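(* Let $k\in\mathbb Z_{\ge0}$ and $m\in\frac52+\mathbb Z_{\ge0}$. Let $\Gamma$ be a discrete subgroup of $\mathrm{SL}_2(\mathbb R)^\sim$. Then the series $\sum_{\gamma\in\Gamma}|F_{k,m}(\gamma g)|$ converges uniformly on compact sets, and $P_\Gamma F_{k,m}\in\mathcal A(\Gamma\backslash\mathrm{SL}_2(\mathbb R)^\sim)$. Moreover, $P_\Gamma F_{k,m}$ is bounded.
   Context: Let $\mathcal H=\{z\in\mathbb C:\Im z>0\}$, let $\mathrm{Hol}(\mathcal H)$ be the space of holomorphic functions on $\mathcal H$, and let $g.z=\frac{az+b}{cz+d}$, $j(g,z)=cz+d$ for $g=\begin{pmatrix}a&b\\c&d\end{pmatrix}$. The square root $\sqrt{\cdot}$ is the branch with values in $\{\Re>0\}\cup\{\Re=0,\Im\ge0\}$, and $z^m:=(\sqrt z)^{2m}$ for half-integral $m$. The metaplectic group is $\mathrm{SL}_2(\mathbb R)^\sim=\{\sigma=(g_\sigma,\eta_\sigma)\in\mathrm{SL}_2(\mathbb R)\times\mathrm{Hol}(\mathcal H):\eta_\sigma(z)^2=j(g_\sigma,z)\ \forall z\in\mathcal H\}$ with multiplication $\sigma_1\sigma_2=(g_{\sigma_1}g_{\sigma_2},\ \eta_{\sigma_1}(g_{\sigma_2}.z)\eta_{\sigma_2}(z))$. An element $\sigma$ is determined by $(g_\sigma,\eta_\sigma(i))$, and we write $\sigma\equiv(g_\sigma,\eta_\sigma(i))$. Put $n_x=\left(\begin{pmatrix}1&x\\0&1\end{pmatrix},1\right)$,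 $a_y=\left(\begin{pmatrix}y^{1/2}&0\\0&y^{-1/2}\end{pmatrix},y^{-1/4}\right)$, $\kappa_t=\left(\begin{pmatrix}\cos t&-\sin t\\\sin t&\cos t\end{pmatrix},e^{it/2}\right)$. The Lie group structure is the one for which $(x,y,t)\mapsto n_xa_y\kappa_t$, $\mathbb R\times\mathbb R_{>0}\times\mathbb R\to\mathrm{SL}_2(\mathbb R)^\sim$, is a local diffeomorphism; $\mathrm{SL}_2(\mathbb R)^\sim$ is then a connected unimodular Lie group doubly covering $\mathrm{SL}_2(\mathbb R)$. $K=\{\kappa_t:t\in\mathbb R\}$ is a maximal compact subgroup. $\mathfrak g$ is the Lie algebra of $\mathrm{SL}_2(\mathbb R)^\sim$, and $Z(\mathfrak g_{\mathbb C})$ is the center of $U(\mathfrak g_{\mathbb C})$, acting on smooth functions by left-invariant differential operators. $\mathcal A(\Gamma\backslash\mathrm{SL}_2(\mathbb R)^\sim)$, the set of square-integrable automorphic forms with respect to $\Gamma$, is the set of all $F\in C^\infty(\Gamma\backslash\mathrm{SL}_2(\mathbb R)^\sim)\cap L^2(\Gamma\backslash\mathrm{SL}_2(\mathbb R)^\sim)$ (smooth left-$\Gamma$-invariant functions, square-integrable on $\Gamma\backslash\mathrm{SL}_2(\mathbb R)^\sim$ for the measure induced by Haar measure) such that $\mathrm{span}_{\mathbb C}\{F(\,\cdot\,\kappa):\kappa\in K\}$ and $\{z.F:z\in Z(\mathfrak g_{\mathbb C})\}$ are finite-dimensional. For $k\in\mathbb Z_{\ge0}$, $f_{k,m}(z)=(2i)^m\frac{(z-i)^k}{(z+i)^{m+k}}$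 for $z\in\mathcal H$, and $F_{k,m}(\sigma)=f_{k,m}(g_\sigma.i)\,\eta_\sigma(i)^{-2m}$ for $\sigma\in\mathrm{SL}_2(\mathbb R)^\sim$. $(P_\Gamma F_{k,m})(\sigma)=\sum_{\gamma\in\Gamma}F_{k,m}(\gamma\sigma)$. *)

(* Defs.v *)
From HB Require Import structures.
From mathcomp Require Import all_boot all_order all_algebra finmap.
From mathcomp Require Import all_classical all_reals all_analysis.
From mathcomp Require Import complex ring lra.
From mathcomp.analysis.showcase Require Import summability.

Set Implicit Arguments.
Unset Strict Implicit.
Unset Printing Implicit Defensive.

Import Order.TTheory GRing.Theory Num.Theory numFieldNormedType.Exports.

Local Open Scope classical_set_scope.
Local Open Scope ring_scope.
Local Open Scope complex_scope.

Notation cRe := complex.Re.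
Notation cIm := complex.Im.

Section ComplexFacts.
Context {R : realType}.
Implicit Types z w : R[i].

Definition cabs z : R := cRe `|z|.

(* The square root with values in {Re > 0} or {Re = 0, Im >= 0}; the library's
   [sqrtC] takes its values in the closed upper half-plane instead. *)
Definition psqrt z : R[i] :=
  let s := sqrtC z in
  if (0 < cRe s) || ((cRe s == 0) && (0 <= cIm s)) then s else - s.

(* For a half-integer m, [twice m] is the integer 2m, since a rational that is
   an integer equals its own numerator. *)
Definition twice (m : rat) : int := numq (2 * m).

Definition hpow z (m : rat) : R[i] := psqrt z ^ twice m.

Lemma psqrt_sqr z : psqrt z ^+ 2 = z.
Proof. by rewrite /psqrt; case: ifP => _; rewrite ?sqrrN sqrtCK. Qed.

Lemma psqrt_Re_ge0 z : 0 <= cRe (psqrt z).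
Proof.
rewrite /psqrt; case: ifPn => [/orP[/ltW//|/andP[/eqP-> //]]|].
rewrite negb_or -leNgt => /andP[+ _].
by case: (sqrtC z) => a b /=; rewrite oppr_ge0.
Qed.

Lemma psqrt_Re_gt0 z : cIm z != 0 -> 0 < cRe (psqrt z).
Proof.
move=> hz; rewrite lt_neqAle psqrt_Re_ge0 andbT eq_sym.
apply: contra hz; have := psqrt_sqr z.
case: (psqrt z) => a b /= <- /eqP ->.
by rewrite expr2 /= mul0r mulr0 addr0.
Qed.

Lemma cabs_norm z : `|z| = (cabs z)%:C.
Proof. by rewrite /cabs normc_def. Qed.

Lemma cRe_le_cabs z : cRe z <= cabs z.
Proof.
apply: le_trans (ler_norm _) _.
by have := normc_ge_Re z; rewrite cabs_norm lecR.
Qed.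

Lemma cIm_le_cabs z : `|cIm z| <= cabs z.
Proof.
rewrite /cabs normc_def /= -sqrtr_sqr ler_wsqrtr // lerDr.
exact: sqr_ge0.
Qed.

End ComplexFacts.
Section UpperHalfPlane.
Context {R : realType}.

Definition uhp := {z : R[i] | 0 < cIm z}.

Lemma uhp_i_subproof : 0 < cIm ('i : R[i]).
Proof. exact: ltr01. Qed.

Definition uhp_i : uhp := exist _ 'i uhp_i_subproof.

Definition holomorphic (f : uhp -> R[i]) : Prop :=
  forall z : uhp, derivable (fun w : R[i]^o => f (insubd z w) : R[i]^o) (val z) 1.

Implicit Types (g h : 'M[R]_2) (z : uhp).

Definition autj g z : R[i] := (g 1 0)%:C * val z + (g 1 1)%:C.

(* Total in [g]; by [mobius_val], for det g = 1 this is (az + b) / (cz + d). *)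
Definition mobius g z : uhp :=
  insubd z (((g 0 0)%:C * val z + (g 0 1)%:C) / autj g z).

Lemma det22 g : \det g = g 0 0 * g 1 1 - g 0 1 * g 1 0.
Proof.
rewrite (expand_det_row _ 0) !big_ord_recl big_ord0 /cofactor !det_mx11 !mxE /=.
rewrite addr0 /= expr0 expr1 mul1r mulN1r mulrN.
by congr (_ * g _ _ - g _ _ * g _ _); apply/val_inj.
Qed.

Lemma ord2_ind (P : 'I_2 -> Prop) : P 0 -> P 1 -> forall i, P i.
Proof.
move=> P0 P1 [[|[|//]] hi].
- by rewrite (_ : Ordinal hi = 0) //; apply/val_inj.
- by rewrite (_ : Ordinal hi = 1) //; apply/val_inj.
Qed.

Lemma mulmx22 g h i j : (g *m h) i j = g i 0 * h 0 j + g i 1 * h 1 j.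
Proof.
rewrite mxE !big_ord_recl big_ord0 addr0.
by congr (_ + g _ _ * h _ _); apply/val_inj.
Qed.

Lemma autj_neq0 g z : \det g = 1 -> autj g z != 0.
Proof.
rewrite det22 /autj => dg; case: z => -[x y] /= y0; apply/eqP => -[].
rewrite !mul0r subr0 !addr0 => e1 e2.
have c0 : g 1 0 = 0 by apply/eqP; move/eqP: e2; rewrite mulf_eq0 (gt_eqF y0) orbF.
move: e1 dg; rewrite c0 mul0r add0r => ->; rewrite !mulr0 subr0 => /esym/eqP.
by rewrite oner_eq0.
Qed.

Lemma mobius_Im g (w : R[i]) : \det g = 1 -> 0 < cIm w ->
  0 < cIm (((g 0 0)%:C * w + (g 0 1)%:C) / ((g 1 0)%:C * w + (g 1 1)%:C)).
Proof.
move=> dg w0; have := autj_neq0 (exist _ w w0 : uhp) dg; rewrite /autj /=.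
move: dg; rewrite det22; case: w w0 => x y /= y0 dg.
rewrite eq_complex /= !mul0r subr0 !addr0 => nz.
set p := g 1 0 * x + g 1 1; set q := g 1 0 * y.
have N0 : 0 < p ^+ 2 + q ^+ 2.
  rewrite lt_neqAle addr_ge0 ?sqr_ge0 // andbT eq_sym.
  by rewrite paddr_eq0 ?sqr_ge0 // !sqrf_eq0.
rewrite (_ : _ + _ = y / (p ^+ 2 + q ^+ 2)) ?divr_gt0 //.
rewrite -[y in RHS]mulr1 -dg; move: (_^-1) => D; rewrite /p /q; ring.
Qed.

Lemma mobius_val g z : \det g = 1 ->
  val (mobius g z) = ((g 0 0)%:C * val z + (g 0 1)%:C) / autj g z.
Proof. by move=> dg; rewrite val_insubd mobius_Im //; case: z. Qed.

Lemma autjM g h z : \det h = 1 -> autj (g *m h) z = autj g (mobius h z) * autj h z.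
Proof.
move=> dh; have := autj_neq0 z dh.
rewrite [LHS]/autj [autj g _]/autj mobius_val // !mulmx22 !rmorphD !rmorphM /= => nz.
rewrite [RHS]mulrDl -[X in _ = X + _]mulrA divfK // /autj /=; ring.
Qed.

Lemma mobiusM g h z : \det g = 1 -> \det h = 1 ->
  mobius (g *m h) z = mobius g (mobius h z).
Proof.
move=> dg dh; apply/val_inj.
have dgh : \det (g *m h) = 1 by rewrite det_mulmx dg dh mulr1.
have nh := autj_neq0 z dh; have ng := autj_neq0 (mobius h z) dg.
rewrite !mobius_val // autjM // invfM mulrCA mulrC; congr (_ / _).
rewrite !mulmx22 !rmorphD !rmorphM /=.
apply: (mulIf nh). rewrite divfK // [RHS]mulrDl -[X in _ = X + _]mulrA divfK // /autj /=; ring.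
Qed.

Lemma autj1 z : autj 1%:M z = 1.
Proof. by rewrite /autj !mxE /= mul0r add0r. Qed.

Lemma mobius1 z : mobius 1%:M z = z.
Proof.
apply/val_inj; rewrite mobius_val ?det1 // autj1 !mxE /= mul1r addr0.
by rewrite invr1 mulr1.
Qed.

Lemma uhp_near z : \forall w \near (val z : R[i]^o), 0 < cIm (w : R[i]).
Proof.
have y0 := valP z.
have e0 : 0 < ((cIm (val z))%:C : R[i]) by rewrite ltcR.
apply: filterS (nbhsx_ballx (val z : R[i]^o) _ e0) => w.
rewrite /ball /= cabs_norm ltcR => lt_w.
have := le_lt_trans (cIm_le_cabs _) lt_w; rewrite raddfB /= ltr_norml.
by move=> /andP[_]; rewrite ltrBlDr ltrDl.
Qed.

Lemma holomorphic_near (f : uhp -> R[i]) (F : R[i] -> R[i]) :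
    (forall w : uhp, f w = F (val w)) ->
    (forall z : uhp, derivable (F : R[i]^o -> R[i]^o) (val z) 1) ->
  holomorphic f.
Proof.
move=> fF dF z; apply: near_eq_derivable (dF z).
near=> w; rewrite fF val_insubd; have -> // : 0 < cIm w.
by near: w; exact: uhp_near.
Unshelve. all: by end_near. Qed.

Lemma derivable_affine (a b z : R[i]) :
  derivable ((fun w => a * w + b) : R[i]^o -> R[i]^o) z 1.
Proof.
exact: derivableD.
Qed.

Lemma holomorphic_cst (a : R[i]) : holomorphic (fun=> a).
Proof. by move=> z; exact: derivable_cst. Qed.

Lemma holomorphicM (f1 f2 : uhp -> R[i]) :
  holomorphic f1 -> holomorphic f2 -> holomorphic (fun z => f1 z * f2 z).
Proof. by move=> h1 h2 z; exact: derivableM (h1 z) (h2 z). Qed.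

Lemma holomorphicV (f : uhp -> R[i]) : (forall z, f z != 0) ->
  holomorphic f -> holomorphic (fun z => (f z)^-1).
Proof. by move=> f0 hf z; apply: derivableV (hf z). Qed.

Lemma holomorphic_mobius (f : uhp -> R[i]) g : \det g = 1 ->
  holomorphic f -> holomorphic (fun z => f (mobius g z)).
Proof.
move=> dg hf z.
pose m (w : R[i]^o) : R[i]^o :=
  ((g 0 0)%:C * w + (g 0 1)%:C) / ((g 1 0)%:C * w + (g 1 1)%:C).
have mz : m (val z) = val (mobius g z) by rewrite mobius_val.
pose F (w : R[i]^o) : R[i]^o := f (insubd (mobius g z) w).
have dm : derivable m (val z) 1.
  apply: (@derivableM _ _ _ (fun w : R[i]^o => ((g 1 0)%:C * w + (g 1 1)%:C)^-1)).
    exact: derivable_affine.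
  apply: derivableV; last exact: derivable_affine.
  exact: autj_neq0.
have : derivable (F \o m) (val z) 1.
  apply/derivable1_diffP/differentiable_comp; first exact/derivable1_diffP.
  by rewrite mz; apply/derivable1_diffP; exact: hf.
apply: near_eq_derivable; near=> w; rewrite /= /F.
have w0 : 0 < cIm w by near: w; exact: uhp_near.
congr f; apply/val_inj; rewrite mobius_val // val_insubd (mobius_Im dg w0).
by rewrite /autj val_insubd w0.
Unshelve. all: by end_near. Qed.

End UpperHalfPlane.
Arguments uhp R : clear implicits.

Record metaplectic (R : realType) := Metaplectic {
  mp_mx : 'M[R]_2;
  mp_eta : uhp R -> R[i];
  mp_det : \det mp_mx = 1;
  mp_holo : holomorphic mp_eta;
  mp_sqr : forall z, mp_eta z ^+ 2 = autj mp_mx z }.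

Section MetaplecticGroup.
Context {R : realType}.
Local Notation Mp := (metaplectic R).
Implicit Types s t u : Mp.

Lemma mp_ext s t :
  mp_mx s = mp_mx t -> (forall z, mp_eta s z = mp_eta t z) -> s = t.
Proof.
case: s t => [g e d h q] [g' e' d' h' q'] /= eg /funext ee; subst g' e'.
by congr Metaplectic; exact: Prop_irrelevance.
Qed.

HB.instance Definition _ := gen_eqMixin Mp.
HB.instance Definition _ := gen_choiceMixin Mp.

Lemma mp_eta_neq0 s z : mp_eta s z != 0.
Proof.
by have := autj_neq0 z (mp_det s); rewrite -mp_sqr expf_eq0.
Qed.

Program Definition mp_one : Mp :=
  @Metaplectic R 1%:M (fun=> 1) (det1 _ _) (@holomorphic_cst R 1) _.
Next Obligation. by move=> z; rewrite expr1n autj1. Qed.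

Program Definition mp_mul s t : Mp :=
  @Metaplectic R (mp_mx s *m mp_mx t)
    (fun z => mp_eta s (mobius (mp_mx t) z) * mp_eta t z) _ _ _.
Next Obligation. by move=> s t; rewrite det_mulmx !mp_det mulr1. Qed.
Next Obligation.
move=> s t; apply: holomorphicM; last exact: mp_holo.
by apply: holomorphic_mobius; [exact: mp_det|exact: mp_holo].
Qed.
Next Obligation.
by move=> s t z; rewrite exprMn !mp_sqr autjM // mp_det.
Qed.

Lemma mp_mx_unit s : mp_mx s \in unitmx.
Proof. by rewrite unitmxE mp_det unitr1. Qed.

Lemma mp_detV s : \det (invmx (mp_mx s)) = 1.
Proof. by rewrite det_inv mp_det invr1. Qed.

Program Definition mp_inv s : Mp :=
  @Metaplectic R (invmx (mp_mx s))
    (fun z => (mp_eta s (mobius (invmx (mp_mx s)) z))^-1) (mp_detV s) _ _.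
Next Obligation.
move=> s; apply: holomorphicV => [z|]; first exact: mp_eta_neq0.
by apply: holomorphic_mobius; [exact: mp_detV|exact: mp_holo].
Qed.
Next Obligation.
move=> s z; have nz := autj_neq0 (mobius (invmx (mp_mx s)) z) (mp_det s).
apply: (mulfI nz); rewrite -autjM ?mp_detV // mulmxV ?mp_mx_unit // autj1.
by rewrite exprVn mp_sqr mulfV.
Qed.

Lemma mp_mulA : associative mp_mul.
Proof.
move=> s t u; apply: mp_ext => [|z] /=; first exact: mulmxA.
by rewrite mobiusM ?mp_det // mulrA.
Qed.

Lemma mp_mul1 : left_id mp_one mp_mul.
Proof. by move=> s; apply: mp_ext => [|z] /=; rewrite ?mul1mx ?mul1r. Qed.

Lemma mp_mulr1 : right_id mp_one mp_mul.
Proof. by move=> s; apply: mp_ext => [|z] /=; rewrite ?mulmx1 ?mobius1 ?mulr1. Qed.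

Lemma mp_mulV : left_inverse mp_one mp_inv mp_mul.
Proof.
move=> s; apply: mp_ext => [|z] /=; first by rewrite mulVmx ?mp_mx_unit.
rewrite -mobiusM ?mp_detV ?mp_det // mulVmx ?mp_mx_unit // mobius1.
by rewrite mulVf // mp_eta_neq0.
Qed.

Lemma mp_mulrV : right_inverse mp_one mp_inv mp_mul.
Proof.
move=> s; apply: mp_ext => [|z] /=; first by rewrite mulmxV ?mp_mx_unit.
by rewrite mulfV // mp_eta_neq0.
Qed.

HB.instance Definition _ :=
  isGroup.Build Mp mp_mulA mp_mul1 mp_mulr1 mp_mulV mp_mulrV.

HB.instance Definition _ := isPointed.Build Mp mp_one.

End MetaplecticGroup.

Section Lift.
Context {R : realType}.
Local Notation Mp := (metaplectic R).

Lemma psqrtD_neq0 (z w : R[i]) : cIm z != 0 -> psqrt w + psqrt z != 0.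
Proof.
move=> hz; have := psqrt_Re_gt0 hz; have := psqrt_Re_ge0 w.
case: (psqrt z) (psqrt w) => a b [c d] /= c0 a0; rewrite eq_complex /=.
by rewrite (gt_eqF (ltr_wpDl c0 a0)).
Qed.

Lemma psqrtB (z w : R[i]) : cIm z != 0 ->
  psqrt w - psqrt z = (w - z) / (psqrt w + psqrt z).
Proof.
move=> hz; apply: (mulIf (psqrtD_neq0 w hz)); rewrite divfK ?psqrtD_neq0 //.
by rewrite -subr_sqr !psqrt_sqr.
Qed.

Lemma continuous_psqrt (z : R[i]) : cIm z != 0 ->
  (psqrt w : R[i]^o) @[w --> (z : R[i]^o)] --> (psqrt z : R[i]^o).
Proof.
move=> hz; have r0 := psqrt_Re_gt0 hz; set r := cRe _ in r0.
have rC0 : 0 < r%:C :> R[i] by rewrite ltcR.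
have FF : Filter (nbhs (z : R[i]^o)) by exact: nbhs_filter.
refine (iffRL (@cvgrPdist_lt _ (R[i]^o) _ _ FF (fun w : R[i]^o => psqrt w : R[i]^o) (psqrt z : R[i]^o)) _) => e e0.
have nz : \forall w \near (z : R[i]^o), `|w - z| < e * r%:C.
  apply: filterS (nbhsx_ballx (z : R[i]^o) _ (mulr_gt0 e0 rC0)) => w.
  by rewrite /ball /= distrC.
near=> w; rewrite distrC psqrtB // normf_div.
rewrite ltr_pdivrMr ?normr_gt0 ?psqrtD_neq0 //.
apply: (@lt_le_trans _ _ (e * r%:C)).
  by near: w.
rewrite ler_pM2l // cabs_norm lecR; apply: le_trans (cRe_le_cabs _).
have := psqrt_Re_ge0 w; rewrite /r.
by case: (psqrt z) (psqrt w) => a b [c d] /= c0; rewrite lerDr.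
Unshelve. all: by end_near. Qed.

Lemma derivable_psqrt (z : R[i]) : cIm z != 0 ->
  derivable (psqrt : R[i]^o -> R[i]^o) z 1.
Proof.
move=> hz; apply/cvg_ex; exists ((psqrt z + psqrt z)^-1 : R[i]^o).
have shift0 : (h + z : R[i]^o) @[h --> (0 : R[i]^o)^'] --> (z : R[i]^o).
  rewrite -[X in _ --> X]add0r; apply: cvgD; last exact: cvg_cst.
  exact: nbhs_dnbhs.
have cv : ((psqrt (h + z) + psqrt z)^-1 : R[i]^o) @[h --> (0 : R[i]^o)^'] -->
    ((psqrt z + psqrt z)^-1 : R[i]^o).
  apply: cvgV; first exact: psqrtD_neq0.
  apply: cvgD; last exact: cvg_cst.
  exact: cvg_comp shift0 (continuous_psqrt hz).
apply: cvg_trans cv; apply: near_eq_cvg; near=> h.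
have h0 : h != 0 by near: h; exact: nbhs_dnbhs_neq.
rewrite /shift /=.
have -> : (h *: (1 : R[i]^o) + z : R[i]^o) = h + z by rewrite /GRing.scale /= mulr1.
by rewrite psqrtB // addrK /GRing.scale /= mulKf.
Unshelve. all: by end_near. Qed.

Lemma holomorphic_psqrt_autj (g : 'M[R]_2) :
  holomorphic (fun z => psqrt (autj g z)).
Proof.
have [c0|c0] := eqVneq (g 1 0) 0.
  rewrite (_ : (fun z => _) = fun=> psqrt (g 1 1)%:C); first exact: holomorphic_cst.
  by apply/funext => z; rewrite /autj c0 mul0r add0r.
apply: (@holomorphic_near _ _
  (fun w => psqrt ((g 1 0)%:C * w + (g 1 1)%:C))) => // z.
have jz : cIm (autj g z) != 0.
  rewrite /autj; case: z => -[x y] /= y0.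
  by rewrite mul0r !addr0 mulf_neq0 // gt_eqF.
have dpsqrt : derivable (psqrt : R[i]^o -> R[i]^o) (autj g z) 1.
  exact: derivable_psqrt.
have /derivable1_diffP 
    := @derivable_affine R (g 1 0)%:C (g 1 1)%:C (val z).
move=> /differentiable_comp/(_ (iffLR (derivable1_diffP _ _) dpsqrt)).
by move/derivable1_diffP.
Qed.

(* The element "(g, w)", i.e. the one with matrix [g] and eta(i) = w. *)
Program Definition mp_lift (g : 'M[R]_2) (w : R[i]) (dg : \det g = 1)
    (hw : w ^+ 2 = autj g uhp_i) : Mp :=
  @Metaplectic R g
    (fun z => w / psqrt (autj g uhp_i) * psqrt (autj g z)) dg _ _.
Next Obligation.
move=> g w dg hw; apply: holomorphicM; first exact: holomorphic_cst.
exact: holomorphic_psqrt_autj.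
Qed.
Next Obligation.
move=> g w dg hw z; rewrite !exprMn exprVn !psqrt_sqr hw divff ?mul1r //.
exact: autj_neq0.
Qed.

Lemma mp_lift_eta_i g w dg hw : mp_eta (@mp_lift g w dg hw) uhp_i = w.
Proof.
have := autj_neq0 uhp_i dg; rewrite -[X in X != 0]psqrt_sqr expf_eq0 /=.
by move=> nz; rewrite divfK.
Qed.

End Lift.

Section Iwasawa.
Context {R : realType}.
Local Notation Mp := (metaplectic R).

Definition mx22 (a b c d : R) : 'M[R]_2 :=
  \matrix_(i, j) if i == 0 then (if j == 0 then a else b)
                 else (if j == 0 then c else d).

Lemma det_mx22 a b c d : \det (mx22 a b c d) = a * d - b * c.
Proof. by rewrite det22 !mxE. Qed.

Lemma autj_mx22_i a b c d : autj (mx22 a b c d) uhp_i = d +i* c.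
Proof.
rewrite /autj !mxE /=; apply/eqP; rewrite eq_complex /=.
by apply/andP; split; apply/eqP; ring.
Qed.

Program Definition mp_n (x : R) : Mp := @mp_lift R (mx22 1 x 0 1) 1 _ _.
Next Obligation. by move=> x; rewrite det_mx22 mulr0 subr0 mulr1. Qed.
Next Obligation. by move=> x; rewrite autj_mx22_i expr1n. Qed.

Program Definition mp_a (y : R) (y0 : 0 < y) : Mp :=
  @mp_lift R (mx22 (Num.sqrt y) 0 0 (Num.sqrt y)^-1)
    ((Num.sqrt (Num.sqrt y))^-1)%:C _ _.
Next Obligation.
by move=> y y0; rewrite det_mx22 mulr0 subr0 mulfV // gt_eqF // sqrtr_gt0.
Qed.
Next Obligation.
by move=> y y0; rewrite autj_mx22_i -rmorphXn exprVn sqr_sqrtr // sqrtr_ge0.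
Qed.

Program Definition mp_kappa (t : R) : Mp :=
  @mp_lift R (mx22 (cos t) (- sin t) (sin t) (cos t))
    (cos (t / 2) +i* sin (t / 2)) _ _.
Next Obligation.
by move=> t; rewrite det_mx22 mulNr opprK -!expr2 cos2Dsin2.
Qed.
Next Obligation.
move=> t; rewrite autj_mx22_i.
have -> : t = t / 2 + t / 2 by rewrite -splitr.
rewrite cosD sinD -splitr expr2; apply/eqP; rewrite eq_complex /= eqxx /=.
by rewrite addrC.
Qed.

Definition mp_K : set Mp := range mp_kappa.

(* (x, y, t) |-> n_x a_y kappa_t, with a junk value for y <= 0. *)
Definition iwasawa (p : R * R * R) : Mp :=
  if pselect (0 < p.1.2) is left y0
  then (mp_n p.1.1 * mp_a y0 * mp_kappa p.2)%g else 1%g.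

Definition iwasawa_dom : set (R * R * R) := [set p | 0 < p.1.2].

Lemma open_iwasawa_dom : open iwasawa_dom.
Proof.
apply: (@open_comp _ _ (fun p : R * R * R => p.1.2) [set y | 0 < y]).
  move=> p _; apply: (@continuous_comp _ _ _ fst snd); first exact: cvg_fst.
  exact: cvg_snd.
exact: open_gt.
Qed.

(* As [iwasawa] is onto and is to be a local diffeomorphism on [iwasawa_dom],
   the topology of the metaplectic group is the quotient topology. *)
Definition mp_open (U : set Mp) : Prop := open (iwasawa_dom `&` iwasawa @^-1` U).

Lemma mp_openT : mp_open setT.
Proof. by rewrite /mp_open preimage_setT setIT; exact: open_iwasawa_dom. Qed.

Lemma mp_openI : setI_closed mp_open.
Proof.
move=> U V oU oV; rewrite /mp_open preimage_setI setIIr; exact: openI.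
Qed.

Lemma mp_open_bigU (I : Type) (f : I -> set Mp) :
  (forall i, mp_open (f i)) -> mp_open (\bigcup_i f i).
Proof.
move=> of_; rewrite /mp_open preimage_bigcup setI_bigcupr.
by apply: bigcup_open => i _; exact: of_.
Qed.

HB.instance Definition _ :=
  isOpenTopological.Build Mp mp_openT mp_openI mp_open_bigU.

(* C^n functions on the open set [iwasawa_dom], by iterated partial derivatives;
   the values outside that set are irrelevant. *)
Fixpoint Cn (n : nat) (h : R * R * R -> R) : Prop :=
  (forall p, iwasawa_dom p -> {for p, continuous h}) /\
  if n is n'.+1 then
    forall v : R * R * R, v \in [:: (1, 0, 0); (0, 1, 0); (0, 0, 1)] ->
      (forall p, iwasawa_dom p -> derivable h p v) /\ Cn n' (fun p => 'D_v h p)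
  else True.

Definition mp_smooth (F : Mp -> R[i]) : Prop :=
  forall n, Cn n (fun p => cRe (F (iwasawa p))) /\
            Cn n (fun p => cIm (F (iwasawa p))).

End Iwasawa.

(* The universal enveloping algebra of g_C, g = sl_2(R), presented by the basis
   E, H, W of g: expressions in the free C-algebra on E, H, W, up to the
   congruence [uenv_eq] generated by the algebra axioms and XY - YX = [X, Y]. *)
Inductive sl2 := slE | slH | slW.

Inductive uenv (R : realType) :=
| UScal of R[i]
| UGen of sl2
| UAdd of uenv R & uenv R
| UMul of uenv R & uenv R.
Arguments UGen {R}.

Section Enveloping.
Context {R : realType}.
Local Notation Mp := (metaplectic R).

Definition sl2_mx (a : sl2) : 'M[R]_2 :=
  match a with
  | slE => mx22 0 1 0 0
  | slH => mx22 1 0 0 (-1)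
  | slW => mx22 0 (-1) 1 0
  end.

Definition sl2_coord (X : 'M[R]_2) (a : sl2) : R :=
  match a with slE => X 0 1 + X 1 0 | slH => X 0 0 | slW => X 1 0 end.

Lemma sl2_coordP (X : 'M[R]_2) : \tr X = 0 ->
  X = sl2_coord X slE *: sl2_mx slE + sl2_coord X slH *: sl2_mx slH
      + sl2_coord X slW *: sl2_mx slW.
Proof.
rewrite /mxtrace !big_ord_recl big_ord0 addr0.
have -> : lift ord0 ord0 = 1 :> 'I_2 by apply/val_inj.
move=> tr0; apply/matrixP => i j.
by elim/ord2_ind: i; elim/ord2_ind: j; rewrite !mxE /=; lra.
Qed.

Definition sl2_bracket (a b : sl2) : 'M[R]_2 :=
  sl2_mx a *m sl2_mx b - sl2_mx b *m sl2_mx a.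

Definition UVec (X : 'M[R]_2) : uenv R :=
  UAdd (UMul (UScal (sl2_coord X slE)%:C) (UGen slE))
    (UAdd (UMul (UScal (sl2_coord X slH)%:C) (UGen slH))
          (UMul (UScal (sl2_coord X slW)%:C) (UGen slW))).

Inductive uenv_eq : uenv R -> uenv R -> Prop :=
| ueq_refl u : uenv_eq u u
| ueq_sym u v : uenv_eq u v -> uenv_eq v u
| ueq_trans u v w : uenv_eq u v -> uenv_eq v w -> uenv_eq u w
| ueq_add u u' v v' :
    uenv_eq u u' -> uenv_eq v v' -> uenv_eq (UAdd u v) (UAdd u' v')
| ueq_mul u u' v v' :
    uenv_eq u u' -> uenv_eq v v' -> uenv_eq (UMul u v) (UMul u' v')
| ueq_addC u v : uenv_eq (UAdd u v) (UAdd v u)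
| ueq_addA u v w : uenv_eq (UAdd u (UAdd v w)) (UAdd (UAdd u v) w)
| ueq_add0 u : uenv_eq (UAdd (UScal 0) u) u
| ueq_mulA u v w : uenv_eq (UMul u (UMul v w)) (UMul (UMul u v) w)
| ueq_mulDl u v w : uenv_eq (UMul (UAdd u v) w) (UAdd (UMul u w) (UMul v w))
| ueq_mulDr u v w : uenv_eq (UMul u (UAdd v w)) (UAdd (UMul u v) (UMul u w))
| ueq_mul1 u : uenv_eq (UMul (UScal 1) u) u
| ueq_mul0 u : uenv_eq (UMul (UScal 0) u) (UScal 0)
| ueq_scalD c d : uenv_eq (UAdd (UScal c) (UScal d)) (UScal (c + d))
| ueq_scalM c d : uenv_eq (UMul (UScal c) (UScal d)) (UScal (c * d))
| ueq_scalC c u : uenv_eq (UMul (UScal c) u) (UMul u (UScal c))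
| ueq_lie a b : uenv_eq (UMul (UGen a) (UGen b))
    (UAdd (UMul (UGen b) (UGen a)) (UVec (sl2_bracket a b))).

Definition uenv_center : set (uenv R) :=
  [set z | forall u, uenv_eq (UMul z u) (UMul u z)].

(* The one-parameter subgroup exp(tX) for X = E, H, W; the lift to the
   metaplectic group of a one-parameter subgroup of SL_2(R) is unique. *)
Definition mp_exp (a : sl2) (t : R) : Mp :=
  match a with
  | slE => mp_n t
  | slH => mp_a (expR_gt0 (2 * t))
  | slW => mp_kappa t
  end.

Lemma mp_exp_tangent a i j :
  is_derive (0 : R) 1 (fun t => mp_mx (mp_exp a t) i j) (sl2_mx a i j).
Proof.
have sqrt_exp t : Num.sqrt (expR (2 * t)) = expR t :> R.
  by rewrite expRM_natl sqrtr_sqr ger0_norm // expR_ge0.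
have sinN : is_derive (0 : R) 1 (fun t => - sin t) (- 1 : R).
  by apply: is_derive_eq; rewrite cos0.
have expV : is_derive (0 : R) 1 (fun t => (expR t)^-1) (- 1 : R).
  under eq_fun do rewrite -expRN.
  by apply: is_derive_eq; rewrite oppr0 expR0 ?mul1r ?mulr1 ?mulN1r.
case: a; elim/ord2_ind: i; elim/ord2_ind: j; rewrite [sl2_mx _]/= [mx22 _ _ _ _ _ _]mxE /=;
  under eq_fun do rewrite mxE /= ?sqrt_exp.
all: try exact: is_derive_cst.
all: try by apply: is_derive_eq; rewrite ?expR0 ?cos0 ?sin0 ?oppr0.
Qed.

Definition mp_deriv (a : sl2) (F : Mp -> R[i]) : Mp -> R[i] := fun s =>
  (derive1 (fun t => cRe (F (s * mp_exp a t)%g)) 0)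
  +i* (derive1 (fun t => cIm (F (s * mp_exp a t)%g)) 0).

Fixpoint uenv_act (u : uenv R) (F : Mp -> R[i]) : Mp -> R[i] :=
  match u with
  | UScal c => fun s => c * F s
  | UGen a => mp_deriv a F
  | UAdd u v => fun s => uenv_act u F s + uenv_act v F s
  | UMul u v => uenv_act u (uenv_act v F)
  end.

Definition finite_dim_span (S : set (Mp -> R[i])) : Prop :=
  exists n (B : 'I_n -> Mp -> R[i]), forall F, S F ->
    exists c : 'I_n -> R[i], forall s, F s = \sum_i c i * B i s.

End Enveloping.

Section Automorphic.
Context {R : realType}.
Local Notation Mp := (metaplectic R).
Implicit Types (Gam : set Mp) (F : Mp -> R[i]).

Definition mp_subgroup Gam : Prop :=
  Gam 1%g /\ forall s t, Gam s -> Gam t -> Gam (s * t^-1)%g.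

Definition discrete_subgroup Gam : Prop :=
  mp_subgroup Gam /\ Gam `<=` isolated Gam.

Definition left_invariant Gam F : Prop :=
  forall g s, Gam g -> F (g * s)%g = F s.

Definition mp_borel := g_sigma_algebraType (@open Mp).

Definition haar_measure (mu : {measure set mp_borel -> \bar R}) : Prop :=
  [/\ forall (s : Mp) (A : set mp_borel), measurable A ->
        mu ([set t | A (s * t)%g] : set Mp) = mu A,
      forall C : set Mp, compact C -> (mu C < +oo)%E &
      forall U : set Mp, open U -> U !=set0 -> (0 < mu U)%E].

(* The Borel sets of Gam \ Mp, as left-Gam-invariant subsets of Mp: the open
   sets of the quotient correspond to the invariant open sets. *)
Definition quot_borel Gam := g_sigma_algebraType
  [set U : set Mp | open U /\ forall g s, Gam g -> U s -> U (g * s)%g].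

(* The measure on Gam \ Mp induced by [mu] is characterized by the unfolding
   formula for nonnegative phi in C_c(Mp). *)
Definition quotient_measure Gam (mu : {measure set mp_borel -> \bar R})
    (nu : {measure set (quot_borel Gam) -> \bar R}) : Prop :=
  forall phi : Mp -> R, continuous phi -> (forall s, 0 <= phi s) ->
    compact (closure [set s | phi s != 0]) ->
  (\int[mu]_s (phi s)%:E =
   \int[nu]_s \esum_(g in Gam) (phi (g * s)%g)%:E)%E.

Definition square_integrable Gam (mu : {measure set mp_borel -> \bar R}) F : Prop :=
  exists2 nu : {measure set (quot_borel Gam) -> \bar R},
    quotient_measure mu nu & (\int[nu]_s (cabs (F s) ^+ 2)%:E < +oo)%E.

Definition automorphic_form Gam (mu : {measure set mp_borel -> \bar R}) F : Prop :=
  [/\ mp_smooth F /\ left_invariant Gam F,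
      square_integrable Gam mu F,
      finite_dim_span [set (fun s => F (s * k)%g) | k in mp_K] &
      finite_dim_span [set uenv_act z F | z in uenv_center]].

Definition poincare Gam F : Mp -> R[i] :=
  fun s => sum (fun g : Gam => F (val g * s)%g : R[i]^o).

(* A series of nonnegative terms: its sum does not depend on an enumeration of
   Gam, so convergence is taken along the finite subsets of Gam. *)
Definition abs_series_cvg_compact Gam F : Prop :=
  exists S : Mp -> R, forall C : set Mp, compact C ->
    {uniform C, (fun (B : {fset Gam}) s =>
       partial_sum (fun g : Gam => cabs (F (val g * s)%g)) B) @ totally --> S}.

Definition f_km (k : nat) (m : rat) (z : uhp R) : R[i] :=
  hpow (2 * 'i) m * ((val z - 'i) ^+ k / hpow (val z + 'i) (m + k%:R)).

Definition F_km (k : nat) (m : rat) : Mp -> R[i] := fun s =>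
  f_km k m (mobius (mp_mx s) uhp_i) * mp_eta s uhp_i ^ (- twice m).

End Automorphic.

(* Main.v *)
Require Import Defs.
From HB Require Import structures.
From mathcomp Require Import all_boot all_order all_algebra finmap.
From mathcomp Require Import all_classical all_reals all_analysis.
From mathcomp Require Import measurable_realfun.
From mathcomp Require Import complex zify ring lra.
From mathcomp.analysis.showcase Require Import summability.

Set Implicit Arguments.
Unset Strict Implicit.
Unset Printing Implicit Defensive.

Import Order.TTheory GRing.Theory Num.Theory numFieldNormedType.Exports.
Local Open Scope classical_set_scope.
Local Open Scope ring_scope.

(* In the model SU(1,1), let al and be be the entries in the first column and put
   theta = al ^ (- 1/2), which is well defined on the metaplectic group and bounded by 1. Then
   F_(k,m) = be ^ k theta ^ (2m + 2k), hence |F_(k,m)| <= |theta| ^ 5. Cut the group into cells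
   by rounding Iwasawa coordinates. The suprema of |theta| ^ 5 over the cells are summable; as
   Gamma is discrete, a fine enough grid has at most one element of s Gamma in each cell, for
   every s; and |theta| is invariant under inversion. So the sum of |theta (gamma s)| ^ 5 over
   Gamma is bounded uniformly in s, which gives the convergence and the bound.

   The functions be ^ a (conj be) ^ b theta ^ (n + 2a + 2b) have the same majorant, and their
   derivatives along curves are combinations of functions of this kind, so the series may be
   differentiated termwise: it is smooth, and under g it generates a module in which it spans the
   space of lowest weight. A central element commutes with W, preserves that space, and so acts
   by a scalar. K acts by a character.

   The measure on the quotient is w mu, where w (s) = |theta s| ^ 5 / sum |theta (gamma s)| ^ 5
   has orbit sums 1. Since |P_Gamma F| is at most the denominator of w, |P_Gamma F| ^ 2 w is at
   most a multiple of |theta| ^ 5, which is mu-integrable because the group is covered by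
   translates of one compact set, one for each cell of the upper half-plane. *)

(** * Limits and derivatives of complex-valued functions *)

(** The exponent 5 is the least integer that works: |theta| ^ n is |al| ^ (- n/2), and the ball |al|
    <= r has hyperbolic area of order r ^ 2, so the sum over the cells converges only for n > 4. The
    hypothesis on m supplies exactly 2m >= 5. Nothing is known of Gamma beyond discreteness, so
    there is no fundamental domain to compute with: the cells control the summation, and the weight
    w takes the place of the indicator function of a fundamental domain. The Haar measure is
    likewise given by its axioms alone, so the majorant can only be integrated through invariance
    and the finite measure of a compact set. The action of g is therefore lifted to arrays of formal
    coefficients, on which it is given by explicit operators; centrality is exploited there and the
    result is carried back to functions. *)

Section ComplexToolkit.
Local Open Scope complex_scope.
Context {R : realType}.
Implicit Types (z w : R[i]).

Lemma cabsC z : (cabs z)%:C = `|z|.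
Proof. by rewrite cabs_norm. Qed.

Lemma cabs_ge0 z : 0 <= cabs z.
Proof. by rewrite -lecR cabsC normr_ge0. Qed.

Lemma cabsM z w : cabs (z * w) = cabs z * cabs w.
Proof. by apply: complexI; rewrite rmorphM /= !cabsC normrM. Qed.

Lemma cabsD z w : cabs (z + w) <= cabs z + cabs w.
Proof. by rewrite -lecR rmorphD /= !cabsC ler_normD. Qed.

Lemma cabsN z : cabs (- z) = cabs z.
Proof. by apply: complexI; rewrite !cabsC normrN. Qed.

Lemma cabsB z w : cabs (z - w) = cabs (w - z).
Proof. by rewrite -cabsN opprB. Qed.

Lemma cabs0 : cabs (0 : R[i]) = 0.
Proof. by apply: complexI; rewrite cabsC normr0. Qed.

Lemma cabs1 : cabs (1 : R[i]) = 1.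
Proof. by apply: complexI; rewrite cabsC normr1. Qed.

Lemma cabsV z : cabs z^-1 = (cabs z)^-1.
Proof. by apply: complexI; rewrite fmorphV /= !cabsC normfV. Qed.

Lemma cabsX z n : cabs (z ^+ n) = cabs z ^+ n.
Proof. by apply: complexI; rewrite rmorphXn /= !cabsC normrX. Qed.

Lemma cabs_real (x : R) : cabs x%:C = `|x|.
Proof. by apply: complexI; rewrite cabsC normc_def /= expr0n /= addr0 sqrtr_sqr. Qed.

Lemma cabs_gt0 z : (0 < cabs z) = (z != 0).
Proof. by rewrite -[RHS]normr_gt0 -cabsC ltcR. Qed.

Lemma cabs_eq0 z : (cabs z == 0) = (z == 0).
Proof. by rewrite -[RHS]normr_eq0 -cabsC (inj_eq (@complexI _)). Qed.

Lemma cabs_sqr z : cabs z ^+ 2 = cRe z ^+ 2 + cIm z ^+ 2.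
Proof. by rewrite /cabs normc_def /= sqr_sqrtr // addr_ge0 // sqr_ge0. Qed.

Lemma cabs_conj z : cabs (conjc z) = cabs z.
Proof.
apply/eqP; rewrite -(@eqrXn2 _ 2) ?cabs_ge0 // !cabs_sqr.
by case: z => a b /=; rewrite sqrrN.
Qed.

Lemma cabs_leD z w : cabs z <= cabs w + cabs (z - w).
Proof. by apply: le_trans (cabsD _ _); rewrite addrC subrK. Qed.

Lemma norm_cRe z : `|cRe z| <= cabs z.
Proof. by have := normc_ge_Re z; rewrite -cabsC lecR. Qed.

Lemma cabs_le_ReIm z : cabs z <= `|cRe z| + `|cIm z|.
Proof.
have {1}-> : z = (cRe z)%:C + 'i * (cIm z)%:C by rewrite -complexE.
apply: le_trans (cabsD _ _) _; rewrite cabsM !cabs_real.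
suff -> : cabs ('i : R[i]) = 1 by rewrite mul1r.
by apply/eqP; rewrite -(@eqrXn2 _ 2) ?cabs_ge0 // cabs_sqr /= expr0n /= add0r expr1n.
Qed.

Lemma cabs_sum (I : Type) (r : seq I) (P : pred I) (f : I -> R[i]) :
  cabs (\sum_(i <- r | P i) f i) <= \sum_(i <- r | P i) cabs (f i).
Proof.
elim/big_rec2: _ => [|i x z _ h]; first by rewrite cabs0.
by apply: le_trans (cabsD _ _) _; rewrite lerD2l.
Qed.

Lemma cRe_sum (I : Type) (r : seq I) (P : pred I) (f : I -> R[i]) :
  cRe (\sum_(i <- r | P i) f i) = \sum_(i <- r | P i) cRe (f i).
Proof. exact: (raddf_sum (@complex.Re R)). Qed.

Lemma cIm_sum (I : Type) (r : seq I) (P : pred I) (f : I -> R[i]) :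
  cIm (\sum_(i <- r | P i) f i) = \sum_(i <- r | P i) cIm (f i).
Proof. exact: (raddf_sum (@complex.Im R)). Qed.

Lemma cReM z w : cRe (z * w) = cRe z * cRe w - cIm z * cIm w.
Proof. by case: z w => a b [c d]. Qed.

Lemma cImM z w : cIm (z * w) = cRe z * cIm w + cIm z * cRe w.
Proof. by case: z w => a b [c d]. Qed.

Lemma ceq z w : cRe z = cRe w -> cIm z = cIm w -> z = w.
Proof. by case: z w => a b [c d] /= -> ->. Qed.

(** The bound [e] is real, whereas the norm of [R[i]] takes its values in [R[i]]; [ccvgP] identifies
    this with convergence in the normed space. *)
Definition ccvg (T : Type) (F : set_system T) (f : T -> R[i]) (l : R[i]) : Prop :=
  forall e : R, 0 < e -> \forall x \near F, cabs (f x - l) < e.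

Section Ccvg.
Variables (T : Type) (F : set_system T).
Context {FF : Filter F}.
Implicit Types f g : T -> R[i].

Lemma ccvgP f l :
  ccvg F f l <-> ((f x : R[i]^o) @[x --> F] --> (l : R[i]^o)).
Proof.
split=> h.
  refine (iffRL (@cvgrPdist_lt _ (R[i]^o) T F FF (fun x => f x : R[i]^o) (l : R[i]^o)) _).
  move=> e e0.
  have [er e0'] : e = (cRe e)%:C /\ 0 < cRe e.
    case: e e0 => a b; rewrite ltcE /= => /andP[/eqP-> a0].
    by split.
  have := h _ e0'; apply: (@filterS T F FF) => x; rewrite distrC -cabsC er ltcR.
  exact.
move=> e e0.
have e0C : 0 < e%:C :> R[i] by rewrite ltcR.
have := iffLR (@cvgrPdist_lt _ (R[i]^o) T F FF (fun x => f x : R[i]^o) (l : R[i]^o)) h _ e0C.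
by apply: filterS => x; rewrite distrC -cabsC ltcR.
Qed.

Lemma ccvg_ReIm f l : ccvg F f l <->
  (cRe (f x) @[x --> F] --> cRe l) /\ (cIm (f x) @[x --> F] --> cIm l).
Proof.
split=> [h|[h1 h2] e e0].
  split; apply/cvgrPdist_lt => e e0; have := h e e0; apply: filterS => x hx.
    apply: le_lt_trans hx; rewrite -normrN opprB -raddfB; exact: norm_cRe.
  apply: le_lt_trans hx; rewrite -normrN opprB -raddfB; exact: cIm_le_cabs.
have e2 : 0 < e / 2 by rewrite divr_gt0.
move/cvgrPdist_lt/(_ _ e2): h1 => h1; move/cvgrPdist_lt/(_ _ e2): h2 => h2.
near=> x; apply: le_lt_trans (cabs_le_ReIm _) _.
rewrite (splitr e) ltrD //; rewrite raddfB /= -normrN opprB; near: x; done.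
Unshelve. all: by end_near. Qed.

Lemma ccvg_cst c : ccvg F (fun=> c) c.
Proof. by move=> e e0; near=> x; rewrite subrr cabs0. Unshelve. all: by end_near. Qed.

Lemma ccvgD f g a b : ccvg F f a -> ccvg F g b ->
  ccvg F (fun x => f x + g x) (a + b).
Proof. by move=> /ccvgP h1 /ccvgP h2; apply/ccvgP; exact: cvgD h1 h2. Qed.

Lemma ccvgN f a : ccvg F f a -> ccvg F (fun x => - f x) (- a).
Proof. by move=> /ccvgP h1; apply/ccvgP; exact: cvgN h1. Qed.

Lemma ccvgM f g a b : ccvg F f a -> ccvg F g b ->
  ccvg F (fun x => f x * g x) (a * b).
Proof.
move=> /ccvgP h1 /ccvgP h2; apply/ccvgP.
exact: (@cvgM R[i] T F FF _ _ _ _ h1 h2).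
Qed.

Lemma ccvgV f a : a != 0 -> ccvg F f a -> ccvg F (fun x => (f x)^-1) a^-1.
Proof.
by move=> a0 /ccvgP h1; apply/ccvgP; exact: (@cvgV R[i] T F FF _ _ a0 h1).
Qed.

Lemma ccvgX f a n : ccvg F f a -> ccvg F (fun x => f x ^+ n) (a ^+ n).
Proof.
move=> h; elim: n => [|n ih]; first exact: ccvg_cst.
rewrite exprS (_ : (fun x => _) = fun x => f x * f x ^+ n); first exact: ccvgM.
by apply/funext => x; rewrite exprS.
Qed.

Lemma ccvg_conj f a : ccvg F f a -> ccvg F (fun x => conjc (f x)) (conjc a).
Proof. by move=> h e /h; apply: filterS => x; rewrite -rmorphB /= cabs_conj. Qed.

Lemma ccvg_real (h : T -> R) (x : R) : h t @[t --> F] --> x -> ccvg F (fun t => (h t)%:C) x%:C.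
Proof. by move=> hx; apply/ccvg_ReIm; split=> //=; exact: cvg_cst. Qed.

Lemma ccvg_eq f g a : (\forall x \near F, f x = g x) -> ccvg F f a -> ccvg F g a.
Proof.
move=> fg h e /h; apply: filterS2 fg => x -> //.
Qed.

Lemma ccvg_congr f g a b : (forall x, f x = g x) -> a = b -> ccvg F f a -> ccvg F g b.
Proof. by move=> /funext-> ->. Qed.

Lemma ccvg_cabs f a : ccvg F f a -> cabs (f x) @[x --> F] --> cabs a.
Proof.
move=> h; apply/cvgrPdist_lt => e /h; apply: filterS => x; apply: le_lt_trans.
rewrite ler_distl; apply/andP; split; first by rewrite lerBlDr; exact: cabs_leD.
by rewrite cabsB; exact: cabs_leD.
Qed.

Lemma ccvg_sum (I : Type) (r : seq I) (f : I -> T -> R[i]) (l : I -> R[i]) :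
  (forall i, ccvg F (f i) (l i)) ->
  ccvg F (fun x => \sum_(i <- r) f i x) (\sum_(i <- r) l i).
Proof.
move=> h; elim: r => [|i r ih].
  by rewrite big_nil; apply: ccvg_eq (ccvg_cst 0); near=> x; rewrite big_nil.
rewrite big_cons; apply: ccvg_eq (ccvgD (h i) ih).
by near=> x; rewrite big_cons.
Unshelve. all: by end_near. Qed.

End Ccvg.
Arguments ccvg_cst {T F FF} c _ _.

Lemma ccvg_comp (T U : Type) (F : set_system T) (G : set_system U) (h : T -> U)
  (f : U -> R[i]) l : h @ F `=>` G -> ccvg G f l -> ccvg F (fun x => f (h x)) l.
Proof. by move=> hF hf e /hf; exact: hF. Qed.

Lemma ccvg_unique (T : Type) (F : set_system T) {FF : ProperFilter F}
  (f : T -> R[i]) a b : ccvg F f a -> ccvg F f b -> a = b.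
Proof.
move=> /ccvg_ReIm[h1 h2] /ccvg_ReIm[h3 h4].
by apply: ceq; [exact: cvg_unique h1 h3|exact: cvg_unique h2 h4].
Qed.

(** In w - z = (psqrt w - psqrt z) (psqrt w + psqrt z), the last factor has real part at least Re
    (psqrt z), because [psqrt] has nonnegative real part. This gives continuity of the branch
    wherever Re (psqrt z) > 0. *)
Lemma psqrt_lip z w : cabs (psqrt w - psqrt z) * cRe (psqrt z) <= cabs (w - z).
Proof.
have -> : w - z = psqrt w ^+ 2 - psqrt z ^+ 2 by rewrite !psqrt_sqr.
rewrite subr_sqr cabsM ler_wpM2l ?cabs_ge0 //.
apply: le_trans (cRe_le_cabs _); rewrite raddfD /= lerDr; exact: psqrt_Re_ge0.
Qed.

Lemma psqrt_Re_gt0_slit z : cIm z != 0 \/ 0 < cRe z -> 0 < cRe (psqrt z).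
Proof.
case=> [/psqrt_Re_gt0 //|z0]; rewrite lt_neqAle psqrt_Re_ge0 andbT.
apply/negP => /eqP h; move: z0; rewrite -{1}(psqrt_sqr z) expr2 cReM -h mul0r sub0r.
by rewrite oppr_gt0 -expr2 ltNge sqr_ge0.
Qed.

Lemma ccvg_psqrt (T : Type) (F : set_system T) {FF : Filter F} (f : T -> R[i]) a :
  0 < cRe (psqrt a) -> ccvg F f a -> ccvg F (fun x => psqrt (f x)) (psqrt a).
Proof.
move=> a0 h e e0; have := h _ (mulr_gt0 e0 a0); apply: filterS => x hx.
by rewrite -(ltr_pM2r a0); apply: le_lt_trans hx; exact: psqrt_lip.
Qed.

Definition cderiv (f : R -> R[i]) (t : R) (l : R[i]) : Prop :=
  ccvg (0 : R)^' (fun h => (f (t + h) - f t) * (h^-1)%:C) l.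

Lemma cderiv_ReIm f t l : cderiv f t l <->
  is_derive t 1 (fun u => cRe (f u)) (cRe l) /\ is_derive t 1 (fun u => cIm (f u)) (cIm l).
Proof.
have key (g : R -> R) (c : R) : is_derive t 1 g c <->
    ((g (t + h) - g t) * h^-1 @[h --> (0 : R)^'] --> c).
  have E : (fun h : R => (g (t + h) - g t) * h^-1) =
           (fun h : R => h^-1 *: ((g \o shift t) (h *: (1 : R)) - g t)).
    by apply/funext => h; rewrite /= /GRing.scale /= mulr1 mulrC (addrC h).
  rewrite E; split=> [[d1 d2]|h].
    by move: d1; rewrite /derivable -d2 /derive.
  have dg : derivable g t 1 by apply/cvg_ex; exists c.
  apply: DeriveDef => //; exact: cvg_lim h.
rewrite !key /cderiv; split=> [/ccvg_ReIm[h1 h2]|[h1 h2]].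
  split.
    by move: h1; under eq_fun do rewrite cReM /= mulr0 subr0 raddfB /=.
  by move: h2; under eq_fun do rewrite cImM /= mulr0 add0r raddfB /=.
apply/ccvg_ReIm; split.
  by under eq_fun do rewrite cReM /= mulr0 subr0 raddfB /=.
by under eq_fun do rewrite cImM /= mulr0 add0r raddfB /=.
Qed.

Lemma cderiv_cst c t : cderiv (fun=> c) t 0.
Proof. by rewrite /cderiv; under eq_fun do rewrite subrr mul0r; exact: ccvg_cst. Qed.

Arguments cderiv_cst c t _ _ : clear implicits.

Lemma cderivD f g t a b : cderiv f t a -> cderiv g t b ->
  cderiv (fun u => f u + g u) t (a + b).
Proof.
move=> h1 h2; rewrite /cderiv; apply: ccvg_congr (ccvgD h1 h2) => // h.
by ring.
Qed.

Lemma cderiv_congr f g t a b :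
  (forall u, f u = g u) -> a = b -> cderiv f t a -> cderiv g t b.
Proof. by move=> /funext-> ->. Qed.

Lemma cderiv_near f g t a : (\forall u \near t, f u = g u) -> cderiv f t a -> cderiv g t a.
Proof.
move=> fg; have E := nbhs_singleton fg; apply: ccvg_eq.
have : \forall h \near (0 : R), f (t + h) = g (t + h).
  have : (t + h) @[h --> (0 : R)] --> t.
    rewrite -{2}(addr0 t); apply: cvgD; [exact: cvg_cst|exact: cvg_id].
  by move=> /(_ _ fg).
by move=> /nbhs_dnbhs; apply: filterS => h ->; rewrite E.
Qed.

Lemma cderiv_cont f t a : cderiv f t a -> ccvg (0 : R)^' (fun h => f (t + h)) (f t).
Proof.
move=> h; rewrite -[f t]add0r.
have id0 : ccvg (0 : R)^' (fun h : R => h%:C) 0.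
  by apply: (@ccvg_real _ _ _ (fun h : R => h)); exact: (@nbhs_dnbhs R 0).
pose proof (ccvgD (ccvgM h id0) (ccvg_cst (f t))) as H; rewrite mulr0 in H.
apply: ccvg_eq H.
near=> u; have u0 : u != 0 by near: u; exact: nbhs_dnbhs_neq.
by rewrite -mulrA -rmorphM /= mulVf // rmorph1 mulr1 subrK.
Unshelve. all: by end_near. Qed.

Lemma cderivM f g t a b : cderiv f t a -> cderiv g t b ->
  cderiv (fun u => f u * g u) t (a * g t + f t * b).
Proof.
move=> h1 h2; have c2 := cderiv_cont h2; rewrite /cderiv.
apply: ccvg_congr (ccvgD (ccvgM h1 c2) (ccvgM (ccvg_cst (f t)) h2)) => // h.
by ring.
Qed.

Lemma cderivZ c f t a : cderiv f t a -> cderiv (fun u => c * f u) t (c * a).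
Proof. by move=> h; have := cderivM (cderiv_cst c t) h; rewrite mul0r add0r. Qed.

Lemma cderivX f t a n : cderiv f t a ->
  cderiv (fun u => f u ^+ n) t (n%:R * f t ^+ n.-1 * a).
Proof.
move=> h; elim: n => [|n ih]; first by rewrite !mul0r; exact: cderiv_cst.
apply: cderiv_congr (cderivM h ih) => [u|]; first by rewrite exprS.
case: n {ih} => [|n] /=; first by ring.
by rewrite !exprS -[n.+2%:R]natr1; ring.
Qed.

Lemma cderiv_conj f t a : cderiv f t a -> cderiv (fun u => conjc (f u)) t (conjc a).
Proof.
move=> h; apply: ccvg_congr (ccvg_conj h) => // u.
by rewrite rmorphM rmorphB; congr (_ * _); exact: conjc_real.
Qed.

Lemma cderiv_real (h : R -> R) (t x : R) : is_derive t 1 h x ->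
  cderiv (fun u => (h u)%:C) t x%:C.
Proof. by move=> hx; apply/cderiv_ReIm; split => //=; exact: is_derive_cst. Qed.

(* Since [root u ^+ 2 * f u = 1], the difference quotients of [root] are those of [f]
   times [- root (t + h) ^+ 2 * root t ^+ 2 / (root (t + h) + root t)]. *)
Lemma cderiv_invsqrt (f root : R -> R[i]) t a :
  (\forall u \near t, root u ^+ 2 * f u = 1) -> ccvg (nbhs t) root (root t) ->
  cderiv f t a -> cderiv root t (- (2%:R)^-1 * root t ^+ 3 * a).
Proof.
move=> hr hc hf.
have E : root t ^+ 2 * f t = 1 := nbhs_singleton hr.
have r0 : root t != 0.
  by apply/eqP => r0; move: E; rewrite r0 expr0n mul0r => /esym/eqP; rewrite oner_eq0.
have sh : (t + h) @[h --> (0 : R)^'] --> t.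
  rewrite -{2}(addr0 t); apply: cvgD; [exact: cvg_cst|exact: nbhs_dnbhs].
have hr' : \forall h \near (0 : R)^', root (t + h) ^+ 2 * f (t + h) = 1 by exact: sh hr.
have hc' : ccvg (0 : R)^' (fun h => root (t + h)) (root t) by exact: ccvg_comp sh hc.
have s0 : root t + root t != 0 by rewrite -mulr2n mulrn_eq0.
pose proof (ccvgM (ccvgN hf) (ccvgM (ccvgM (ccvgX 2 hc') (ccvg_cst (root t ^+ 2)))
   (ccvgV s0 (ccvgD hc' (ccvg_cst (root t)))))) as h1.
rewrite /cderiv.
have -> : - (2%:R)^-1 * root t ^+ 3 * a =
    - a * (root t ^+ 2 * root t ^+ 2 / (root t + root t)).
  by field.
apply: ccvg_eq h1.
have nz : \forall h \near (0 : R)^', root (t + h) + root t != 0.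
  have c0 : 0 < cabs (root t + root t) by rewrite cabs_gt0.
  pose proof (ccvgD hc' (ccvg_cst (root t)) c0) as H; apply: filterS H => h.
  by apply: contraTneq => ->; rewrite sub0r cabsN ltxx.
near=> h.
have e1 : root (t + h) ^+ 2 * f (t + h) = 1 by near: h.
have e2 : root (t + h) + root t != 0 by near: h.
have e3 : root (t + h) - root t =
    - (f (t + h) - f t) * (root (t + h) ^+ 2 * root t ^+ 2) / (root (t + h) + root t).
  apply: (mulIf e2); rewrite divfK // -subr_sqr.
  rewrite -[X in X - _ = _]mulr1 -[X in _ - X = _]mulr1 -{1}E -e1; ring.
by rewrite e3; ring.
Unshelve. all: by end_near. Qed.

(** The mean value theorem is applied to the real and the imaginary part separately, which is the
    origin of the factor 2. *)
Lemma cderiv_mvt (f f' : R -> R[i]) (t d M : R) :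
  (forall u, `|u| < d -> cderiv f (t + u) (f' u)) ->
  (forall u, `|u| < d -> cabs (f' u) <= M) ->
  forall h, `|h| < d -> cabs (f (t + h) - f t) <= 2 * M * `|h|.
Proof.
move=> df bf h hd.
have key (g g' : R -> R) : (forall u, `|u| < d -> is_derive (t + u) 1 g (g' u)) ->
    (forall u, `|u| < d -> `|g' u| <= M) -> `|g (t + h) - g t| <= M * `|h|.
  move=> dg bg.
  have der x : `|x - t| < d -> is_derive x 1 g (g' (x - t)).
    by move=> /dg; rewrite addrC subrK.
  have cont x : `|x - t| < d -> {for x, continuous g}.
    by move=> /der[d1 _]; exact/differentiable_continuous/derivable1_diffP.
  have [h0|h0|->] := ltgtP h 0; last by rewrite addr0 subrr !normr0 mulr0.
  - have lt : t + h < t by rewrite gtrDl.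
    have ok x : x \in `[t + h, t] -> `|x - t| < d.
      rewrite in_itv /= => /andP[h1 h2]; apply: le_lt_trans hd.
      by rewrite ler0_norm ?subr_le0 // ltr0_norm // opprB lerBlDr; lra.
    have [||c hc E] := @MVT R g (fun x => g' (x - t)) _ _ lt.
    + by move=> x hx; apply: der; apply: ok; exact: subset_itv_oo_cc hx.
    + by apply: continuous_in_subspaceT => x /set_mem hx; apply: cont; exact: ok.
    rewrite distrC E normrM opprD addNKr normrN ler_wpM2r //.
    by apply: bg; apply: ok; exact: subset_itv_oo_cc hc.
  - have lt : t < t + h by rewrite ltrDl.
    have ok x : x \in `[t, t + h] -> `|x - t| < d.
      rewrite in_itv /= => /andP[h1 h2]; apply: le_lt_trans hd.
      by rewrite ger0_norm ?subr_ge0 // gtr0_norm // lerBlDl.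
    have [||c hc E] := @MVT R g (fun x => g' (x - t)) _ _ lt.
    + by move=> x hx; apply: der; apply: ok; exact: subset_itv_oo_cc hx.
    + by apply: continuous_in_subspaceT => x /set_mem hx; apply: cont; exact: ok.
    rewrite E normrM addrAC subrr add0r ler_wpM2r //.
    by apply: bg; apply: ok; exact: subset_itv_oo_cc hc.
apply: le_trans (cabs_le_ReIm _) _.
rewrite !raddfB /= -mulrA mulrDl mul1r lerD //.
  apply: (key (fun u => cRe (f u)) (fun u => cRe (f' u))) => u hu.
    by have /cderiv_ReIm[] := df u hu.
  by apply: le_trans (norm_cRe _) (bf u hu).
apply: (key (fun u => cIm (f u)) (fun u => cIm (f' u))) => u hu.
  by have /cderiv_ReIm[] := df u hu.
by apply: le_trans (cIm_le_cabs _) (bf u hu).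
Qed.

End ComplexToolkit.

(** * Absolutely convergent families *)

Section Summation.
Local Open Scope complex_scope.
Context {R : realType} {I : choiceType}.
Implicit Types (f g : I -> R[i]) (b : I -> R) (B : {fset I}).

#[local] Existing Instance totally_filter.

Definition fsum_bounded b : Prop :=
  (forall i, 0 <= b i) /\ exists K, forall B, \sum_(i <- B) b i <= K.

Lemma partial_sumE (V : zmodType) (f : I -> V) B :
  partial_sum f B = \sum_(i <- B) f i.
Proof. by rewrite /partial_sum -(big_seq_fsetE _ _ predT). Qed.

Lemma fsumU (V : zmodType) (f : I -> V) B B' : (B `<=` B')%fset ->
  \sum_(i <- B') f i = \sum_(i <- B) f i + \sum_(i <- (B' `\` B)%fset) f i.
Proof.
move=> sBB'; rewrite (big_fsetID _ (mem B)) /=; congr (_ + _).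
  by apply: eq_fbigl => i; rewrite !inE /= andb_idl // => /(fsubsetP sBB').
by apply: eq_fbigl => i; rewrite !inE /= andbC.
Qed.

Lemma fsum_le b B B' : (forall i, 0 <= b i) -> (B `<=` B')%fset ->
  \sum_(i <- B) b i <= \sum_(i <- B') b i.
Proof. by move=> b0 /fsumU->; rewrite lerDl sumr_ge0. Qed.

Lemma fsum_tail b : fsum_bounded b -> forall e, 0 < e ->
  exists B0, forall B, (B0 `<=` B)%fset -> \sum_(i <- (B `\` B0)%fset) b i < e.
Proof.
move=> [b0 [K hK]] e e0.
pose S := range (fun B : {fset I} => \sum_(i <- B) b i).
have hS : has_sup S.
  split; first by exists (\sum_(i <- fset0) b i); exists fset0.
  by exists K => _ [B _ <-]; exact: hK.
have [_ [B0 _ <-] hB0] := sup_adherent e0 hS.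
exists B0 => B sB; have : \sum_(i <- B) b i <= sup S.
  by apply: ub_le_sup; [exact: hS.2|exists B].
by rewrite (fsumU b sB); move: hB0; lra.
Qed.

Lemma fsum_cvg b (g : I -> R) : fsum_bounded b -> (forall i, `|g i| <= b i) ->
  cvg ((fun B => \sum_(i <- B) g i) @ totally).
Proof.
move=> hb hg; apply: cauchy_cvg; apply: cauchy_exP => e e0.
have [B0 hB0] := fsum_tail hb e0.
exists (\sum_(i <- B0) g i), B0 => // B /= sB.
rewrite /ball /= (fsumU g sB) opprD addNKr normrN.
apply: le_lt_trans (hB0 _ sB); apply: le_trans (ler_norm_sum _ _ _) _.
exact: ler_sum.
Qed.

Definition csum f : R[i] := summability.sum (f : I -> R[i]^o).

Lemma csum_ccvg b f : fsum_bounded b -> (forall i, cabs (f i) <= b i) ->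
  ccvg (@totally I) (fun B => \sum_(i <- B) f i) (csum f).
Proof.
move=> hb hf.
have h1 := fsum_cvg hb (fun i => le_trans (norm_cRe _) (hf i)).
have h2 := fsum_cvg hb (fun i => le_trans (cIm_le_cabs _) (hf i)).
set l1 := lim _ in h1; set l2 := lim _ in h2.
have h : ccvg (@totally I) (fun B => \sum_(i <- B) f i) (l1 +i* l2).
  apply/ccvg_ReIm; split => /=.
    by under eq_fun do rewrite cRe_sum.
  by under eq_fun do rewrite cIm_sum.
suff -> : csum f = l1 +i* l2 by [].
rewrite /csum /summability.sum.
have {h}/ccvgP h : ccvg (@totally I) (fun B => partial_sum (f : I -> R[i]^o) B) (l1 +i* l2).
  by apply: ccvg_congr h => // B; rewrite partial_sumE.
exact: (cvg_lim (@norm_hausdorff _ (R[i]^o)) h).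
Qed.

(** The finite set [B0] depends on the majorant only, not on [f]. This uniformity is what lets
    limits and derivatives pass through [csum]. *)
Lemma csum_tail b : fsum_bounded b -> forall e, 0 < e -> exists B0,
  forall f, (forall i, cabs (f i) <= b i) ->
  forall B, (B0 `<=` B)%fset -> cabs (csum f - \sum_(i <- B) f i) <= e.
Proof.
move=> hb e e0; have [B0 hB0] := fsum_tail hb e0.
exists B0 => f hf B sB; apply/ler_addgt0Pr => d d0.
have [B1 _ hB1] := csum_ccvg hb hf d0.
have := hB1 (B1 `|` B)%fset (fsubsetUl _ _); rewrite /= => h1.
set B' := (B1 `|` B)%fset in h1 *.
have sB' : (B `<=` B')%fset by exact: fsubsetUr.
have -> : csum f - \sum_(i <- B) f i =
    (csum f - \sum_(i <- B') f i) + \sum_(i <- (B' `\` B)%fset) f i.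
  by rewrite (fsumU f sB'); ring.
apply: le_trans (cabsD _ _) _; rewrite addrC lerD //; last by rewrite cabsB ltW.
apply: ltW; apply: le_lt_trans (hB0 _ (fsubset_trans sB sB')).
apply: le_trans (cabs_sum _ _ _) _; apply: le_trans (ler_sum _ (fun i _ => hf i)) _.
by apply: fsum_le hb.1 _; exact: fsetDS.
Qed.

Lemma csum_le b f K : fsum_bounded b -> (forall i, cabs (f i) <= b i) ->
  (forall B, \sum_(i <- B) b i <= K) -> cabs (csum f) <= K.
Proof.
move=> hb hf hK; apply/ler_addgt0Pr => e e0.
have [B0 hB0] := csum_tail hb e0; have := hB0 f hf B0 (fsubset_refl _).
move=> h; rewrite addrC; apply: le_trans (cabs_leD _ (\sum_(i <- B0) f i)) _.
rewrite addrC lerD //; apply: le_trans (cabs_sum _ _ _) _.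
by apply: le_trans (ler_sum _ (fun i _ => hf i)) (hK _).
Qed.

Lemma fsum_boundedZ b (c : R) : 0 <= c -> fsum_bounded b ->
  fsum_bounded (fun i => c * b i).
Proof.
move=> c0 [b0 [K hK]]; split=> [i|]; first by rewrite mulr_ge0.
by exists (c * K) => B; rewrite -mulr_sumr ler_wpM2l.
Qed.

Lemma fsum_boundedD b b' : fsum_bounded b -> fsum_bounded b' ->
  fsum_bounded (fun i => b i + b' i).
Proof.
move=> [b0 [K hK]] [b0' [K' hK']]; split=> [i|]; first by rewrite addr_ge0.
by exists (K + K') => B; rewrite big_split lerD.
Qed.

Lemma csum_unique b f l : fsum_bounded b -> (forall i, cabs (f i) <= b i) ->
  ccvg (@totally I) (fun B => \sum_(i <- B) f i) l -> csum f = l.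
Proof. by move=> hb hf; apply: ccvg_unique; exact: csum_ccvg hb hf. Qed.

Lemma csumZ b f c : fsum_bounded b -> (forall i, cabs (f i) <= b i) ->
  csum (fun i => c * f i) = c * csum f.
Proof.
move=> hb hf; apply: (@csum_unique (fun i => cabs c * b i)) => [|i|].
- by apply: fsum_boundedZ => //; exact: cabs_ge0.
- by rewrite cabsM ler_wpM2l // cabs_ge0.
- apply: ccvg_congr (ccvgM (ccvg_cst c) (csum_ccvg hb hf)) => // B.
  by rewrite mulr_sumr.
Qed.

Lemma csumD b f g : fsum_bounded b -> (forall i, cabs (f i) <= b i) ->
  (forall i, cabs (g i) <= b i) ->
  csum (fun i => f i + g i) = csum f + csum g.
Proof.
move=> hb hf hg; apply: (@csum_unique (fun i => b i + b i)) => [|i|].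
- exact: fsum_boundedD.
- by apply: le_trans (cabsD _ _) _; rewrite lerD.
- apply: ccvg_congr (ccvgD (csum_ccvg hb hf) (csum_ccvg hb hg)) => // B.
  by rewrite big_split.
Qed.

Lemma csum_reindex b f (s s' : I -> I) : cancel s s' -> cancel s' s ->
  fsum_bounded b -> (forall i, cabs (f i) <= b i) ->
  csum (fun i => f (s i)) = csum f.
Proof.
move=> ss' s's hb hf; have sI := can_inj ss'.
have reidx (V : zmodType) (h : I -> V) B :
    \sum_(i <- B) h (s i) = \sum_(i <- [fset s x | x in B]%fset) h i.
  by rewrite big_imfset //= => x y _ _; exact: sI.
apply: (@csum_unique (fun i => b (s i))) => [|i|].
- split=> [i|]; first exact: hb.1.
  by have [K hK] := hb.2; exists K => B; rewrite reidx.
- exact: hf.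
- move=> e e0; have [B0 _ hB0] := csum_ccvg hb hf e0.
  exists [fset s' x | x in B0]%fset => // B /= sB; rewrite reidx; apply: hB0 => /=.
  apply/fsubsetP => x xB; apply/imfsetP; exists (s' x); last by rewrite s's.
  by apply: (fsubsetP sB); apply/imfsetP; exists x.
Qed.

Lemma ccvg_csum (T : Type) (F : set_system T) {FF : Filter F} b
    (f : T -> I -> R[i]) (l : I -> R[i]) : fsum_bounded b ->
  (\forall x \near F, forall i, cabs (f x i) <= b i) ->
  (forall i, cabs (l i) <= b i) ->
  (forall i, ccvg F (f^~ i) (l i)) ->
  ccvg F (fun x => csum (f x)) (csum l).
Proof.
move=> hb hf hl fl e e0.
have e3 : 0 < e / 3 by rewrite divr_gt0.
have [B0 hB0] := csum_tail hb e3.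
have h2 := hB0 l hl B0 (fsubset_refl _).
pose proof (@ccvg_sum R T F _ I B0 (fun i => f^~ i) l fl _ e3) as h3.
near=> x.
have hx : forall i, cabs (f x i) <= b i by near: x.
have h1 := hB0 (f x) hx B0 (fsubset_refl _).
have h4 : cabs (\sum_(i <- B0) f x i - \sum_(i <- B0) l i) < e / 3 by near: x.
have -> : csum (f x) - csum l = (csum (f x) - \sum_(i <- B0) f x i) +
  ((\sum_(i <- B0) f x i - \sum_(i <- B0) l i) - (csum l - \sum_(i <- B0) l i)) by ring.
apply: le_lt_trans (cabsD _ _) _.
have := cabsD (\sum_(i <- B0) f x i - \sum_(i <- B0) l i) (- (csum l - \sum_(i <- B0) l i)).
rewrite cabsN; lra.
Unshelve. all: by end_near. Qed.

(** By [cderiv_mvt] the difference quotients of the terms are dominated by 2 b, so the claim reduces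
    to [ccvg_csum]. *)
Lemma cderiv_csum b (f f' : R -> I -> R[i]) (t d : R) : 0 < d -> fsum_bounded b ->
  (forall i u, `|u| < d -> cderiv (fun v => f v i) (t + u) (f' u i)) ->
  (forall i u, `|u| < d -> cabs (f (t + u) i) <= b i) ->
  (forall i u, `|u| < d -> cabs (f' u i) <= b i) ->
  cderiv (fun v => csum (f v)) t (csum (f' 0)).
Proof.
move=> d0 hb hd hf hf'.
have z0 : `|0 : R| < d by rewrite normr0.
have hd0 : \forall h \near (0 : R)^', `|h| < d.
  apply: nbhs_dnbhs; exists d => // x /=; by rewrite sub0r normrN.
have hb2 := fsum_boundedZ (ler0n R 2) hb.
have H : ccvg (0 : R)^' (fun h => csum (fun i => (f (t + h) i - f t i) * (h^-1)%:C))
    (csum (f' 0)).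
  apply: (@ccvg_csum _ _ _ (fun i => 2 * b i)) => // [|i|i].
  - near=> h => i.
    have h0 : h != 0 by near: h; exact: nbhs_dnbhs_neq.
    have hlt : `|h| < d by near: h.
    rewrite cabsM cabs_real normfV ler_pdivrMr ?normr_gt0 //.
    exact: (cderiv_mvt (hd i) (hf' i) hlt).
  - apply: le_trans (hf' i 0 z0) _; rewrite mulr2n mulrDl mul1r lerDl; exact: hb.1.
  - by have := hd i 0 z0; rewrite addr0.
apply: ccvg_eq H; near=> h.
have hlt : `|h| < d by near: h.
have hb1 i : cabs (f (t + h) i) <= b i by exact: hf.
have hb3 i : cabs (- f t i) <= b i by rewrite cabsN; have := hf i 0 z0; rewrite addr0.
have hb4 i : cabs (f (t + h) i - f t i) <= b i + b i.
  by apply: le_trans (cabsD _ _) _; rewrite lerD.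
transitivity (csum (fun i => (h^-1)%:C * (f (t + h) i - f t i))).
  by congr csum; apply/funext => i; rewrite mulrC.
rewrite (csumZ _ (fsum_boundedD hb hb) hb4) mulrC; congr (_ * _).
rewrite (csumD hb hb1 hb3); congr (_ + _).
transitivity (csum (fun i => -1 * f t i)).
  by congr csum; apply/funext => i; rewrite mulN1r.
rewrite (csumZ _ hb) ?mulN1r // => i; rewrite -cabsN; exact: hb3.
Unshelve. all: by end_near. Qed.

End Summation.

(** * Coordinates on the metaplectic group *)

Section MetaplecticCoordinates.
Local Open Scope complex_scope.
Context {R : realType}.
Local Notation Mp := (metaplectic R).
Implicit Types (g h : 'M[R]_2) (s t : Mp) (z : uhp R).

(* Cayley transform: the matrix of g in SU(1,1) has rows (al, conj be) and (be, conj al). *)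
Definition al g : R[i] := ((g 0 0 + g 1 1) / 2) +i* ((g 1 0 - g 0 1) / 2).
Definition be g : R[i] := ((g 0 0 - g 1 1) / 2) +i* (- (g 0 1 + g 1 0) / 2).

Lemma alM g h : al (g *m h) = al g * al h + conjc (be g) * be h.
Proof. by apply: ceq; rewrite /al /be !mulmx22 /=; field. Qed.

Lemma beM g h : be (g *m h) = be g * al h + conjc (al g) * be h.
Proof. by apply: ceq; rewrite /al /be !mulmx22 /=; field. Qed.

Lemma al_be_det g : \det g = 1 -> cabs (al g) ^+ 2 = 1 + cabs (be g) ^+ 2.
Proof. by rewrite det22 => dg; rewrite !cabs_sqr /= -[X in _ = X + _]dg; field. Qed.

Lemma cabs_be_le g : \det g = 1 -> cabs (be g) <= cabs (al g).
Proof.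
move=> /al_be_det E; have := cabs_ge0 (be g); have := cabs_ge0 (al g); nra.
Qed.

Lemma cabs_al_ge1 g : \det g = 1 -> 1 <= cabs (al g).
Proof.
move=> /al_be_det E; have := cabs_ge0 (be g); have := cabs_ge0 (al g); nra.
Qed.

Lemma al_neq0 g : \det g = 1 -> al g != 0.
Proof. by move=> /cabs_al_ge1 h; rewrite -cabs_gt0; apply: lt_le_trans h. Qed.

Definition mpZ s : R[i] := val (mobius (mp_mx s) uhp_i).
Definition mpN s : R[i] := mp_eta s uhp_i.

Lemma mpZ_Im s : 0 < cIm (mpZ s).
Proof. exact: (valP (mobius (mp_mx s) uhp_i)). Qed.

Lemma mpN_sqr s : mpN s ^+ 2 = (mp_mx s 1 1) +i* (mp_mx s 1 0).
Proof. by rewrite /mpN mp_sqr /autj /=; apply: ceq => /=; ring. Qed.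

Lemma mpN_neq0 s : mpN s != 0.
Proof. exact: mp_eta_neq0. Qed.

Lemma mpZ_N s : mpZ s * mpN s ^+ 2 = (mp_mx s 0 1) +i* (mp_mx s 0 0).
Proof.
rewrite /mpN mp_sqr /mpZ mobius_val ?mp_det // divfK ?autj_neq0 ?mp_det //.
by apply: ceq => /=; ring.
Qed.

(** This is Im (g.i) = |j(g,i)| ^ (-2), with j(g,i) the square of [mpN]. *)
Lemma mpZ_Im_N s : cIm (mpZ s) * cabs (mpN s) ^+ 4 = 1.
Proof.
have := mpZ_N s; have := mpN_sqr s; have := mp_det s; rewrite det22.
set a := mp_mx s 0 0; set b := mp_mx s 0 1; set c := mp_mx s 1 0; set d := mp_mx s 1 1.
move=> dg; rewrite -[4%N]/(2 * 2)%N exprM -cabsX => ->.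
rewrite cabs_sqr /=; case: (mpZ s) => x y /= [h1 h2].
by rewrite -dg -/a; move: h1 h2; rewrite -/a -/b => <- <-; ring.
Qed.

Lemma mpZ_add_i s : (mpZ s + 'i) * mpN s ^+ 2 = 2 * 'i * al (mp_mx s).
Proof.
by rewrite mulrDl mpZ_N mpN_sqr /al; apply: ceq => /=; field.
Qed.

Lemma mpZ_sub_i s : (mpZ s - 'i) * mpN s ^+ 2 = 2 * 'i * be (mp_mx s).
Proof.
by rewrite mulrBl mpZ_N mpN_sqr /be; apply: ceq => /=; field.
Qed.

Lemma two_i_neq0 : 2 * 'i != 0 :> R[i].
Proof. by rewrite mulf_neq0 ?pnatr_eq0 // eq_complex /= oner_eq0 andbF. Qed.

(** A continuous branch of al ^ (- 1/2): by [mpZ_add_i], al is (mpZ + i) mpN ^ 2 / (2i). Since mpZ +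
    i stays in the upper half-plane, its principal root is continuous, and [mpN] carries the sheet
    of the double cover. *)
Definition theta s : R[i] := psqrt (2 * 'i) / (psqrt (mpZ s + 'i) * mpN s).

Lemma theta_sqr s : theta s ^+ 2 * al (mp_mx s) = 1.
Proof.
have h := mpZ_add_i s.
have i0 := two_i_neq0.
have nz : (mpZ s + 'i) * mpN s ^+ 2 != 0 by rewrite h mulf_neq0 // al_neq0 // mp_det.
rewrite /theta exprMn exprVn exprMn !psqrt_sqr.
by apply: (mulfI nz); rewrite mulr1 mulrCA mulrA divfK.
Qed.

Lemma theta_neq0 s : theta s != 0.
Proof.
apply/eqP => h; have := theta_sqr s; rewrite h expr0n mul0r => /esym/eqP.
by rewrite oner_eq0.
Qed.

Lemma cabs_theta_sqr s : cabs (theta s) ^+ 2 * cabs (al (mp_mx s)) = 1.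
Proof. by rewrite -cabsX -cabsM theta_sqr cabs1. Qed.

Lemma cabs_theta_gt0 s : 0 < cabs (theta s).
Proof. by rewrite cabs_gt0 theta_neq0. Qed.

Lemma cabs_theta_le1 s : cabs (theta s) <= 1.
Proof.
have := cabs_theta_sqr s; have := cabs_al_ge1 (mp_det s); have := cabs_theta_gt0 s.
nra.
Qed.

(* F_(k,m) is the case a = k, b = 0, n = 2m; differentiating along one-parameter subgroups
   stays in the span of this larger family. *)
Definition Gfun (a b n : nat) s : R[i] :=
  be (mp_mx s) ^+ a * conjc (be (mp_mx s)) ^+ b * theta s ^+ (n + 2 * a + 2 * b).

Lemma cabs_be_theta s : cabs (be (mp_mx s)) * cabs (theta s) ^+ 2 <= 1.
Proof.
rewrite -(cabs_theta_sqr s) mulrC ler_wpM2l ?sqr_ge0 //; exact/cabs_be_le/mp_det.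
Qed.

(** The exponent [n + 2 * a + 2 * b] provides one theta ^ 2 for each factor be or conj be, and |be
    theta ^ 2| <= 1. *)
Lemma cabs_Gfun a b n s : cabs (Gfun a b n s) <= cabs (theta s) ^+ n.
Proof.
rewrite /Gfun; have := cabs_be_theta s; move: (theta s) (be (mp_mx s)) => u v.
rewrite !cabsM !cabsX cabs_conj (exprD _ (n + 2 * a)) (exprD _ n) !exprM.
move: (cabs u) (cabs v) (cabs_ge0 u) (cabs_ge0 v) => x y x0 y0 h.
have -> : y ^+ a * y ^+ b * (x ^+ n * x ^+ 2 ^+ a * x ^+ 2 ^+ b) =
   x ^+ n * ((y * x ^+ 2) ^+ a * (y * x ^+ 2) ^+ b) by rewrite !exprMn; ring.
have h0 : 0 <= y * x ^+ 2 by rewrite mulr_ge0 ?sqr_ge0.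
by rewrite ler_piMr ?exprn_ge0 // mulr_ile1 ?exprn_ile1 ?exprn_ge0.
Qed.

Lemma cabs_theta_exp n s : (5 <= n)%N -> cabs (theta s) ^+ n <= cabs (theta s) ^+ 5.
Proof.
by move=> n5; rewrite ler_wiXn2l ?cabs_ge0 // cabs_theta_le1.
Qed.

Lemma twice_half n : twice (5 / 2 + n%:R) = (5 + 2 * n)%N :> int.
Proof.
rewrite /twice (_ : 2 * _ = ((5 + 2 * n)%N%:Z)%:~R) ?numq_int //.
by rewrite -pmulrn natrD natrM; field.
Qed.

Lemma F_kmE k n s : F_km k (5 / 2 + n%:R) s = Gfun k 0 (5 + 2 * n) s.
Proof.
rewrite /F_km /f_km /hpow -[mp_eta _ _]/(mpN s) -[val _]/(mpZ s).
have -> : 5 / 2 + n%:R + k%:R = 5 / 2 + (n + k)%:R :> rat by rewrite natrD addrA.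
rewrite !twice_half -exprnP -exprnN -exprnP /Gfun expr0 mulr1 muln0 addn0.
have Zi : psqrt (mpZ s + 'i) != 0.
  apply/eqP => h; have := psqrt_sqr (mpZ s + 'i); rewrite h expr0n /= => e.
  by have := mpZ_add_i s; rewrite -e mul0r => /esym/eqP;
    rewrite (negbTE (mulf_neq0 two_i_neq0 (al_neq0 (mp_det s)))).
(* Since theta ^ 2 = 1 / al, the powers of [mpN] cancel here. What remains involves only integral
   powers of one and the same [psqrt], so no branches have to be compared. *)
have E : be (mp_mx s) * theta s ^+ 2 = (mpZ s - 'i) / (psqrt (mpZ s + 'i)) ^+ 2.
  have N0 : mpN s ^+ 2 != 0 by rewrite expf_neq0 // mpN_neq0.
  have a0 := al_neq0 (mp_det s); have i0 := two_i_neq0.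
  have -> : theta s ^+ 2 = (al (mp_mx s))^-1.
    by apply: (mulIf a0); rewrite theta_sqr mulVf.
  rewrite psqrt_sqr -(mulfK N0 (mpZ s - 'i)) mpZ_sub_i -(mulfK N0 (mpZ s + 'i)) mpZ_add_i.
  move: N0 a0 i0; move: (mpN s ^+ 2) (al _) (be _) (2 * 'i) => u v w x u0 v0 x0.
  by field; rewrite u0 v0.
have -> : be (mp_mx s) ^+ k * theta s ^+ (5 + 2 * n + 2 * k) =
   (be (mp_mx s) * theta s ^+ 2) ^+ k * theta s ^+ (5 + 2 * n).
  by move: (theta s) => u; rewrite exprMn -exprM -mulrA -exprD addnC.
rewrite E /theta; set N' := (5 + 2 * n)%N.
have -> : (5 + 2 * (n + k) = N' + 2 * k)%N by rewrite /N'; ring.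
move: Zi (mpN_neq0 s) {E}; move: (psqrt (2 * 'i)) (psqrt (mpZ s + 'i)) (mpN s) (mpZ s - 'i).
move: N' => M u v w x v0 w0; rewrite !expr_div_n (exprMn _ v w) (exprD v) exprM.
move: (x ^+ k) (u ^+ M) (expf_neq0 M v0) (expf_neq0 M w0) (expf_neq0 k (expf_neq0 2 v0)).
move: (v ^+ M) (w ^+ M) (v ^+ 2 ^+ k) => p q r a b p0 q0 r0.
by field; rewrite p0 q0 r0.
Qed.

End MetaplecticCoordinates.

(** * Inversion, and the explicit form of eta *)

Section MetaplecticTopology.
Local Open Scope complex_scope.
Context {R : realType}.
Local Notation Mp := (metaplectic R).
Implicit Types (g h : 'M[R]_2) (s t : Mp) (z : uhp R).

Lemma mp_mxM s t : mp_mx (s * t)%g = mp_mx s *m mp_mx t.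
Proof. by []. Qed.

Lemma mp_mx1 : mp_mx (1%g : Mp) = 1%:M.
Proof. by []. Qed.

Lemma mpZM s t : mpZ (s * t)%g = val (mobius (mp_mx s) (mobius (mp_mx t) uhp_i)).
Proof. by rewrite /mpZ mp_mxM mobiusM // mp_det. Qed.

Lemma mpNM s t : mpN (s * t)%g = mp_eta s (mobius (mp_mx t) uhp_i) * mpN t.
Proof. by []. Qed.

Lemma alV s : al (mp_mx s^-1%g) = conjc (al (mp_mx s)).
Proof.
have := alM (mp_mx s^-1%g) (mp_mx s); rewrite -mp_mxM mulVg mp_mx1 => e1.
have := beM (mp_mx s^-1%g) (mp_mx s); rewrite -mp_mxM mulVg mp_mx1 => e2.
have a1 : al (1%:M : 'M[R]_2) = 1 by apply: ceq; rewrite /= !mxE /=; field.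
have b1 : be (1%:M : 'M[R]_2) = 0 by apply: ceq; rewrite /= !mxE /=; field.
have E : al (mp_mx s) * conjc (al (mp_mx s)) = 1 + be (mp_mx s) * conjc (be (mp_mx s)).
  have := al_be_det (mp_det s); rewrite !cabs_sqr.
  case: (al _) (be _) => a b [c d] /= h; apply: ceq => /=; last by ring.
  by move: h; rewrite !expr2; lra.
move: E e1 e2; rewrite a1 b1; move: (al (mp_mx s)) (be (mp_mx s)) => a b.
move: (al _) (be _) => a' b' E e1 e2.
have e2' : conjc b' * conjc a = - (a' * conjc b).
  apply/eqP; rewrite -subr_eq0 opprK; apply/eqP.
  have := congr1 conjc e2; rewrite rmorphD !rmorphM rmorph0 /= conjcK => e3.
  by rewrite -e3.
have : conjc a * 1 = a' * (a * conjc a) + conjc b' * conjc a * b by rewrite {1}e1; ring.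
by rewrite mulr1 E e2' => ->; ring.
Qed.

(** |theta| depends on |al| only, and inversion conjugates al. This turns g s, with g in Gamma, into
    s^-1 g^-1, a left translate of Gamma, for which the cells are suited. *)
Lemma cabs_thetaV s : cabs (theta s^-1%g) = cabs (theta s).
Proof.
have := cabs_theta_sqr s^-1%g; have := cabs_theta_sqr s; rewrite alV cabs_conj.
have := cabs_theta_gt0 s; have := cabs_theta_gt0 s^-1%g.
have := cabs_al_ge1 (mp_det s).
move: (cabs _) (cabs (theta _)) (cabs (theta _)) => a x y a1 x0 y0 h1 h2.
have a0 : a != 0 by rewrite gt_eqF //; lra.
have : x ^+ 2 = y ^+ 2 by apply: (mulIf a0); rewrite h1.
by move/eqP; rewrite eqrXn2 // ?ltW // => /eqP.
Qed.

Lemma cabs_alM_le s t : cabs (al (mp_mx (s * t)%g)) <=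
  2 * cabs (al (mp_mx s)) * cabs (al (mp_mx t)).
Proof.
rewrite mp_mxM alM; apply: le_trans (cabsD _ _) _; rewrite !cabsM cabs_conj.
have := cabs_be_le (mp_det s); have := cabs_be_le (mp_det t).
have := cabs_ge0 (be (mp_mx s)); have := cabs_ge0 (be (mp_mx t)); nra.
Qed.

Lemma cabs_al_le s t : cabs (al (mp_mx s)) <=
  2 * cabs (al (mp_mx (s * t)%g)) * cabs (al (mp_mx t)).
Proof.
have := cabs_alM_le (s * t)%g t^-1%g; by rewrite mulgK alV cabs_conj.
Qed.

Lemma cabs_thetaM_le s t : cabs (theta (s * t)%g) ^+ 2 <=
  2 * cabs (al (mp_mx t)) * cabs (theta s) ^+ 2.
Proof.
have E (u : Mp) : cabs (theta u) ^+ 2 = (cabs (al (mp_mx u)))^-1.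
  have a0 : cabs (al (mp_mx u)) != 0 by rewrite cabs_eq0 al_neq0 // mp_det.
  by apply: (mulIf a0); rewrite mulVf // cabs_theta_sqr.
have := cabs_al_le s t; have := cabs_al_ge1 (mp_det s).
have := cabs_al_ge1 (mp_det (s * t)%g); rewrite !E.
move: (cabs _) (cabs _) (cabs _) => a b c a1 b1 h.
by rewrite ler_pdivlMr; [rewrite mulrC ler_pdivrMr|]; lra.
Qed.

Lemma psqrt_1 : psqrt (1 : R[i]) = 1.
Proof.
have /eqP := psqrt_sqr (1 : R[i]); rewrite sqrf_eq1 => /orP[/eqP//|/eqP h].
by have := psqrt_Re_ge0 (1 : R[i]); rewrite {}h /= => h0; exfalso; lra.
Qed.

(** The ratio avoids the closed negative real axis. If it is a real number r, comparing imaginary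
    parts gives c Im z = r c, hence r = Im z > 0 when c is nonzero; when c = 0 the ratio is 1. *)
Lemma autj_ratio_slit g z : \det g = 1 ->
  0 < cRe (psqrt (autj g z / autj g uhp_i)).
Proof.
move=> dg; have ni := autj_neq0 uhp_i dg; have nz := autj_neq0 z dg.
apply: psqrt_Re_gt0_slit; case: (eqVneq (cIm (autj g z / autj g uhp_i)) 0); last by left.
move=> im0; right; set r := _ / _ in im0 *.
have E : autj g z = (cRe r)%:C * autj g uhp_i.
  by rewrite -[LHS](divfK ni) -/r; congr (_ * _); apply: ceq.
move: E nz ni dg; rewrite det22 /autj; move: (cRe r) => {r im0} r;
  case: z => -[x y] /= y0 [e1 e2] nz ni dg.
have {}e1 : g 1 0 * x + g 1 1 = r * g 1 1 by lra.
have {}e2 : g 1 0 * y = r * g 1 0 by lra.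
have [c0|c0] := eqVneq (g 1 0) 0.
  move: e1 dg; rewrite c0 !(mul0r, mulr0, add0r, subr0) => e1 dg.
  have d0 : g 1 1 != 0 by apply/eqP => d0; move/eqP: dg; rewrite d0 mulr0 eq_sym oner_eq0.
  by have : r = 1 by [apply: (mulIf d0); rewrite mul1r]; lra.
by have : r = y by [apply: (mulIf c0); rewrite -e2 mulrC]; lra.
Qed.

Lemma mp_eta_ccvg s (T : Type) (F : set_system T) {FF : Filter F} (f : T -> uhp R) z :
  ccvg F (fun x => val (f x)) (val z) -> ccvg F (fun x => mp_eta s (f x)) (mp_eta s z).
Proof.
move=> /ccvgP fz.
have /derivable1_diffP/differentiable_continuous hc := @mp_holo R s z.
have := cvg_comp _ _ fz hc; rewrite /= valKd => h.
by apply: ccvg_congr (iffRL (ccvgP _ _) h) => // x /=; rewrite valKd.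
Qed.

Lemma uhp_segment_subproof z (u : R) : 0 <= u <= 1 ->
  0 < cIm ('i + u%:C * (val z - 'i)).
Proof.
case: z => -[x y] /= y0 /andP[u0 u1]; rewrite mul0r addr0.
by have [->|u'] := eqVneq u 0; nra.
Qed.

(* A path from i (at u = 0) to z (at u = pi / 2). *)
Definition uhp_path z (u : R) : uhp R := insubd uhp_i ('i + (sin u ^+ 2)%:C * (val z - 'i)).

Lemma uhp_pathE z u : val (uhp_path z u) = 'i + (sin u ^+ 2)%:C * (val z - 'i).
Proof.
rewrite val_insubd uhp_segment_subproof // sqr_ge0 /=.
by have := cos2Dsin2 u; have := sqr_ge0 (cos u); lra.
Qed.

Lemma uhp_path_ccvg z u :
  ccvg (nbhs u) (fun v => val (uhp_path z v)) (val (uhp_path z u)).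
Proof.
rewrite uhp_pathE.
have H : ccvg (nbhs u) (fun v => 'i + (sin v ^+ 2)%:C * (val z - 'i))
    ('i + (sin u ^+ 2)%:C * (val z - 'i)).
  apply: ccvgD; first exact: ccvg_cst.
  apply: ccvgM; last exact: ccvg_cst.
  apply: ccvg_real; apply: (@continuous_comp _ _ _ (@sin R) (fun x => x ^+ 2)).
    exact: continuous_sin.
  exact: exprn_continuous.
by apply: ccvg_congr H => // v; rewrite uhp_pathE.
Qed.

(* The quotient of the two sides is continuous with values in {1, -1}. *)
Lemma mp_etaE s z :
  mp_eta s z = mpN s * psqrt (autj (mp_mx s) z / autj (mp_mx s) uhp_i).
Proof.
set r := fun w => autj (mp_mx s) w / autj (mp_mx s) uhp_i.
have ji := autj_neq0 uhp_i (mp_det s).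
have r0 w : mpN s * psqrt (r w) != 0.
  rewrite mulf_neq0 ?mpN_neq0 //; apply/eqP => h.
  by have := autj_ratio_slit w (mp_det s); rewrite -/(r w) h ltxx.
pose q w := mp_eta s w / (mpN s * psqrt (r w)).
suff q1 : q z = 1 by rewrite -[LHS](divfK (r0 z)) -/(q z) q1 mul1r.
have qsqr w : (q w == 1) || (q w == -1).
  rewrite -sqrf_eq1 /q expr_div_n exprMn psqrt_sqr /mpN !mp_sqr /r.
  by rewrite mulrC [X in X^-1]mulrC divfK // mulVf // autj_neq0 // mp_det.
pose p u := cRe (q (uhp_path z u)).
have pc : continuous p.
  move=> u; suff /ccvg_ReIm[] : ccvg (nbhs u) (fun v => q (uhp_path z v)) (q (uhp_path z u)) by [].
  have hu := uhp_path_ccvg z u.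
  apply: ccvgM; first exact: mp_eta_ccvg.
  apply: ccvgV => //; apply: ccvgM; first exact: ccvg_cst.
  apply: ccvg_psqrt; first exact: autj_ratio_slit (mp_det s).
  apply: ccvgM; last exact: ccvg_cst.
  apply: ccvgD; last exact: ccvg_cst.
  by apply: ccvgM => //; exact: ccvg_cst.
have pi2 : 0 <= pi / 2 :> R by rewrite divr_ge0 // pi_ge0.
have p0 : p 0 = 1.
  rewrite /p (_ : uhp_path z 0 = uhp_i); last first.
    by apply: val_inj; rewrite uhp_pathE sin0 expr0n /= mul0r addr0.
  by rewrite /q /r divff // psqrt_1 mulr1 divff // mpN_neq0.
have ppi : uhp_path z (pi / 2) = z.
  by apply: val_inj; rewrite uhp_pathE sin_pihalf expr1n mul1r addrC subrK.
have /orP[/eqP//|/eqP h] := qsqr z; exfalso.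
have p1 : p (pi / 2) = -1 by rewrite /p ppi h.
have [||c _] := @IVT R p 0 (pi / 2) 0 pi2.
- exact: continuous_subspaceT.
- by rewrite p0 p1 /Num.min /Num.max; case: ifP; lra.
- rewrite /p; have /orP[/eqP->|/eqP->] := qsqr (uhp_path z c) => /=; lra.
Qed.

(** [mpZ_N] and [mpN_sqr] recover the matrix, and [mp_etaE] recovers eta from its value at i. *)
Lemma mp_inj s t : mpZ s = mpZ t -> mpN s = mpN t -> s = t.
Proof.
move=> hZ hN; have h1 := mpZ_N s; have h2 := mpN_sqr s.
have [e1 e2] : mp_mx t 0 1 = mp_mx s 0 1 /\ mp_mx t 0 0 = mp_mx s 0 0.
  by have := mpZ_N t; rewrite -hZ -hN h1 => -[-> ->].
have [e3 e4] : mp_mx t 1 1 = mp_mx s 1 1 /\ mp_mx t 1 0 = mp_mx s 1 0.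
  by have := mpN_sqr t; rewrite -hN h2 => -[-> ->].
have E : mp_mx s = mp_mx t.
  by apply/matrixP => i j; elim/ord2_ind: i; elim/ord2_ind: j.
by apply: mp_ext => // z; rewrite !mp_etaE hN E.
Qed.

Definition cis (x : R) : R[i] := cos x +i* sin x.

Lemma cisD x y : cis (x + y) = cis x * cis y.
Proof. by apply: ceq; rewrite /cis /= ?cosD ?sinD //; ring. Qed.

Lemma cabs_cis x : cabs (cis x) = 1.
Proof.
by apply/eqP; rewrite -(@eqrXn2 _ 2) ?cabs_ge0 // cabs_sqr /= expr1n cos2Dsin2.
Qed.

Lemma cis0 : cis 0 = 1.
Proof. by apply: ceq; rewrite /cis /= ?cos0 ?sin0. Qed.

Lemma cis_onto (u : R[i]) : cabs u = 1 -> exists2 x, 0 <= x <= 2 * pi & cis x = u.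
Proof.
move=> hu; have : cRe u ^+ 2 + cIm u ^+ 2 = 1 by rewrite -cabs_sqr hu expr1n.
case: u {hu} => a b /= hab.
have a1 : -1 <= a <= 1 by apply/andP; split; have := sqr_ge0 b; nra.
have sq : Num.sqrt (1 - a ^+ 2) = `|b| by rewrite -hab addrAC subrr add0r sqrtr_sqr.
have pi0 := pi_ge0 R.
have [b0|b0] := leP 0 b.
  exists (acos a); first by rewrite acos_ge0 //=; have := acos_lepi a1; lra.
  by apply: ceq; rewrite /cis /= ?acosK ?sin_acos // sq ger0_norm.
exists (2 * pi - acos a).
  by have := acos_ge0 a1; have := acos_lepi a1; lra.
have -> : 2 * pi - acos a = (- acos a + pi) + pi by ring.
apply: ceq; first by rewrite /= !cosDpi opprK cosN acosK.
by rewrite /= !sinDpi opprK sinN sin_acos // sq ltr0_norm // opprK.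
Qed.

End MetaplecticTopology.

(** * Iwasawa coordinates and continuity *)

Section IwasawaCoordinates.
Local Open Scope complex_scope.
Context {R : realType}.
Local Notation Mp := (metaplectic R).
Implicit Types (s t : Mp) (p : R * R * R).

Lemma mpZ_kappaM s (t : R) : mpZ (s * mp_kappa t)%g = mpZ s.
Proof.
rewrite mpZM (_ : mobius (mp_mx (mp_kappa t)) uhp_i = uhp_i) //.
apply: val_inj; rewrite mobius_val ?mp_det //.
have nz := autj_neq0 uhp_i (mp_det (mp_kappa t)).
apply: (mulIf nz); rewrite divfK // /autj /= !mxE /=.
by apply: ceq => /=; ring.
Qed.

Lemma mpN_kappaM s (t : R) : mpN (s * mp_kappa t)%g = mpN s * cis (t / 2).
Proof.
rewrite mpNM; congr (_ * _); last first.
  by rewrite /mpN /mp_kappa mp_lift_eta_i.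
rewrite (_ : mobius (mp_mx (mp_kappa t)) uhp_i = uhp_i) //.
by apply: val_inj; have := mpZ_kappaM 1%g t; rewrite mul1g /mpZ mp_mx1 mobius1.
Qed.

Lemma mp_mx_na (x y : R) (y0 : 0 < y) : mp_mx (mp_n x * mp_a y0)%g =
  mx22 (Num.sqrt y) (x / Num.sqrt y) 0 (Num.sqrt y)^-1.
Proof.
apply/matrixP => i j; rewrite mp_mxM mulmx22 /=.
by elim/ord2_ind: i; elim/ord2_ind: j; rewrite !mxE /=; ring.
Qed.

Lemma mpZ_na (x y : R) (y0 : 0 < y) : mpZ (mp_n x * mp_a y0)%g = x +i* y.
Proof.
rewrite /mpZ mobius_val ?mp_det //.
have nz := autj_neq0 uhp_i (mp_det (mp_n x * mp_a y0)%g).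
have s0 : Num.sqrt y != 0 by rewrite gt_eqF // sqrtr_gt0.
have E : y = Num.sqrt y * Num.sqrt y by rewrite -expr2 sqr_sqrtr // ltW.
apply: (mulIf nz); rewrite divfK // /autj mp_mx_na /= !mxE /=.
move: s0 E {nz}; move: (Num.sqrt y) => r r0 E.
by apply: ceq => /=; rewrite E; field.
Qed.

Lemma mpN_na (x y : R) (y0 : 0 < y) :
  mpN (mp_n x * mp_a y0)%g = ((Num.sqrt (Num.sqrt y))^-1)%:C.
Proof.
rewrite mpNM [X in _ * X]/mpN mp_lift_eta_i.
have J z : autj (mp_mx (mp_n x)) z = 1 by rewrite /autj /= !mxE /= mul0r add0r.
have := mp_etaE (mp_n x) (mobius (mp_mx (mp_a y0)) uhp_i).
by rewrite !J divr1 psqrt_1 mulr1 /mpN mp_lift_eta_i => ->; rewrite mul1r.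
Qed.

Lemma iwasawaE (x y t : R) (y0 : 0 < y) :
  iwasawa (x, y, t) = (mp_n x * mp_a y0 * mp_kappa t)%g.
Proof.
by rewrite /iwasawa /=; case: pselect => //= y0'; rewrite (Prop_irrelevance y0' y0).
Qed.

Lemma mpZ_iwasawa p : iwasawa_dom p -> mpZ (iwasawa p) = p.1.1 +i* p.1.2.
Proof.
by case: p => -[x y] t y0; rewrite (@iwasawaE x y t y0) mpZ_kappaM mpZ_na.
Qed.

Lemma mpN_iwasawa p : iwasawa_dom p ->
  mpN (iwasawa p) = ((Num.sqrt (Num.sqrt p.1.2))^-1)%:C * cis (p.2 / 2).
Proof.
by case: p => -[x y] t y0; rewrite (@iwasawaE x y t y0) mpN_kappaM mpN_na.
Qed.

Lemma sqrt4_X4 (y : R) : 0 < y -> Num.sqrt (Num.sqrt y) ^+ 4 = y.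
Proof.
by move=> y0; rewrite -[4%N]/(2 * 2)%N exprM !sqr_sqrtr ?sqrtr_ge0 // ltW.
Qed.

Lemma cabs_mpN s : cabs (mpN s) * Num.sqrt (Num.sqrt (cIm (mpZ s))) = 1.
Proof.
have y0 := mpZ_Im s; have := mpZ_Im_N s.
set q := Num.sqrt _; have q0 : 0 <= q by rewrite sqrtr_ge0.
rewrite -{1}(sqrt4_X4 y0) -/q -exprMn => /eqP.
rewrite -[X in _ == X -> _](expr1n _ 4) eqrXn2 ?mulr_ge0 ?cabs_ge0 //.
by move=> /eqP <-; rewrite mulrC.
Qed.

(** As kappa_t has eta (i) = exp (i t / 2), the angle has period 4 pi. The bounded range of the
    angle later gives the compactness of [box]. *)
Lemma iwasawa_onto s : exists p,
  [/\ iwasawa_dom p, 0 <= p.2 <= 4 * pi & iwasawa p = s].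
Proof.
have y0 := mpZ_Im s; set q := Num.sqrt (Num.sqrt (cIm (mpZ s))).
have q0 : 0 < q by rewrite !sqrtr_gt0.
have [|x hx E] := @cis_onto R (mpN s * q%:C).
  by rewrite cabsM cabs_real gtr0_norm // cabs_mpN.
exists (cRe (mpZ s), cIm (mpZ s), 2 * x); split => //=; first by lra.
apply: mp_inj; first by rewrite mpZ_iwasawa //=; apply: ceq.
rewrite mpN_iwasawa //= mulrAC mulfV ?pnatr_eq0 // mul1r E -/q mulrCA -rmorphM /=.
by rewrite mulVf ?gt_eqF // mulr1.
Qed.

Lemma iwasawa_continuous p : iwasawa_dom p -> {for p, continuous (@iwasawa R)}.
Proof.
move=> dp V; rewrite /= nbhsE /= => -[U [oU Up] UV].
apply: filterS (_ : nbhs p (iwasawa_dom `&` @iwasawa R @^-1` U)).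
  by move=> q [_ /UV].
by apply: open_nbhs_nbhs; split; [exact: oU|split].
Qed.

Lemma mp_continuous (T : topologicalType) (f : Mp -> T) :
  (forall p, iwasawa_dom p -> {for p, continuous (f \o @iwasawa R)}) -> continuous f.
Proof.
move=> hf; apply/continuousP => A oA.
suff : open (iwasawa_dom `&` @iwasawa R @^-1` (f @^-1` A)) by [].
rewrite openE => p [dp Ap]; apply: filterI.
  by apply: open_nbhs_nbhs; split => //; exact: open_iwasawa_dom.
by apply: (hf p dp); apply: open_nbhs_nbhs.
Qed.

Lemma mp_ccvg (f : Mp -> R[i]) s :
  (forall p, iwasawa_dom p -> ccvg (nbhs p) (fun q => f (iwasawa q)) (f (iwasawa p))) ->
  ccvg (nbhs s) f (f s).
Proof.
move=> hf; apply/ccvgP.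
apply: (@mp_continuous (R[i]^o) (fun s => f s : R[i]^o)) => p dp.
by have /ccvgP := hf p dp.
Qed.

Lemma iwasawa_domP p : iwasawa_dom p -> \forall q \near p, iwasawa_dom q.
Proof. by move=> dp; apply: open_nbhs_nbhs; split => //; exact: open_iwasawa_dom. Qed.

Lemma coord_x p : q.1.1 @[q --> p] --> p.1.1.
Proof. by apply: (@continuous_comp _ _ _ fst fst); exact: cvg_fst. Qed.

Lemma coord_y p : q.1.2 @[q --> p] --> p.1.2.
Proof. by apply: (@continuous_comp _ _ _ fst snd); [exact: cvg_fst|exact: cvg_snd]. Qed.

Lemma coord_t p : q.2 @[q --> p] --> p.2.
Proof. exact: cvg_snd. Qed.

Lemma cis_ccvg (T : Type) (F : set_system T) {FF : Filter F} (f : T -> R) (a : R) :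
  f x @[x --> F] --> a -> ccvg F (fun x => cis (f x)) (cis a).
Proof.
move=> fa; apply/ccvg_ReIm; split.
  by apply: (cvg_comp _ _ fa); exact: continuous_cos.
by apply: (cvg_comp _ _ fa); exact: continuous_sin.
Qed.

Lemma sqrt4_cvg (T : Type) (F : set_system T) {FF : Filter F} (f : T -> R) (a : R) :
  f x @[x --> F] --> a -> Num.sqrt (Num.sqrt (f x)) @[x --> F] --> Num.sqrt (Num.sqrt a).
Proof.
move=> fa; apply: (cvg_comp (fun x => Num.sqrt (f x))); last exact: sqrt_continuous.
by apply: (cvg_comp _ _ fa); exact: sqrt_continuous.
Qed.

Lemma mpZ_ccvg s : ccvg (nbhs s) mpZ (mpZ s).
Proof.
apply: mp_ccvg => p dp; rewrite mpZ_iwasawa //.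
have H : ccvg (nbhs p) (fun q => q.1.1 +i* q.1.2) (p.1.1 +i* p.1.2).
  by apply/ccvg_ReIm; split => /=; [exact: coord_x|exact: coord_y].
by apply: ccvg_eq H; apply: filterS (iwasawa_domP dp) => q dq; rewrite mpZ_iwasawa.
Qed.

Lemma mpN_ccvg s : ccvg (nbhs s) mpN (mpN s).
Proof.
apply: mp_ccvg => p dp; rewrite mpN_iwasawa //.
have H : ccvg (nbhs p) (fun q => ((Num.sqrt (Num.sqrt q.1.2))^-1)%:C * cis (q.2 / 2))
    (((Num.sqrt (Num.sqrt p.1.2))^-1)%:C * cis (p.2 / 2)).
  apply: ccvgM.
    apply: ccvg_real; apply: cvgV; first by rewrite gt_eqF // !sqrtr_gt0.
    by apply: sqrt4_cvg; exact: coord_y.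
  by apply: cis_ccvg; apply: cvgM; [exact: coord_t|exact: cvg_cst].
by apply: ccvg_eq H; apply: filterS (iwasawa_domP dp) => q dq; rewrite mpN_iwasawa.
Qed.

Lemma cis_asin (v : R[i]) : cabs v = 1 -> 0 < cRe v -> cis (asin (cIm v)) = v.
Proof.
move=> hv v0; have : cRe v ^+ 2 + cIm v ^+ 2 = 1 by rewrite -cabs_sqr hv expr1n.
case: v v0 {hv} => a b /= a0 hab.
have b1 : -1 <= b <= 1 by apply/andP; split; have := sqr_ge0 a; nra.
apply: ceq; rewrite /= ?asinK // cos_asin // -hab addrK sqrtr_sqr gtr0_norm //.
Qed.

(* The map (mpZ, mpN) is a homeomorphism onto its image: near a point, the third Iwasawa
   coordinate is recovered from mpN by the arcsine. *)
Lemma mp_cvg (T : Type) (F : set_system T) {FF : Filter F} (h : T -> Mp) s :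
  ccvg F (fun x => mpZ (h x)) (mpZ s) -> ccvg F (fun x => mpN (h x)) (mpN s) ->
  h x @[x --> F] --> s.
Proof.
move=> hZ hN; have [p [dp _ ps]] := iwasawa_onto s.
pose q x := Num.sqrt (Num.sqrt (cIm (mpZ (h x)))).
(* [v] has modulus 1: it is the phase of [mpN (h x)] relative to that of [mpN s]. *)
pose v x := mpN (h x) * (q x)%:C * cis (- (p.2 / 2)).
pose k x := (cRe (mpZ (h x)), cIm (mpZ (h x)), p.2 + 2 * asin (cIm (v x))).
have [hx hy] := iffLR (ccvg_ReIm _ _) hZ.
have Zs : mpZ s = p.1.1 +i* p.1.2 by rewrite -ps mpZ_iwasawa.
have q0 x : 0 < q x by rewrite !sqrtr_gt0 mpZ_Im.
have v1 : ccvg F v 1.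
  have -> : 1 = mpN s * (Num.sqrt (Num.sqrt (cIm (mpZ s))))%:C * cis (- (p.2 / 2)).
    rewrite -ps mpN_iwasawa // mpZ_iwasawa //= fmorphV /=.
    have : (Num.sqrt (Num.sqrt p.1.2))%:C != 0 by rewrite fmorph_eq0 gt_eqF // !sqrtr_gt0.
    move: (_%:C) => a a0; rewrite [a^-1 * _]mulrC -!mulrA mulKf //.
    by rewrite -cisD subrr cis0.
  apply: ccvgM; last exact: ccvg_cst.
  by apply: ccvgM => //; apply: ccvg_real; apply: sqrt4_cvg.
have [v1r v1i] := iffLR (ccvg_ReIm _ _) v1.
have cv x : cabs (v x) = 1.
  by rewrite /v !cabsM cabs_cis mulr1 cabs_real gtr0_norm // cabs_mpN.
have kp : k x @[x --> F] --> p.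
  rewrite (_ : p = (p.1.1, p.1.2, p.2)); last by case: (p) => -[].
  have kp1 : (cRe (mpZ (h x)), cIm (mpZ (h x))) @[x --> F] --> (p.1.1, p.1.2).
    by rewrite Zs in hx hy; exact: cvg_pair hx hy.
  suff kp2 : p.2 + 2 * asin (cIm (v x)) @[x --> F] --> p.2 by exact: cvg_pair kp1 kp2.
  rewrite -[X in _ --> X]addr0; apply: cvgD; first exact: cvg_cst.
  rewrite -(mulr0 (2 : R)); apply: cvgM; first exact: cvg_cst.
  have as0 : asin (0 : R) = 0.
    rewrite -{1}(@sin0 R) sinK // in_itv /= oppr_le0; have := pi_ge0 R; lra.
  rewrite -as0; apply: (cvg_comp _ _ v1i).
  by apply: continuous_asin; rewrite /= ltrN10 ltr01.
rewrite -ps; apply: cvg_trans (cvg_comp _ _ kp (iwasawa_continuous dp)).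
apply: near_eq_cvg; near=> x.
have vr : 0 < cRe (v x) by near: x; apply: (cvgr_gt _ v1r); exact: ltr01.
have dk : iwasawa_dom (k x) by exact: mpZ_Im.
apply: mp_inj; first by rewrite /= mpZ_iwasawa //=; apply: ceq.
rewrite /= mpN_iwasawa //= -/(q x) mulrDl mulrAC mulfV ?pnatr_eq0 // mul1r cisD cis_asin //.
have qC : (q x)%:C != 0 by rewrite fmorph_eq0 gt_eqF.
rewrite fmorphV /= /v; move: ((q x)%:C) qC => a a0.
have := cisD (p.2 / 2) (- (p.2 / 2)); rewrite subrr cis0.
move: (cis _) (cis _) => c b bc.
have -> : a^-1 * (b * (mpN (h x) * a * c)) = a^-1 * a * (b * c) * mpN (h x) by ring.
by rewrite -bc mulVf // !mul1r.
Unshelve. all: by end_near. Qed.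

Lemma mpZM_E s t : mpZ (s * t)%g =
  ((mp_mx s 0 0)%:C * mpZ t + (mp_mx s 0 1)%:C) / ((mp_mx s 1 0)%:C * mpZ t + (mp_mx s 1 1)%:C).
Proof. by rewrite mpZM mobius_val ?mp_det. Qed.

Lemma mp_mulg_continuous (g : Mp) : continuous (fun s : Mp => (g * s)%g).
Proof.
move=> s; have hZ := @mpZ_ccvg s.
apply: (@mp_cvg _ (nbhs s) (nbhs_filter s)); last first.
  pose proof (ccvgM (@mp_eta_ccvg R g _ (nbhs s) _ (fun t : Mp => mobius (mp_mx t) uhp_i)
    (mobius (mp_mx s) uhp_i) hZ) (@mpN_ccvg s)) as H.
  exact: H.
have lin (c d : R) : ccvg (nbhs s) (fun t => c%:C * mpZ t + d%:C) (c%:C * mpZ s + d%:C).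
  by pose proof (ccvgD (ccvgM (ccvg_cst c%:C) hZ) (ccvg_cst d%:C)) as H.
pose proof (ccvgM (lin (mp_mx g 0 0) (mp_mx g 0 1))
  (ccvgV (autj_neq0 (mobius (mp_mx s) uhp_i) (mp_det g)) (lin (mp_mx g 1 0) (mp_mx g 1 1)))) as H.
by apply: ccvg_congr H => [t|]; rewrite mpZM_E.
Qed.

Lemma theta_ccvg s : ccvg (nbhs s) theta (theta s).
Proof.
have y0 := mpZ_Im s.
have Re0 : 0 < cRe (psqrt (mpZ s + 'i)).
  by apply: psqrt_Re_gt0; rewrite raddfD /= gt_eqF // addr_gt0.
apply: ccvgM; first exact: ccvg_cst.
apply: ccvgV; first by rewrite mulf_neq0 ?mpN_neq0 //; apply: contraTneq Re0 => ->; rewrite ltxx.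
apply: ccvgM; last exact: mpN_ccvg.
apply: ccvg_psqrt => //; apply: ccvgD; last exact: ccvg_cst.
exact: mpZ_ccvg.
Qed.

Lemma al_ccvg s : ccvg (nbhs s) (fun t => al (mp_mx t)) (al (mp_mx s)).
Proof.
have E t : al (mp_mx t) = (mpZ t + 'i) * mpN t ^+ 2 / (2 * 'i).
  by rewrite mpZ_add_i mulrC mulKf // two_i_neq0.
rewrite E; under eq_fun do rewrite E.
apply: ccvgM; last exact: ccvg_cst.
apply: ccvgM; last by apply: ccvgX; exact: mpN_ccvg.
by apply: ccvgD; [exact: mpZ_ccvg|exact: ccvg_cst].
Qed.

Lemma be_ccvg s : ccvg (nbhs s) (fun t => be (mp_mx t)) (be (mp_mx s)).
Proof.
have E t : be (mp_mx t) = (mpZ t - 'i) * mpN t ^+ 2 / (2 * 'i).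
  by rewrite mpZ_sub_i mulrC mulKf // two_i_neq0.
rewrite E; under eq_fun do rewrite E.
apply: ccvgM; last exact: ccvg_cst.
apply: ccvgM; last by apply: ccvgX; exact: mpN_ccvg.
by apply: ccvgD; [exact: mpZ_ccvg|exact: ccvg_cst].
Qed.

Lemma Gfun_ccvg a b n s : ccvg (nbhs s) (Gfun a b n) (Gfun a b n s).
Proof.
have h := @be_ccvg s.
apply: ccvgM; last by apply: ccvgX; exact: theta_ccvg.
apply: ccvgM; apply: ccvgX => //; exact: ccvg_conj.
Qed.

Lemma cabs_theta_continuous : continuous (fun s : Mp => cabs (theta s)).
Proof. by move=> s; exact: (@ccvg_cabs R _ (nbhs s) (nbhs_filter s) _ _ (@theta_ccvg s)). Qed.

Lemma mp_nbhs1 (V : set Mp) : nbhs (1%g : Mp) V ->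
  exists2 e, 0 < e & forall s, cabs (mpZ s - 'i) < e -> cabs (mpN s - 1) < e -> V s.
Proof.
move=> hV.
(* The filter generated by the sets sought. By [mp_cvg] the identity map converges along it to 1,
   that is, every neighbourhood of 1 contains one of these sets. *)
pose F := filter_from [set e : R | 0 < e]
  (fun e => [set s : Mp | cabs (mpZ s - 'i) < e /\ cabs (mpN s - 1) < e]).
have FF : Filter F.
  apply: filter_from_filter; first by exists 1; rewrite /=.
  move=> e1 e2 /= e10 e20; exists (Num.min e1 e2); first by rewrite /= lt_min e10.
  by move=> s /= [h1 h2]; move: h1 h2; rewrite !lt_min => /andP[? ?] /andP[? ?].
have Z1 : mpZ (1%g : Mp) = 'i by rewrite /mpZ mp_mx1 mobius1.
have cv : s @[s --> F] --> (1%g : Mp).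
  apply: mp_cvg => e e0; exists e => // s /= [].
    by rewrite Z1.
  by [].
have [e e0 he] := cv V hV.
by exists e => // s h1 h2; apply: he.
Qed.

End IwasawaCoordinates.

(** * Lattice sums *)

Section BoundedSums.
Context {R : realType}.

(** Unlike in [fsum_bounded], the bound is a parameter, so that one bound can serve a whole family
    of sums. *)
Definition fsum_le_by (I : choiceType) (K : R) (b : I -> R) : Prop :=
  (forall i, 0 <= b i) /\ forall B : {fset I}, \sum_(i <- B) b i <= K.

Lemma fsum_le_by_bounded (I : choiceType) K (b : I -> R) :
  fsum_le_by K b -> fsum_bounded b.
Proof. by move=> [b0 hK]; split=> //; exists K. Qed.

Lemma fsum_le_by_nat K (b : nat -> R) : (forall n, 0 <= b n) ->
  (forall n, \sum_(0 <= i < n) b i <= K) -> fsum_le_by K b.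
Proof.
move=> b0 hK; split=> // B.
pose n := (\max_(i <- B) i).+1; apply: le_trans (hK n).
have -> : \sum_(0 <= i < n) b i = \sum_(i <- [fset i in iota 0 n]%fset) b i.
  rewrite /index_iota subn0; symmetry; apply: perm_big; apply: uniq_perm => //.
  - exact: iota_uniq.
  - by move=> i; rewrite !inE.
apply: fsum_le => //; apply/fsubsetP => i iB; rewrite !inE mem_iota /=.
have : (i <= \max_(i <- B) i)%N by rewrite (big_fsetD1 i) //= leq_maxl.
by move=> h; rewrite add1n ltnS h andbT lt0n orbN.
Qed.

Lemma fsum_le_by_comp (I J : choiceType) K (b : J -> R) (f : I -> J) :
  injective f -> fsum_le_by K b -> fsum_le_by K (fun i => b (f i)).
Proof.
move=> fI [b0 hK]; split=> [i|B]; first exact: b0.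
apply: le_trans (hK [fset f i | i in B]%fset).
by rewrite big_imfset //= => x y _ _; exact: fI.
Qed.

Lemma fsum_le_by_le (I : choiceType) K (b b' : I -> R) :
  (forall i, 0 <= b' i <= b i) -> fsum_le_by K b -> fsum_le_by K b'.
Proof.
move=> h [b0 hK]; split=> [i|B]; first by case/andP: (h i).
by apply: le_trans (hK B); apply: ler_sum => i _; case/andP: (h i).
Qed.

Lemma fsum_le_by_int K (b : nat -> R) :
  fsum_le_by K b -> fsum_le_by (K + K) (fun j : int => b `|j|%N).
Proof.
move=> [b0 hK]; split=> [j|B]; first exact: b0.
have key (B' : {fset int}) : {in B' &, injective absz} -> \sum_(j <- B') b `|j|%N <= K.
  move=> inj; apply: le_trans (hK [fset `|j|%N | j in B']%fset).
  by rewrite big_imfset.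
rewrite (big_fsetID _ (fun j : int => 0 <= j)) /= lerD // key // => x y;
  rewrite !inE => /andP[_ x0] /andP[_ y0] E; lia.
Qed.

Lemma fsum_le_by_prod (I J : choiceType) K L (b : I -> R) (c : J -> R) :
  fsum_le_by K b -> fsum_le_by L c ->
  fsum_le_by (K * L) (fun ij : I * J => b ij.1 * c ij.2).
Proof.
move=> [b0 hK] [c0 hL]; split=> [ij|B]; first by rewrite mulr_ge0.
pose B1 := [fset ij.1 | ij in B]%fset; pose B2 := [fset ij.2 | ij in B]%fset.
pose P := [fset ((i, j) : (I * J)%type) | i in B1, j in B2]%fset.
have h : \sum_(ij <- B) (b ij.1 * c ij.2) <= \sum_(ij <- P) (b ij.1 * c ij.2).
  apply: fsum_le => [ij|]; first by rewrite mulr_ge0.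
  apply/fsubsetP => -[i j] ijB; apply/imfset2P; exists i.
    by apply/imfsetP; exists (i, j).
  by exists j => //; apply/imfsetP; exists (i, j).
apply: le_trans h _.
rewrite big_imfset2 /=; last by move=> [i j] [i' j'] _ _ /= [-> ->].
under eq_bigr do rewrite -mulr_sumr.
rewrite -mulr_suml ler_pM // ?sumr_ge0 //.
Qed.

Lemma fsum_le_by_scale (I : choiceType) K c (b : I -> R) : 0 <= c ->
  fsum_le_by K b -> fsum_le_by (c * K) (fun i => c * b i).
Proof.
move=> c0 [b0 hK]; split=> [i|B]; first by rewrite mulr_ge0.
by rewrite -mulr_sumr ler_wpM2l.
Qed.

(** Eighth roots make the exponent 9/8 available through square roots alone. It exceeds 1, so the
    sum converges, and [theta_cell] can still afford it. *)
Definition sqrt8 (x : R) : R := Num.sqrt (Num.sqrt (Num.sqrt x)).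

Lemma sqrt8X (x : R) : 0 <= x -> sqrt8 x ^+ 8 = x.
Proof.
by move=> x0; rewrite -[8%N]/(2 * (2 * 2))%N !exprM !sqr_sqrtr ?sqrtr_ge0.
Qed.

Lemma sqrt8_gt0 (x : R) : 0 < x -> 0 < sqrt8 x.
Proof. by move=> x0; rewrite !sqrtr_gt0. Qed.

(* Applied to u = n ^ (1/8), this makes the sum of the n ^ (- 9/8) telescope. *)
Lemma sqrt8_step (u v : R) : 0 < u -> u <= v -> v ^+ 8 = u ^+ 8 + 1 ->
  v ^- 9 <= 8 * (u^-1 - v^-1).
Proof.
move=> u0 uv E; have v0 := lt_le_trans u0 uv.
have h : 1 <= (v - u) * (8 * v ^+ 7).
  have e1 : v ^+ 8 - u ^+ 8 = 1 by rewrite E addrAC subrr add0r.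
  rewrite -[leLHS]e1 subrXX ler_wpM2l ?subr_ge0 //.
  apply: le_trans (_ : _ <= \sum_(i < 8) v ^+ 7) _; last by rewrite sumr_const card_ord mulr_natl.
  apply: ler_sum => i _; rewrite [X in _ <= X](_ : _ = v ^+ (8.-1 - i) * v ^+ i).
    by rewrite ler_wpM2l ?exprn_ge0 ?lerXn2r ?nnegrE // ltW.
  by rewrite -exprD subnK // -ltnS.
have -> : 8 * (u^-1 - v^-1) = ((v - u) * (8 * v ^+ 7)) * (v / u) * v ^- 9.
  by field; rewrite !gt_eqF.
rewrite ler_peMl ?invr_ge0 ?exprn_ge0 ?(ltW v0) //.
by rewrite mulr_ege1 // ler_pdivlMr // mul1r.
Qed.

Lemma fsum_sqrt8 : fsum_le_by 9 (fun n : nat => sqrt8 n.+1%:R ^- 9).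
Proof.
have pos n : 0 < sqrt8 n.+1%:R by rewrite sqrt8_gt0.
apply: fsum_le_by_nat => [n|n]; first by rewrite invr_ge0 exprn_ge0 // ltW.
(* The first term is 1, and [sqrt8_step] telescopes the others to 8 (1 - 1/u) with u the last
   root. *)
have h : \sum_(0 <= i < n.+1) sqrt8 i.+1%:R ^- 9 <= 9 - 8 * (sqrt8 n.+1%:R)^-1.
  elim: n => [|n ih].
    by rewrite big_nat1 /sqrt8 !sqrtr1 expr1n invr1; lra.
  rewrite big_nat_recr //=; apply: le_trans (lerD ih _) _.
    apply: (@sqrt8_step (sqrt8 n.+1%:R)) => //.
      by rewrite /sqrt8 !ler_wsqrtr // ler_nat.
    by rewrite !sqrt8X // -natr1.
  by lra.
apply: le_trans (_ : \sum_(0 <= i < n.+1) sqrt8 i.+1%:R ^- 9 <= _).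
  by rewrite big_nat_recr //= lerDl invr_ge0 exprn_ge0 // ltW.
by apply: le_trans h _; rewrite gerBl mulr_ge0 // invr_ge0 ltW.
Qed.

Lemma fsum_geometric (q : R) : 0 <= q < 1 -> fsum_le_by (1 - q)^-1 (fun n => q ^+ n).
Proof.
move=> /andP[q0 q1]; apply: fsum_le_by_nat => [n|n]; first by rewrite exprn_ge0.
have q1' : 0 < 1 - q by rewrite subr_gt0.
rewrite -div1r ler_pdivlMr // mulrC.
have -> : (1 - q) * \sum_(0 <= i < n) q ^+ i = 1 - q ^+ n.
  by rewrite big_mkord -opprB mulNr -subrX1 opprB.
by rewrite gerBl exprn_ge0.
Qed.

Lemma fsum_indicator (Q : nat) : fsum_le_by Q.+1%:R (fun n : nat => (n <= Q)%N%:R).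
Proof.
apply: fsum_le_by_nat => [n|n]; first exact: ler0n.
suff : \sum_(0 <= i < n) (i <= Q)%N%:R <= (minn n Q.+1)%:R :> R.
  by move=> /le_trans; apply; rewrite ler_nat geq_minr.
elim: n => [|n ih]; first by rewrite big_geq // min0n.
rewrite big_nat_recr //=; apply: le_trans (lerD ih (lexx _)) _.
by rewrite -natrD ler_nat; case: leqP => h; lia.
Qed.

End BoundedSums.

(** * Cells of the hyperbolic plane *)

Section Cells.
Local Open Scope complex_scope.
Context {R : realType}.
Local Notation Mp := (metaplectic R).
Implicit Types (s t u : Mp).

Lemma cabs_two_i_sqr : cabs (2 * 'i : R[i]) ^+ 2 = 4.
Proof.
rewrite cabsM exprMn [X in _ * X]cabs_sqr /= expr0n expr1n add0r mulr1.
by rewrite -(rmorph_nat (real_complex R)) cabs_real normr_nat; ring.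
Qed.

(** With d the hyperbolic distance from i to g.i, this says |be| = sinh (d/2), and the next lemma
    says |al| = cosh (d/2). *)
Lemma cabs_mpZ_sub_i s :
  cabs (mpZ s - 'i) ^+ 2 = 4 * cabs (be (mp_mx s)) ^+ 2 * cIm (mpZ s).
Proof.
have h : cabs (mpZ s - 'i) ^+ 2 * cabs (mpN s) ^+ 4 = 4 * cabs (be (mp_mx s)) ^+ 2.
  have := congr1 (fun z => cabs z ^+ 2) (mpZ_sub_i s).
  rewrite /= cabsM cabsX [cabs (2 * 'i * _)]cabsM (exprMn _ (cabs (mpZ s - 'i))) -exprM (exprMn _
    (cabs (2 * 'i))) => ->.
  by rewrite cabs_two_i_sqr.
by rewrite -h -mulrA [_ ^+ 4 * _]mulrC mpZ_Im_N mulr1.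
Qed.

Lemma cabs_mpZ_add_i s :
  cabs (mpZ s + 'i) ^+ 2 = 4 * cabs (al (mp_mx s)) ^+ 2 * cIm (mpZ s).
Proof.
have h : cabs (mpZ s + 'i) ^+ 2 * cabs (mpN s) ^+ 4 = 4 * cabs (al (mp_mx s)) ^+ 2.
  have := congr1 (fun z => cabs z ^+ 2) (mpZ_add_i s).
  rewrite /= cabsM cabsX [cabs (2 * 'i * _)]cabsM (exprMn _ (cabs (mpZ s + 'i))) -exprM (exprMn _
    (cabs (2 * 'i))) => ->.
  by rewrite cabs_two_i_sqr.
by rewrite -h -mulrA [_ ^+ 4 * _]mulrC mpZ_Im_N mulr1.
Qed.

(* The invariance of the hyperbolic distance. *)
Lemma be_mulV s t : 4 * cabs (be (mp_mx (s^-1 * t)%g)) ^+ 2 * (cIm (mpZ s) * cIm (mpZ t)) =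
  cabs (mpZ t - mpZ s) ^+ 2.
Proof.
have bV : be (mp_mx s^-1%g) = - be (mp_mx s).
  have := beM (mp_mx s^-1%g) (mp_mx s); rewrite -mp_mxM mulVg mp_mx1 alV conjcK.
  have -> : be (1%:M : 'M[R]_2) = 0 by apply: ceq; rewrite /= !mxE /=; field.
  move=> h; apply: (mulIf (al_neq0 (mp_det s))); apply/eqP.
  by rewrite mulNr -subr_eq0 opprK [_ * be _]mulrC in h *; rewrite -h.
have E : mpN s ^+ 2 * mpN t ^+ 2 * (mpZ t - mpZ s) = 2 * 'i * be (mp_mx (s^-1 * t)%g).
  rewrite mp_mxM beM alV conjcK bV.
  have i0 := @two_i_neq0 R.
  apply: (mulfI i0); transitivity (- ((2 * 'i * be (mp_mx s)) * (2 * 'i * al (mp_mx t))) +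
    (2 * 'i * al (mp_mx s)) * (2 * 'i * be (mp_mx t))); last by ring.
  by rewrite -!mpZ_add_i -!mpZ_sub_i; ring.
have := congr1 (fun z => cabs z ^+ 2) E.
rewrite /= (cabsM (_ * _)) (cabsM (_ ^+ 2)) !cabsX [cabs (2 * 'i * _)]cabsM.
rewrite (exprMn _ (_ * _)) (exprMn _ (cabs (mpN s) ^+ 2)) -!exprM (exprMn _ (cabs (2 * 'i))).
rewrite cabs_two_i_sqr.
have := mpZ_Im_N s; have := mpZ_Im_N t; move: (_ ^+ (2 * 2)) (_ ^+ (2 * 2)) => a b h1 h2 h.
rewrite -h.
have -> : b * a * cabs (mpZ t - mpZ s) ^+ 2 * (cIm (mpZ s) * cIm (mpZ t)) =
  (cIm (mpZ s) * b) * (cIm (mpZ t) * a) * cabs (mpZ t - mpZ s) ^+ 2 by ring.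
by rewrite h1 h2 !mul1r.
Qed.

(** With u = s^-1 t, the cocycle relation reads mpN t = mpN s (psqrt r) (mpN u). Here |r - 1| <=
    |mpZ u - i|, because the entry c of s is at most |j(s,i)|. Both errors are at most d, and
    dividing by psqrt r, of modulus at least 1/2, gives 4 d. *)
Lemma mpN_mulV_near s t (d : R) : d <= 1/2 -> cabs (mpZ (s^-1 * t)%g - 'i) <= d ->
  cabs (mpN t / mpN s - 1) <= d -> cabs (mpN (s^-1 * t)%g - 1) <= 4 * d.
Proof.
move=> d2 hZ hN; set u := (s^-1 * t)%g in hZ *.
set r := autj (mp_mx s) (mobius (mp_mx u) uhp_i) / autj (mp_mx s) uhp_i.
have ji := autj_neq0 uhp_i (mp_det s).
have Et : mpN t = mpN s * psqrt r * mpN u.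
  by rewrite -mp_etaE -mpNM /u mulgA mulgV mul1g.
have r1 : cabs (r - 1) <= cabs (mpZ u - 'i).
  have -> : r - 1 = (mp_mx s 1 0)%:C * (mpZ u - 'i) / autj (mp_mx s) uhp_i.
    apply: (mulIf ji); rewrite mulrBl !divfK // mul1r /autj -/(mpZ u).
    by case: (mpZ u) => a b; apply: ceq => /=; ring.
  rewrite !cabsM mulrAC cabs_real -[leRHS]mul1r ler_wpM2r ?cabs_ge0 // cabsV.
  rewrite ler_pdivrMr ?cabs_gt0 // mul1r -mp_sqr -/(mpN s) mpN_sqr.
  exact: (cIm_le_cabs (mp_mx s 1 1 +i* mp_mx s 1 0)).
have q1 : cabs (psqrt r - 1) <= d.
  apply: le_trans hZ; apply: le_trans r1.
  by have := psqrt_lip 1 r; rewrite psqrt_1 /= mulr1.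
have q0 : psqrt r != 0.
  by apply: contraTneq q1 => ->; rewrite sub0r cabsN cabs1 -ltNge; lra.
have N0 := mpN_neq0 s.
have Eu : mpN u - 1 = ((mpN t / mpN s - 1) - (psqrt r - 1)) / psqrt r.
  by rewrite Et; field; rewrite q0 N0.
have qh : 1/2 <= cabs (psqrt r).
  have := cabs_leD 1 (psqrt r); rewrite cabs1 cabsB; lra.
rewrite Eu cabsM cabsV ler_pdivrMr; last by lra.
apply: le_trans (cabsD _ _) _; rewrite cabsN.
have := cabs_ge0 (psqrt r - 1); nra.
Qed.

Lemma mpZ_mulV_near s t (k : R) : 0 <= k <= 1/2 ->
  cabs (mpZ t - mpZ s) ^+ 2 <= k ^+ 2 * (cIm (mpZ s) * cIm (mpZ t)) ->
  cabs (mpZ (s^-1 * t)%g - 'i) <= 2 * k.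
Proof.
move=> k2; rewrite -be_mulV; set u := (s^-1 * t)%g.
rewrite ler_pM2r ?mulr_gt0 ?mpZ_Im // => hk.
have h := cabs_mpZ_sub_i u; have y0 := mpZ_Im u.
have : cIm (mpZ u) <= 1 + cabs (mpZ u - 'i).
  have := cIm_le_cabs (mpZ u - 'i); rewrite raddfB /= => h1.
  by have := ler_norm (cIm (mpZ u) - 1); lra.
have := cabs_ge0 (mpZ u - 'i); move: (cabs _) (cIm _) h y0 => e y h y0 e0 hy.
(* The height of u is itself controlled by e = |mpZ u - i|, so the estimate is improved in two
   rounds: assuming e > 2 k, it first gives e <= 1, then e ^ 2 <= 2 k ^ 2, a contradiction. *)
have h2 : e ^+ 2 <= k ^+ 2 * (1 + e).
  by rewrite h; apply: ler_pM => //; [rewrite mulr_ge0 ?sqr_ge0|exact: ltW].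
rewrite leNgt; apply/negP => lt_e.
have /andP[k0 kh] := k2.
have k4 : k ^+ 2 <= 1/4 by rewrite expr2; nra.
have h3 : k ^+ 2 * (1 + e) <= 1/4 * (1 + e) by rewrite ler_wpM2r //; lra.
have e1 : e <= 1.
  rewrite leNgt; apply/negP => e1.
  have : e * 1 <= e * e by rewrite ler_wpM2l // ltW.
  by move: h2 h3; rewrite expr2; lra.
have h4 : k ^+ 2 * (1 + e) <= k ^+ 2 * 2 by rewrite ler_wpM2l ?sqr_ge0 //; lra.
have h5 : (2 * k) * (2 * k) < e * e by apply: ltr_pM => //; lra.
have : 0 <= k ^+ 2 by exact: sqr_ge0.
by move: h2 h4 h5; rewrite !expr2; lra.
Qed.

Variable e : R.
(** The bound 1/16 makes 8 e at most 1/2, as the use of [mpN_mulV_near] in [cell_near] demands. *)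
Hypothesis e0 : 0 < e <= 1/16.

(** The grid follows the invariant geometry: heights are rounded on a logarithmic scale, real parts
    at a scale proportional to the height, and [mpN], whose modulus is the height to the power -1/4,
    after multiplication by the fourth root [celly4] of the rounded height. *)
Definition cellj s : int := Num.floor (ln (cIm (mpZ s)) / e).
Definition celly (j : int) : R := expR (e * j%:~R).
Definition celly4 (j : int) : R := expR (e * j%:~R / 4).
Definition celll s : int := Num.floor (cRe (mpZ s) / (e * celly (cellj s))).
Definition celln1 s : int := Num.floor (cRe (mpN s) * celly4 (cellj s) / e).
Definition celln2 s : int := Num.floor (cIm (mpN s) * celly4 (cellj s) / e).
Definition cell s : (int * int) * (int * int) := ((cellj s, celll s), (celln1 s, celln2 s)).

Lemma celly_gt0 j : 0 < celly j.
Proof. exact: expR_gt0. Qed.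

Lemma celly4_gt0 j : 0 < celly4 j.
Proof. exact: expR_gt0. Qed.

Lemma celly4X j : celly4 j ^+ 4 = celly j.
Proof. by rewrite -expRM_natl; congr expR; field. Qed.

Lemma expRe : expR e <= 1 + 2 * e.
Proof.
have /andP[e0' e8] := e0; have h := expR_ge1Dx (- e); rewrite expRN in h.
have E0 := expR_gt0 e; have h' : 0 < 1 - e by lra.
have : expR e * (1 - e) <= 1.
  by rewrite mulrC -ler_pdivlMr // div1r; exact: h.
nra.
Qed.

Lemma celly_itv s : celly (cellj s) <= cIm (mpZ s) < celly (cellj s) * (1 + 2 * e).
Proof.
have y0 := mpZ_Im s; have /andP[e0' _] := e0.
have := floor_itv (ln (cIm (mpZ s)) / e); rewrite -/(cellj s) => /andP[h1 h2].
rewrite ler_pdivlMr // mulrC in h1; rewrite ltr_pdivrMr // mulrC in h2.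
apply/andP; split.
  by rewrite -[leRHS]lnK ?posrE // ler_expR.
apply: lt_le_trans (_ : _ < expR (e * (cellj s + 1)%:~R)) _.
  by rewrite -[ltLHS]lnK ?posrE // ltr_expR.
rewrite intrD mulrDr mulr1 expRD ler_wpM2l ?expR_ge0 //; exact: expRe.
Qed.

Lemma celll_itv s : (celll s)%:~R * (e * celly (cellj s)) <= cRe (mpZ s) <
  (celll s + 1)%:~R * (e * celly (cellj s)).
Proof.
have /andP[e0' _] := e0; have ey0 : 0 < e * celly (cellj s) by rewrite mulr_gt0 ?celly_gt0.
have := floor_itv (cRe (mpZ s) / (e * celly (cellj s))).
by rewrite ler_pdivlMr // ltr_pdivrMr.
Qed.

Lemma floor_dist (x y : R) : Num.floor x = Num.floor y -> `|x - y| <= 1.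
Proof.
move=> E; have := floor_itv x; have := floor_itv y; rewrite E intrD.
move: (_%:~R) => f /andP[h1 h2] /andP[h3 h4]; rewrite ler_norml; lra.
Qed.

Lemma sqrt4_celly4 s : celly4 (cellj s) <= Num.sqrt (Num.sqrt (cIm (mpZ s))) <= 2 * celly4 (cellj
  s).
Proof.
have /andP[h1 h2] := celly_itv s; have y0 := celly_gt0 (cellj s).
have z0 := celly4_gt0 (cellj s); have /andP[e0' e8] := e0.
have q0 : 0 <= Num.sqrt (Num.sqrt (cIm (mpZ s))) by rewrite sqrtr_ge0.
apply/andP; split; rewrite -(@ler_pXn2r _ 4) ?nnegrE ?(ltW z0) //.
- by rewrite celly4X sqrt4_X4 // mpZ_Im.
- have -> : (2 * celly4 (cellj s)) ^+ 4 = 16 * celly4 (cellj s) ^+ 4 by ring.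
  by rewrite celly4X sqrt4_X4 ?mpZ_Im //; nra.
- by rewrite mulr_ge0 // ltW.
Qed.

Lemma cell_near s t : cell s = cell t ->
  cabs (mpZ (s^-1 * t)%g - 'i) <= 8 * e /\ cabs (mpN (s^-1 * t)%g - 1) <= 32 * e.
Proof.
move=> [Ej El En1 En2].
have {El} Dl := floor_dist (esym El); have {En1} D1 := floor_dist (esym En1).
have {En2} D2 := floor_dist (esym En2); have /andP[e0' e8] := e0.
have y0 := celly_gt0 (cellj s); have z0 := celly4_gt0 (cellj s).
have /andP[hs1 hs2] := celly_itv s; have /andP[ht1 ht2] := celly_itv t.
rewrite -{}Ej in ht1 ht2 Dl D1 D2.
have ey0 : 0 < e * celly (cellj s) by rewrite mulr_gt0.
have hx : `|cRe (mpZ t) - cRe (mpZ s)| <= e * celly (cellj s).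
  by move: Dl; rewrite -mulrBl normrM normfV (gtr0_norm ey0) ler_pdivrMr // mul1r.
have hy : `|cIm (mpZ t) - cIm (mpZ s)| <= 2 * (e * celly (cellj s)).
  by rewrite ler_norml; apply/andP; split; nra.
have hZ : cabs (mpZ t - mpZ s) ^+ 2 <= (4 * e) ^+ 2 * (cIm (mpZ s) * cIm (mpZ t)).
  have h1 : cabs (mpZ t - mpZ s) <= 3 * (e * celly (cellj s)).
    by apply: le_trans (cabs_le_ReIm _) _; rewrite !raddfB /=; lra.
  apply: le_trans (_ : (3 * (e * celly (cellj s))) ^+ 2 <= _).
    by rewrite lerXn2r ?nnegrE ?cabs_ge0 //; lra.
  have -> : (3 * (e * celly (cellj s))) ^+ 2 = 9 * e ^+ 2 * (celly (cellj s) * celly (cellj s))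
    by ring.
  have -> : (4 * e) ^+ 2 = 16 * e ^+ 2 by ring.
  have e20 := sqr_ge0 e.
  apply: ler_pM; [by rewrite mulr_ge0|by rewrite mulr_ge0 ?ltW|by rewrite ler_wpM2r // ler_nat|].
  by apply: ler_pM; rewrite ?(ltW y0).
have h8 : cabs (mpZ (s^-1 * t)%g - 'i) <= 8 * e.
  have -> : 8 * e = 2 * (4 * e) by ring.
  by apply: mpZ_mulV_near hZ; lra.
split => //; have -> : 32 * e = 4 * (8 * e) by ring.
apply: mpN_mulV_near => //; first by lra.
have hN : cabs (mpN t - mpN s) * celly4 (cellj s) <= 2 * e.
  rewrite -(gtr0_norm z0) -cabs_real -cabsM; apply: le_trans (cabs_le_ReIm _) _.
  have key (x y : R) : `|y * celly4 (cellj s) / e - x * celly4 (cellj s) / e| <= 1 ->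
      `|(y - x) * celly4 (cellj s)| <= e.
    by rewrite -!mulrBl normrM normfV (gtr0_norm e0') ler_pdivrMr // mul1r.
  rewrite cReM cImM /= !mulr0 subr0 add0r !raddfB /=.
  have := key _ _ D1; have := key _ _ D2; lra.
have N0 := mpN_neq0 s; have cN0 : 0 < cabs (mpN s) by rewrite cabs_gt0.
have -> : mpN t / mpN s - 1 = (mpN t - mpN s) / mpN s by field.
rewrite cabsM cabsV ler_pdivrMr //.
have /andP[_ q2] := sqrt4_celly4 s.
have h1 : 1 <= cabs (mpN s) * (2 * celly4 (cellj s)).
  by rewrite -[leLHS](cabs_mpN s) ler_wpM2l // ltW.
rewrite -(ler_pM2r z0); apply: le_trans hN _.
have -> : 8 * e * cabs (mpN s) * celly4 (cellj s) =
  (4 * e) * (cabs (mpN s) * (2 * celly4 (cellj s))) by ring.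
by rewrite -[leLHS]mulr1; apply: ler_pM => //; lra.
Qed.

Definition Qcell : nat := `|Num.floor (2 / e)|%N.

(** |mpN| [celly4] is at most 1, so the last two indices take finitely many values and do not affect
    summability. *)
Lemma celln_bound s : (`|celln1 s| <= Qcell)%N /\ (`|celln2 s| <= Qcell)%N.
Proof.
have /andP[e0' e8] := e0; have z0 := celly4_gt0 (cellj s).
have e2 : 1 <= 1 / e by rewrite ler_pdivlMr //; lra.
have key (x : R) : `|x| <= cabs (mpN s) ->
    (`|Num.floor (x * celly4 (cellj s) / e)| <= Qcell)%N.
  move=> hx.
  have h : `|x * celly4 (cellj s) / e| <= 1 / e.
    rewrite normrM normfV (gtr0_norm e0') ler_wpM2r ?invr_ge0 ?(ltW e0') //.
    rewrite normrM (gtr0_norm z0) -(cabs_mpN s); apply: ler_pM => //; first exact: ltW.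
    by have /andP[] := sqrt4_celly4 s.
  have e3 : 2 / e = 1 / e + 1 / e by field; rewrite gt_eqF.
  have := floor_itv (x * celly4 (cellj s) / e).
  move: h; rewrite ler_norml; move: (x * _ / e) => u /andP[u1 u2].
  rewrite intrD => /andP[f1 f2].
  have f3 : Num.floor u <= Num.floor (2 / e) by rewrite floor_ge_int; lra.
  have f4 : - Num.floor u <= Num.floor (2 / e) by rewrite floor_ge_int rmorphN /=; lra.
  rewrite /Qcell; lia.
by split; apply: key; [exact: norm_cRe|exact: cIm_le_cabs].
Qed.

End Cells.

(** * Summability of the majorant over the group Gamma *)

Section ThetaSummable.
Local Open Scope complex_scope.
Context {R : realType}.
Local Notation Mp := (metaplectic R).
Implicit Types (s t u : Mp).

Section Grid.
Variable e : R.
Hypothesis e0 : 0 < e <= 1/16.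

(** The constants are dictated by [theta_cell]: there q ^ (8 |j|) = exp (- e |j|), and 8 / e ^ 2
    results from W Y e <= 2 (|X| + Y) and (|X| + Y) ^ 2 <= 2 D. *)
Definition cellq : R := expR (- (e / 8)).
Definition cellA : R := 8 / e ^+ 2.
Definition cellw (c : int * int) : R :=
  16 * cellA * (cellq ^+ `|c.1|%N * sqrt8 (`|c.2|%N.+1)%:R ^- 9).

Lemma cellq_itv : 0 <= cellq < 1.
Proof.
have /andP[e0' _] := e0; rewrite expR_ge0 /= -expR0 ltr_expR; lra.
Qed.

Lemma cellA_ge1 : 1 <= cellA.
Proof.
have /andP[e0' e8] := e0; rewrite ler_pdivlMr ?exprn_gt0 // expr2; nra.
Qed.

(** y / (y + 1) ^ 2 is at most 1/y and at most y; the first bound serves j >= 0, the second j <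
    0. *)
Lemma cellq_le (j : int) (y : R) : 0 < y -> celly e j <= y <= 2 * celly e j ->
  y <= 2 * cellq ^+ (8 * `|j|) * (y + 1) ^+ 2.
Proof.
move=> y0 /andP[h1 h2].
have E : cellq ^+ (8 * `|j|) = expR (- e * `|j|%N%:R).
  by rewrite -expRM_natl; congr expR; rewrite natrM; field.
rewrite E; have m0 := expR_gt0 (- e * `|j|%N%:R); move: h1 h2 m0; rewrite /celly.
have y1 : y <= (y + 1) ^+ 2 by rewrite expr2; nra.
case: j {E} => n /=; rewrite ?NegzE /=.
  rewrite -pmulrn mulNr expRN; set c := expR (e * n%:R) => h1 h2 m0.
  have c0 : 0 < c by exact: expR_gt0.
  rewrite mulrAC ler_pdivlMr //; apply: le_trans (_ : y * y <= _); last by rewrite expr2; nra.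
  by rewrite ler_wpM2l // ltW.
rewrite rmorphN /= -pmulrn mulrN -mulNr; set c := expR _ => h1 h2 m0.
apply: le_trans h2 _; rewrite ler_peMr ?mulr_ge0 ?(ltW m0) //.
by rewrite expr2; nra.
Qed.

(** |theta| ^ 4 = 4 Y / D. To keep exponents integral, 16th powers are compared, so that |theta| ^ 5
    turns into (4 Y / D) ^ 20. Of the 20 factors Y, 18 pair with W through (W Y) ^ 2 <= A D and give
    W ^ (- 18/16); the remaining two give the decay in j. From |theta| ^ 4 there would be only 16
    factors, not enough for an exponent of W beyond 1. *)
Lemma theta_cell s : cabs (theta s) ^+ 5 <= cellw (cell e s).1.
Proof.
have /andP[e0' e8] := e0; have y0 := mpZ_Im s.
set D := cabs (mpZ s + 'i) ^+ 2; set Y := cIm (mpZ s) in y0 *; set X := cRe (mpZ s).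
have ED : D = X ^+ 2 + (Y + 1) ^+ 2 by rewrite /D cabs_sqr !raddfD /= addr0.
set th := cabs (theta s); have th0 : 0 < th := cabs_theta_gt0 s.
have hT : th ^+ 4 * D = 4 * Y.
  rewrite /D cabs_mpZ_add_i -/Y.
  have := cabs_theta_sqr s; rewrite -/th => h.
  by transitivity ((th ^+ 2 * cabs (al (mp_mx s))) ^+ 2 * (4 * Y)); [ring|rewrite h expr1n mul1r].
have D0 : 0 < D by rewrite ED; have := sqr_ge0 X; have : 0 < (Y + 1) ^+ 2 by [rewrite exprn_gt0
  //; lra]; lra.
have YD : (Y + 1) ^+ 2 <= D by rewrite ED lerDr sqr_ge0.
set j := cellj e s; set l := celll e s.
have c0 := celly_gt0 e j.
have /andP[hy1 hy2'] := celly_itv e0 s; rewrite -/j -/Y in hy1 hy2'.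
have hy2 : Y <= 2 * celly e j by nra.
have hm := cellq_le y0 (_ : celly e j <= Y <= 2 * celly e j).
have {}hm := hm (introT andP (conj hy1 hy2)).
have q0 : 0 <= cellq by have /andP[] := cellq_itv.
set m := cellq ^+ (8 * `|j|) in hm; have m0 : 0 <= m by rewrite exprn_ge0.
have W1 : 1 <= `|l|%N.+1%:R :> R by rewrite ler1n.
set W := `|l|%N.+1%:R in W1.
have hW : (W * Y) ^+ 2 <= cellA * D.
  have /andP[hl1 hl2] := celll_itv e0 s; rewrite -/j -/l -/X in hl1 hl2.
  have hl : `|l|%N%:R * (e * celly e j) <= `|X| + e * celly e j.
    have ey0 : 0 < e * celly e j by rewrite mulr_gt0.
    rewrite natr_absz intr_norm -[X in _ * X](gtr0_norm ey0) -normrM.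
    rewrite intrD mulrDl mul1r in hl2.
    rewrite ler_norml; apply/andP; split; have := ler_norm X; have := ler_norm (- X);
      rewrite normrN; lra.
  have h1 : W * Y * e <= 2 * (`|X| + Y).
    rewrite /W -natr1.
    apply: le_trans (_ : (`|l|%N%:R + 1) * (2 * celly e j) * e <= _).
      by rewrite ler_wpM2r ?(ltW e0') // ler_wpM2l // addr_ge0.
    have -> : (`|l|%N%:R + 1) * (2 * celly e j) * e = 2 * (`|l|%N%:R * (e * celly e j)) + 2 * (e
      * celly e j) by ring.
    have : e * celly e j <= 1/16 * Y by apply: ler_pM => //; exact: ltW.
    lra.
  have h2 : (`|X| + Y) ^+ 2 <= 2 * D.
    rewrite ED -(real_normK (num_real X)); have := sqr_ge0 (`|X| - Y); rewrite !expr2; nra.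
  rewrite /cellA mulrAC ler_pdivlMr ?exprn_gt0 // -exprMn.
  apply: le_trans (_ : (2 * (`|X| + Y)) ^+ 2 <= _).
    by rewrite lerXn2r ?nnegrE // ?mulr_ge0 ?addr_ge0 //; try exact: ltW; lra.
  by rewrite exprMn; lra.
have A1 := cellA_ge1.
have w0 : 0 < sqrt8 W by rewrite sqrt8_gt0; lra.
rewrite -(@ler_pXn2r _ 16) ?nnegrE ?exprn_ge0 ?(ltW th0) //; last first.
  by rewrite /cellw !mulr_ge0 ?exprn_ge0 ?invr_ge0 ?exprn_ge0 //; try exact: ltW; lra.
have -> : cellw (cell e s).1 ^+ 16 = (16 * cellA) ^+ 16 * m ^+ 2 / W ^+ 18.
  have W0 : 0 <= W by lra.
  have -> : W ^+ 18 = (sqrt8 W ^+ 8) ^+ 18 by rewrite sqrt8X.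
  rewrite /m mulnC exprM /cellw /= -/j -/l -/W -!exprVn.
  by move: (cellq ^+ _) (_^-1) => x y; ring.
have W0' : 0 < W by lra.
rewrite ler_pdivlMr ?exprn_gt0 //.
rewrite -(@ler_pM2r _ (D ^+ 20)) ?(exprn_gt0 20 D0) //.
have -> : (th ^+ 5) ^+ 16 * W ^+ 18 * D ^+ 20 = (th ^+ 4 * D) ^+ 20 * W ^+ 18 by ring.
rewrite hT.
have -> : (4 * Y) ^+ 20 * W ^+ 18 = 4 ^+ 20 * (Y ^+ 2 * ((W * Y) ^+ 2) ^+ 9) by ring.
(* As D >= 1, its power 2 may be raised to 11, so that together with the D ^ 9 of [hW9] it matches
   the D ^ 20 introduced above. *)
have hY2 : Y ^+ 2 <= 4 * m ^+ 2 * D ^+ 11.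
  apply: le_trans (_ : (2 * m * (Y + 1) ^+ 2) ^+ 2 <= _).
    by apply: lerXn2r; rewrite ?nnegrE ?mulr_ge0 ?sqr_ge0 ?(ltW y0) //; lra.
  have -> : (2 * m * (Y + 1) ^+ 2) ^+ 2 = 4 * m ^+ 2 * ((Y + 1) ^+ 2) ^+ 2 by ring.
  rewrite ler_wpM2l ?mulr_ge0 ?sqr_ge0 //.
  apply: le_trans (_ : D ^+ 2 <= _); first by rewrite lerXn2r ?nnegrE ?sqr_ge0 // ltW.
  rewrite ler_weXn2l //; apply: le_trans YD; rewrite expr2; nra.
have hW9 : ((W * Y) ^+ 2) ^+ 9 <= cellA ^+ 9 * D ^+ 9.
  by rewrite -exprMn lerXn2r ?nnegrE ?sqr_ge0 // mulr_ge0 // ?(ltW D0) //; lra.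
apply: le_trans (_ : 4 ^+ 20 * (4 * m ^+ 2 * D ^+ 11 * (cellA ^+ 9 * D ^+ 9)) <= _).
  rewrite ler_wpM2l ?exprn_ge0 //; apply: ler_pM => //; first exact: sqr_ge0.
  by rewrite exprn_ge0 // sqr_ge0.
have -> : 4 ^+ 20 * (4 * m ^+ 2 * D ^+ 11 * (cellA ^+ 9 * D ^+ 9)) =
  4 ^+ 21 * cellA ^+ 9 * (m ^+ 2 * D ^+ 20) by ring.
have md0 : 0 <= m ^+ 2 * D ^+ 20.
  by apply: mulr_ge0; [exact: sqr_ge0|apply: exprn_ge0; exact: ltW].
rewrite -[leRHS]mulrA; apply: ler_wpM2r => //.
have A0 : 0 <= cellA by lra.
rewrite (exprMn _ 16 cellA); apply: ler_pM; [exact: exprn_ge0|exact: exprn_ge0| |by rewrite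
  ler_weXn2l].
by rewrite (_ : 16 = 4 ^+ 2) -?exprM ?ler_weXn2l //; [lra|ring].
Qed.

Lemma cellw_sum : fsum_le_by
  (16 * cellA * (((1 - cellq)^-1 + (1 - cellq)^-1) * (9 + 9))) cellw.
Proof.
have A1 := cellA_ge1.
apply: fsum_le_by_scale; first by lra.
apply: (fsum_le_by_prod (fsum_le_by_int (fsum_geometric cellq_itv)) (fsum_le_by_int fsum_sqrt8)).
Qed.

Definition cellv (c : (int * int) * (int * int)) : R :=
  cellw c.1 * ((`|c.2.1| <= Qcell e)%N%:R * (`|c.2.2| <= Qcell e)%N%:R).

Lemma cellv_sum : exists K, fsum_le_by K cellv.
Proof.
have hQ := fsum_le_by_int (@fsum_indicator R (Qcell e)).
by eexists; exact: (fsum_le_by_prod cellw_sum (fsum_le_by_prod hQ hQ)).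
Qed.

Lemma theta_cellv s : cabs (theta s) ^+ 5 <= cellv (cell e s).
Proof.
rewrite /cellv; have [h1 h2] := celln_bound e0 s; rewrite /= h1 h2 !mulr1.
exact: theta_cell.
Qed.

End Grid.

Variables (Gam : set Mp) (hGam : discrete_subgroup Gam).

(** Points of one cell differ by an element close to 1, and (s g)^-1 (s h) = g^-1 h does not involve
    s; hence one grid separates Gamma in all its left translates. *)
Lemma discrete_grid : exists e, 0 < e <= 1/16 /\
  forall s, injective (fun g : Gam => cell e (s * val g)%g).
Proof.
have [[G1 GV] iso] := hGam.
have [_ [V hV VG]] := iso _ G1.
have [d d0 hd] := mp_nbhs1 hV.
(* 33 exceeds the factor 32 of [cell_near], which makes the inequalities strict. *)
pose e := Num.min (1/16) (d / 33).
have e0 : 0 < e by rewrite lt_min divr_gt0 //=; lra.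
have e16 : e <= 1/16 by rewrite ge_min lexx.
have e33 : e <= d / 33 by rewrite ge_min lexx orbT.
exists e; split; first by rewrite e0.
move=> s g h E; have e1 : 0 < e <= 1/16 by rewrite e0.
have [hZ hN] := cell_near e1 E.
have ge : ((s * val g)^-1 * (s * val h) = (val g)^-1 * val h)%g.
  by rewrite invgM mulgA -(mulgA _ s^-1%g) mulVg mulg1.
rewrite ge in hZ hN.
have VG1 : (V `&` Gam) ((val g)^-1 * val h)%g.
  split; first by apply: hd; [apply: le_lt_trans hZ _|apply: le_lt_trans hN _]; lra.
  have hg := set_valP g; have hh := set_valP h.
  have gV : Gam (val g)^-1%g by have := GV _ _ G1 hg; rewrite mul1g.
  by have := GV _ _ gV (GV _ _ G1 hh); rewrite mul1g invgK.
rewrite VG in VG1; apply: val_inj; apply: (mulgI (val g)^-1%g).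
by rewrite VG1 mulVg.
Qed.

Lemma Gam_inv (g : Gam) : Gam (val g)^-1%g.
Proof.
have [[G1 GV] _] := hGam; have := GV _ _ G1 (set_valP g); by rewrite mul1g.
Qed.

Definition ginv (g : Gam) : Gam := SigSub (mem_set (Gam_inv g)).

Lemma ginvK : involutive ginv.
Proof. by move=> g; apply: val_inj; rewrite /= invgK. Qed.

Lemma theta_orbit_sum : exists K, forall s : Mp,
  fsum_le_by K (fun g : Gam => cabs (theta (val g * s)%g) ^+ 5).
Proof.
have [e [e0 inj]] := discrete_grid; have [K hK] := cellv_sum e0.
exists K => s.
apply: fsum_le_by_le (fsum_le_by_comp (inj_comp (inj s^-1%g) (inv_inj ginvK)) hK) => g.
rewrite exprn_ge0 ?cabs_ge0 //= -cabs_thetaV invgM.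
exact: theta_cellv.
Qed.

End ThetaSummable.

(** * Differentiation along curves *)

Section Curves.
Local Open Scope complex_scope.
Context {R : realType}.
Local Notation Mp := (metaplectic R).
Implicit Types (s t : Mp) (c : R -> Mp) (v w : R) (xi : R[i]).

(* [c] has logarithmic derivative w, xi at [v]: in SU(1,1) coordinates it is the matrix with
   rows (i w, conj xi) and (xi, - i w). *)
Definition curve_at c v w xi : Prop :=
  [/\ cderiv (fun u => al (mp_mx (c u))) v
        ((0 +i* w) * al (mp_mx (c v)) + xi * conjc (be (mp_mx (c v)))),
      cderiv (fun u => be (mp_mx (c u))) v
        ((0 +i* w) * be (mp_mx (c v)) + xi * conjc (al (mp_mx (c v)))) &
      c u @[u --> v] --> c v].

(** The derivative in question is c^-1 c', which left translation does not change; so the same w and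
    xi serve for all the terms of a sum over Gamma. *)
Lemma curve_mul g c v w xi : curve_at c v w xi -> curve_at (fun u => g * c u)%g v w xi.
Proof.
move=> [h1 h2 h3]; split.
- have H := cderivD (cderivZ (al (mp_mx g)) h1) (cderivZ (conjc (be (mp_mx g))) h2).
  apply: cderiv_congr H => [u|]; first by rewrite mp_mxM alM.
  rewrite mp_mxM alM beM.
  move: (al (mp_mx g)) (be (mp_mx g)) (al (mp_mx (c v))) (be (mp_mx (c v))) => x y x' y'.
  by rewrite rmorphD !rmorphM /= conjcK; ring.
- have H := cderivD (cderivZ (be (mp_mx g)) h1) (cderivZ (conjc (al (mp_mx g))) h2).
  apply: cderiv_congr H => [u|]; first by rewrite mp_mxM beM.
  rewrite mp_mxM alM beM.
  move: (al (mp_mx g)) (be (mp_mx g)) (al (mp_mx (c v))) (be (mp_mx (c v))) => x y x' y'.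
  by rewrite rmorphD !rmorphM /= conjcK; ring.
- by apply: (cvg_comp _ _ h3); exact: mp_mulg_continuous.
Qed.

(** Derivative of the member (a, b, n) in the direction (w, xi). It is abstract in [G] so that it
    applies to [Gfun] and to its sums alike. The shift to n + 4 comes from conj al = (1 + |be| ^ 2)
    theta ^ 2, after one factor be is lost. *)
Definition Dfun (G : nat -> nat -> nat -> R[i]) (a b n : nat) w xi : R[i] :=
  xi * a%:R * G a.-1 b n.+4 + conjc xi * b%:R * G a b.-1 n
  - xi * (b%:R + n%:R / 2) * G a b.+1 n - (0 +i* w) * (2 * b%:R + n%:R / 2) * G a b n.

Lemma conj_al_theta s :
  conjc (al (mp_mx s)) = (1 + be (mp_mx s) * conjc (be (mp_mx s))) * theta s ^+ 2.
Proof.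
have E : al (mp_mx s) * conjc (al (mp_mx s)) = 1 + be (mp_mx s) * conjc (be (mp_mx s)).
  have := al_be_det (mp_det s); rewrite !cabs_sqr.
  case: (al _) (be _) => a b [c d] /= h; apply: ceq => /=; last by ring.
  by move: h; rewrite !expr2; lra.
by rewrite -E mulrC mulrA theta_sqr mul1r.
Qed.

Lemma curve_Gfun a b n c v w xi : (0 < n)%N -> curve_at c v w xi ->
  cderiv (fun u => Gfun a b n (c u)) v (Dfun (fun a b n => Gfun a b n (c v)) a b n w xi).
Proof.
move=> n0 [h1 h2 h3].
have near1 : \forall u \near v, theta (c u) ^+ 2 * al (mp_mx (c u)) = 1.
  by near=> u; exact: theta_sqr.
have hth := cderiv_invsqrt near1 (ccvg_comp h3 (@theta_ccvg _ (c v))) h1.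
have H := cderivM (cderivM (cderivX a h2) (cderivX b (cderiv_conj h2)))
  (cderivX (n + 2 * a + 2 * b) hth).
apply: cderiv_congr H => // {hth h1 h2 h3 near1}; rewrite /Dfun /Gfun.
have T0 := theta_neq0 (c v); have := theta_sqr (c v); have := conj_al_theta (c v).
move: (al _) (be _) (theta _) T0 => A B T T0 EA TA.
rewrite rmorphD !rmorphM /= conjcK EA.
have -> : 0 -i* w = - (0 +i* w) by apply: ceq => /=; rewrite ?oppr0.
move: (conjc B) (0 +i* w) (conjc xi) => B' iw xi'.
have -> : A = (T ^+ 2)^-1 by apply: (mulfI (expf_neq0 2 T0)); rewrite TA mulfV // expf_neq0.
rewrite (natrD _ (n + 2 * a)) (natrD _ n) !natrM; case: n n0 => // n _.
(* Once zero exponents are split off, no predecessor is left and each case is a rational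
   identity. *)
case: a => [|a]; case: b => [|b]; rewrite ?mulnS ?muln0 /=.
- rewrite !(addSn, addnS, addn0) /= !exprS; move: (T ^+ n) => z; by field.
- move: (2 * b)%N => q; rewrite !(addSn, addnS, addn0) /= !exprS !exprD.
  rewrite -!natr1; move: (T ^+ n) (T ^+ q) => z y; by field.
- move: (2 * a)%N => q; rewrite !(addSn, addnS, addn0) /= !exprS !exprD.
  rewrite -!natr1; move: (T ^+ n) (T ^+ q) => z y; by field.
- move: (2 * a)%N (2 * b)%N => p q; rewrite !(addSn, addnS, addn0) /= !exprS !exprD.
  rewrite -!natr1; move: (T ^+ n) (T ^+ p) (T ^+ q) => z x y; by field.
Unshelve. all: by end_near. Qed.

End Curves.

(** * Sums over Gamma: convergence, invariance, termwise derivatives *)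

Section PoincareSums.
Local Open Scope complex_scope.
Context {R : realType}.
Local Notation Mp := (metaplectic R).
Implicit Types (s t : Mp) (c : R -> Mp) (a b n : nat).
Variables (Gam : set Mp) (hGam : discrete_subgroup Gam).

Definition orbit_bound s (g : Gam) : R := cabs (theta (val g * s)%g) ^+ 5.

Lemma orbit_bound_sum s : fsum_bounded (orbit_bound s).
Proof. by have [K hK] := theta_orbit_sum hGam; exact: fsum_le_by_bounded (hK s). Qed.

Definition PG a b n s : R[i] := csum (fun g : Gam => Gfun a b n (val g * s)%g).

Lemma Gfun_orbit_bound a b n s (g : Gam) : (5 <= n)%N ->
  cabs (Gfun a b n (val g * s)%g) <= orbit_bound s g.
Proof. by move=> n5; apply: le_trans (cabs_Gfun _ _ _ _) (cabs_theta_exp _ n5). Qed.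

Lemma PG_bounded a b n : (5 <= n)%N -> exists M, forall s, cabs (PG a b n s) <= M.
Proof.
move=> n5; have [K hK] := theta_orbit_sum hGam; exists K => s.
apply: (csum_le (orbit_bound_sum s)) => [g|]; first exact: Gfun_orbit_bound.
exact: (hK s).2.
Qed.

(** Right translation by an element of bounded al costs a factor independent of g, so the majorant
    at one point dominates the terms at all points of a compact set. The assumption 1/2 <= A allows
    the square root of 2 A to be replaced by 2 A. *)
Lemma orbit_boundM s t (A : R) (g : Gam) : 1/2 <= A -> cabs (al (mp_mx t)) <= A ->
  orbit_bound (s * t)%g g <= (2 * A) ^+ 5 * orbit_bound s g.
Proof.
move=> A2 hA; rewrite /orbit_bound mulgA -exprMn.
have h := cabs_thetaM_le (val g * s)%g t.
have x0 := cabs_ge0 (theta (val g * s)%g); have y0 := cabs_ge0 (theta (val g * s * t)%g).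
rewrite lerXn2r ?nnegrE ?mulr_ge0 //; first by lra.
rewrite -(@ler_pXn2r _ 2) ?nnegrE ?mulr_ge0 //; last by lra.
apply: le_trans h _; rewrite exprMn ler_wpM2r ?sqr_ge0 // expr2; nra.
Qed.

Lemma al1 : al (mp_mx (1%g : Mp)) = 1.
Proof. by rewrite mp_mx1; apply: ceq; rewrite /= !mxE /=; field. Qed.

Lemma al_near s : \forall t \near s, cabs (al (mp_mx (s^-1 * t)%g)) <= 2.
Proof.
have h : ccvg (nbhs s) (fun t => al (mp_mx (s^-1 * t)%g)) (al (mp_mx (s^-1 * s)%g)).
  have := ccvg_comp (@mp_mulg_continuous R s^-1%g s) (@al_ccvg R (s^-1 * s)%g).
  exact.
have e0 : 0 < 1 :> R by [].
have := h 1 e0; apply: filterS => t; rewrite mulVg al1 => ht.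
by apply: le_trans (cabs_leD _ 1) _; rewrite cabs1; lra.
Qed.

Lemma PG_ccvg a b n s : (5 <= n)%N -> ccvg (nbhs s) (PG a b n) (PG a b n s).
Proof.
move=> n5; have hb := orbit_bound_sum s.
(* [al_near] provides A = 2 near s, hence the factor (2 A) ^ 5 = 4 ^ 5. *)
have hb' : fsum_bounded (fun g => 4 ^+ 5 * orbit_bound s g).
  by apply: fsum_boundedZ => //; exact: exprn_ge0.
apply: (ccvg_csum hb') => [|g|g].
- have := @al_near s; apply: filterS => t ht g.
  apply: le_trans (Gfun_orbit_bound _ _ _ _ n5) _.
  have := @orbit_boundM s (s^-1 * t)%g 2 g; rewrite mulgA mulgV mul1g.
  have -> : 2 * 2 = 4 :> R by ring.
  by apply => //; lra.
- apply: le_trans (Gfun_orbit_bound _ _ _ _ n5) _.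
  by rewrite ler_peMl ?exprn_ge0 ?cabs_ge0 // exprn_ege1 //; lra.
- exact: (ccvg_comp (@mp_mulg_continuous R (val g) s) (@Gfun_ccvg R a b n _)).
Qed.

Lemma cabs_nat (n : nat) : cabs (n%:R : R[i]) = n%:R.
Proof. by rewrite -(rmorph_nat (real_complex R)) cabs_real normr_nat. Qed.

Lemma cabs_imag (w : R) : cabs (0 +i* w) = `|w|.
Proof.
apply/eqP; rewrite -(@eqrXn2 _ 2) ?cabs_ge0 // cabs_sqr /= expr0n add0r.
by rewrite real_normK ?num_real.
Qed.

(** The sum of the absolute values of the numerical coefficients in [Dfun]. *)
Definition Dconst a b n : R := a%:R + b%:R + (b%:R + n%:R / 2) + (2 * b%:R + n%:R / 2).

Lemma cabs_Dfun (G : nat -> nat -> nat -> R[i]) a b n (w : R) (xi : R[i]) (B x : R) :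
  0 <= x -> (forall a b n, (5 <= n)%N -> cabs (G a b n) <= x) -> (5 <= n)%N ->
  `|w| <= B -> cabs xi <= B -> cabs (Dfun G a b n w xi) <= B * Dconst a b n * x.
Proof.
move=> x0 hG n5 hw hxi; have B0 : 0 <= B by apply: le_trans hw.
have c2 : cabs (n%:R / 2 : R[i]) = n%:R / 2 by rewrite cabsM cabsV !cabs_nat.
have h1 : cabs (b%:R + n%:R / 2 : R[i]) <= b%:R + n%:R / 2.
  by apply: le_trans (cabsD _ _) _; rewrite cabs_nat c2.
have h2 : cabs (2 * b%:R + n%:R / 2 : R[i]) <= 2 * b%:R + n%:R / 2.
  by apply: le_trans (cabsD _ _) _; rewrite cabsM !cabs_nat c2.
have key (u v z : R[i]) (y : R) : cabs u <= B -> cabs v <= y -> cabs z <= x ->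
    cabs (u * v * z) <= B * y * x.
  by move=> hu hv hz; rewrite !cabsM; apply: ler_pM;
    rewrite ?mulr_ge0 ?cabs_ge0 // ler_pM ?cabs_ge0.
have k1 := key xi a%:R (G a.-1 b n.+4) a%:R hxi _ _.
have k2 := key (conjc xi) b%:R (G a b.-1 n) b%:R _ _ (hG _ _ _ n5).
have k3 := key xi _ (G a b.+1 n) _ hxi h1 (hG _ _ _ n5).
have k4 := key (0 +i* w) _ (G a b n) _ _ h2 (hG _ _ _ n5).
have ha : cabs (a%:R : R[i]) <= a%:R by rewrite cabs_nat.
have {}k1 := k1 ha (hG _ _ _ (leq_trans n5 (leq_addl 4 n))).
have {}k2 : cabs (conjc xi * b%:R * G a b.-1 n) <= B * b%:R * x.
  by apply: k2; rewrite ?cabs_conj ?cabs_nat.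
have {}k4 := k4 (_ : cabs (0 +i* w) <= B); rewrite cabs_imag in k4; have {}k4 := k4 hw.
rewrite /Dfun /Dconst.
have t1 := cabsD (xi * a%:R * G a.-1 b n.+4 + conjc xi * b%:R * G a b.-1 n - xi * (b%:R + n%:R /
  2) * G a b.+1 n) (- ((0 +i* w) * (2 * b%:R + n%:R / 2) * G a b n)).
have t2 := cabsD (xi * a%:R * G a.-1 b n.+4 + conjc xi * b%:R * G a b.-1 n) (- (xi * (b%:R + n%:R
  / 2) * G a b.+1 n)).
have t3 := cabsD (xi * a%:R * G a.-1 b n.+4) (conjc xi * b%:R * G a b.-1 n).
rewrite !cabsN in t1 t2.
have -> : B * (a%:R + b%:R + (b%:R + n%:R / 2) + (2 * b%:R + n%:R / 2)) * x =
  B * a%:R * x + B * b%:R * x + B * (b%:R + n%:R / 2) * x + B * (2 * b%:R + n%:R / 2) * x by ring.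
move: k1 k2 k3 k4 t1 t2 t3; lra.
Qed.

Lemma csum_Dfun (G : Gam -> nat -> nat -> nat -> R[i]) a b n (w : R) (xi : R[i])
    (x : Gam -> R) : fsum_bounded x -> (5 <= n)%N ->
    (forall g a b n, (5 <= n)%N -> cabs (G g a b n) <= x g) ->
  csum (fun g => Dfun (G g) a b n w xi) =
  Dfun (fun a b n => csum (fun g => G g a b n)) a b n w xi.
Proof.
move=> hx n5 hG.
pose B := `|w| + cabs xi.
have B0 : 0 <= B by rewrite addr_ge0 ?cabs_ge0.
have D0 : 0 <= B * Dconst a b n by rewrite /Dconst mulr_ge0 // !addr_ge0 // ?divr_ge0 // mulr_ge0.
have cv a' b' n' : (5 <= n')%N ->
    ccvg (@totally Gam) (fun J => \sum_(g <- J) G g a' b' n') (csum (fun g => G g a' b' n')).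
  by move=> n5'; apply: (csum_ccvg hx) => g; exact: hG.
have n9 : (5 <= n.+4)%N by exact: leq_trans n5 (leq_addl 4 n).
apply: (csum_unique (fsum_boundedZ D0 hx)) => [g|].
  apply: cabs_Dfun => //; [exact: hx.1|by move=> *; exact: hG| |].
    by rewrite lerDl cabs_ge0.
  by rewrite lerDr.
have FF : Filter (@totally Gam) by exact: totally_filter.
pose proof (ccvgD (ccvgD (ccvgD (ccvgM (ccvg_cst (xi * a%:R)) (cv a.-1 b n.+4 n9))
  (ccvgM (ccvg_cst (conjc xi * b%:R)) (cv a b.-1 n n5)))
  (ccvgN (ccvgM (ccvg_cst (xi * (b%:R + n%:R / 2))) (cv a b.+1 n n5))))
  (ccvgN (ccvgM (ccvg_cst ((0 +i* w) * (2 * b%:R + n%:R / 2))) (cv a b n n5)))) as H.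
apply: ccvg_congr H => // J.
by rewrite !mulr_sumr -big_split /= -!sumrB.
Qed.

(** While |al| stays below A on the curve, the terms and their derivatives are dominated by
    multiples of the majorant at the identity, so [cderiv_csum] applies. *)
Lemma PG_curve a b n (c : R -> Mp) (t d A B : R) (w : R -> R) (xi : R -> R[i]) :
  (5 <= n)%N -> 0 < d ->
  (forall v, `|v - t| < d -> curve_at c v (w v) (xi v)) ->
  (forall v, `|v - t| < d -> cabs (al (mp_mx (c v))) <= A) ->
  (forall v, `|v - t| < d -> `|w v| <= B /\ cabs (xi v) <= B) ->
  cderiv (fun v => PG a b n (c v)) t (Dfun (fun a b n => PG a b n (c t)) a b n (w t) (xi t)).
Proof.
move=> n5 d0 hc hA hB.
have n0 : (0 < n)%N by exact: leq_trans n5.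
have z0 : `|t - t| < d by rewrite subrr normr0.
have A1 : 1 <= A := le_trans (cabs_al_ge1 (mp_det (c t))) (hA t z0).
have B0 : 0 <= B := le_trans (normr_ge0 _) (hB t z0).1.
have hb := orbit_bound_sum 1%g.
pose C := (2 * A) ^+ 5; have C0 : 0 <= C by rewrite exprn_ge0 //; lra.
have bd v (g : Gam) a' b' n' : `|v - t| < d -> (5 <= n')%N ->
    cabs (Gfun a' b' n' (val g * c v)%g) <= C * orbit_bound 1%g g.
  move=> hv n5'; apply: le_trans (Gfun_orbit_bound _ _ _ _ n5') _.
  have := @orbit_boundM 1%g (c v) A g; rewrite mul1g; apply; [by lra|exact: hA].
have x0 (g : Gam) : 0 <= C * orbit_bound 1%g g by rewrite mulr_ge0 // exprn_ge0 ?cabs_ge0.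
have D0 : 0 <= B * Dconst a b n by rewrite /Dconst mulr_ge0 // !addr_ge0 // ?divr_ge0 // mulr_ge0.
rewrite -(@csum_Dfun (fun g a b n => Gfun a b n (val g * c t)%g) a b n _ _
  (fun g => C * orbit_bound 1%g g)) //; first last.
- by move=> g a' b' n' n5'; exact: bd.
- exact: fsum_boundedZ.
pose f' (u : R) (g : Gam) :=
  Dfun (fun a b n => Gfun a b n (val g * c (t + u)%R)%g) a b n (w (t + u)) (xi (t + u)).
have E : f' 0 = fun g : Gam =>
    Dfun (fun a b n => Gfun a b n (val g * c t)%g) a b n (w t) (xi t).
  by apply/funext => g; rewrite /f' addr0.
rewrite -E.
have ut u : `|u| < d -> `|t + u - t| < d by rewrite addrAC subrr add0r.
have := @cderiv_csum R Gam (fun g => C * orbit_bound 1%g g + B * Dconst a b n * (C * orbit_bound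
  1%g g))
  (fun v g => Gfun a b n (val g * c v)%g) f' t d d0.
apply => [|g u hu|g u hu|g u hu].
- by apply: fsum_boundedD; [|apply: fsum_boundedZ => //]; exact: fsum_boundedZ.
- by apply: curve_Gfun => //; apply: curve_mul; apply: hc; exact: ut.
- apply: le_trans (bd _ _ _ _ _ (ut u hu) n5) _.
  by rewrite lerDl mulr_ge0.
- have [hw hxi] := hB _ (ut u hu).
  apply: le_trans (_ : _ <= B * Dconst a b n * (C * orbit_bound 1%g g)) _; last by rewrite lerDr.
  apply: cabs_Dfun => // a' b' n' n5'; exact: bd (ut u hu) n5'.
Qed.

Lemma poincareE k m s :
  poincare Gam (F_km k (5 / 2 + m%:R)) s = PG k 0 (5 + 2 * m) s.
Proof.
by rewrite (_ : F_km k _ = Gfun k 0 (5 + 2 * m)) //; apply/funext => x; exact: F_kmE.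
Qed.

Lemma PG_left_invariant a b n s (g : Mp) : (5 <= n)%N -> Gam g ->
  PG a b n (g * s)%g = PG a b n s.
Proof.
move=> n5 hg; have [[G1 GV] _] := hGam.
have GM x y : Gam x -> Gam y -> Gam (x * y)%g.
  by move=> hx hy; have := GV _ _ hx (GV _ _ G1 hy); rewrite mul1g invgK.
have gV : Gam g^-1%g by have := GV _ _ G1 hg; rewrite mul1g.
pose f (x : Gam) : Gam := SigSub (mem_set (GM _ _ (set_valP x) hg)).
pose f' (x : Gam) : Gam := SigSub (mem_set (GM _ _ (set_valP x) gV)).
have K1 : cancel f f' by move=> x; apply: val_inj; rewrite /= mulgK.
have K2 : cancel f' f by move=> x; apply: val_inj; rewrite /= mulgVK.
rewrite /PG -(@csum_reindex _ _ _ (fun x : Gam => Gfun a b n (val x * s)%g) f f' K1 K2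
  (orbit_bound_sum s) (fun x => Gfun_orbit_bound _ _ _ _ n5)).
by congr csum; apply/funext => x; rewrite /= mulgA.
Qed.

Lemma compact_al_bounded (C : set Mp) : compact C ->
  exists A, 1/2 <= A /\ forall s, C s -> cabs (al (mp_mx s)) <= A.
Proof.
move=> cC; pose f (s : Mp) := cabs (al (mp_mx s)).
have fc : continuous f.
  by move=> s; exact: (@ccvg_cabs R _ (nbhs s) (nbhs_filter s) _ _ (@al_ccvg R s)).
have : compact (f @` C).
  by apply: continuous_compact => //; exact: continuous_subspaceT.
move=> /compact_bounded[M [_ hM]].
exists (Num.max (1/2) (M + 1)); split; first by rewrite le_max lexx.
move=> s Cs; have := hM (M + 1) (ltr_pwDr ltr01 (lexx M)) (f s) (imageP _ Cs).
by rewrite /= /f ger0_norm ?cabs_ge0 // => h; rewrite le_max h orbT.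
Qed.

Lemma abs_series_PG a b n : (5 <= n)%N -> abs_series_cvg_compact Gam (Gfun a b n).
Proof.
move=> n5; exists (fun s => cRe (csum (fun g : Gam => (cabs (Gfun a b n (val g * s)%g))%:C))).
move=> C cC; have [A [A2 hA]] := compact_al_bounded cC.
have A0 : 0 <= (2 * A) ^+ 5 by apply: exprn_ge0; lra.
have hb := fsum_boundedZ A0 (orbit_bound_sum 1%g).
move=> P /uniform_nbhs[E [entE EP]].
have [e /= e0 eE] : exists2 e : R, 0 < e & forall x y : R, `|x - y| < e -> E (x, y).
  move: entE; rewrite -entourage_ballE => -[e e0 eE]; exists e => // x y xy.
  by apply: eE; rewrite /= /ball /=.
have e2 : 0 < e / 2 by rewrite divr_gt0.
have [B0 hB0] := csum_tail hb e2.
exists B0 => // B /= sB; apply: EP => s Cs; apply: eE.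
rewrite partial_sumE.
have h1 (g : Gam) : cabs ((cabs (Gfun a b n (val g * s)%g))%:C) <= (2 * A) ^+ 5 * orbit_bound 1%g g.
  rewrite cabs_real ger0_norm ?cabs_ge0 //.
  apply: le_trans (Gfun_orbit_bound _ _ _ _ n5) _.
  by have := @orbit_boundM 1%g s A g A2 (hA s Cs); rewrite mul1g.
have := hB0 _ h1 B sB.
have -> : \sum_(g <- B) cabs (Gfun a b n (val g * s)%g) =
    cRe (\sum_(g <- B) (cabs (Gfun a b n (val g * s)%g))%:C) by rewrite cRe_sum.
rewrite -raddfB => h; apply: le_lt_trans (norm_cRe _) _; apply: le_lt_trans h _.
by rewrite ltr_pdivrMr // ltr_pMr //; lra.
Qed.

End PoincareSums.

(** * Smoothness of the Poincare series *)

Section Smoothness.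
Local Open Scope complex_scope.
Context {R : realType}.
Local Notation Mp := (metaplectic R).
Local Notation R3 := (R * R * R)%type.
Implicit Types (p : R3) (f g : R3 -> R) (h : R3 -> R[i]).

Definition dirs : seq R3 := [:: (1, 0, 0); (0, 1, 0); (0, 0, 1)].

(** The domain is open, so continuity and derivatives at its points depend on the values in it
    alone. *)
Lemma Cn_ext n f g : (forall p, iwasawa_dom p -> f p = g p) -> Cn n f -> Cn n g.
Proof.
have near_dom f' g' p : (forall p, iwasawa_dom p -> f' p = g' p) -> iwasawa_dom p ->
    \forall q \near p, f' q = g' q.
  by move=> E dp; have := iwasawa_domP dp; apply: filterS => q /E.
elim: n f g => [|n ih] f g E [fc fD].
  split=> // p dp; rewrite /prop_for /continuous_at -(E p dp).
  by apply: cvg_trans (fc p dp); apply: near_eq_cvg; exact: near_dom.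
split=> [p dp|v hv].
  rewrite /prop_for /continuous_at -(E p dp).
  by apply: cvg_trans (fc p dp); apply: near_eq_cvg; exact: near_dom.
have [fd fn] := fD v hv.
have v0 : v != 0.
  move: hv; rewrite !inE => /or3P[] /eqP->; rewrite !xpair_eqE /= ?oner_eq0 ?andbF //.
split=> [p dp|].
  by apply: near_eq_derivable (fd p dp); exact: near_dom.
by apply: ih fn => p dp; apply: near_eq_derive => //; exact: near_dom.
Qed.

Lemma Cn_S n f : Cn n.+1 f -> Cn n f.
Proof.
elim: n f => [|n ih] f [fc fD]; first by split.
by split=> // v hv; have [fd fn] := fD v hv; split=> //; exact: ih.
Qed.

Lemma Cn_cst n (c : R) : Cn n (fun=> c).
Proof.
elim: n c => [|n ih] c; split=> //; first by move=> p _; exact: cvg_cst.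
  by move=> p _; exact: cvg_cst.
move=> v _; split=> [p _|]; first exact: derivable_cst.
by apply: Cn_ext (ih 0) => p _; rewrite derive_cst.
Qed.

Lemma Cn_D n f g : Cn n f -> Cn n g -> Cn n (fun p => f p + g p).
Proof.
elim: n f g => [|n ih] f g [fc fD] [gc gD]; split=> //.
- by move=> p dp; apply: cvgD; [exact: fc|exact: gc].
- by move=> p dp; apply: cvgD; [exact: fc|exact: gc].
- move=> v hv; have [fd fn] := fD v hv; have [gd gn] := gD v hv; split=> [p dp|].
    by apply: derivableD; [exact: fd|exact: gd].
  by apply: Cn_ext (ih _ _ fn gn) => p dp; rewrite deriveD //; [exact: fd|exact: gd].
Qed.

Lemma Cn_M n f g : Cn n f -> Cn n g -> Cn n (fun p => f p * g p).
Proof.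
elim: n f g => [|n ih] f g [fc fD] [gc gD]; split=> //.
- by move=> p dp; apply: cvgM; [exact: fc|exact: gc].
- by move=> p dp; apply: cvgM; [exact: fc|exact: gc].
- move=> v hv; have [fd fn] := fD v hv; have [gd gn] := gD v hv; split=> [p dp|].
    by apply: derivableM; [exact: fd|exact: gd].
  have f0 : Cn n f by apply: Cn_S; split.
  have g0 : Cn n g by apply: Cn_S; split.
  apply: Cn_ext (Cn_D (ih _ _ f0 gn) (ih _ _ g0 fn)) => p dp.
  by rewrite deriveM //; [exact: fd|exact: gd].
Qed.

Definition cCn n h : Prop := Cn n (fun p => cRe (h p)) /\ Cn n (fun p => cIm (h p)).

Lemma cCn_ext n h h' : (forall p, iwasawa_dom p -> h p = h' p) -> cCn n h -> cCn n h'.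
Proof. by move=> E [h1 h2]; split; [apply: Cn_ext h1|apply: Cn_ext h2] => p /E ->. Qed.

Lemma cCn_cst n (c : R[i]) : cCn n (fun=> c).
Proof. by split; exact: Cn_cst. Qed.

Lemma cCn_D n h h' : cCn n h -> cCn n h' -> cCn n (fun p => h p + h' p).
Proof.
move=> [h1 h2] [h3 h4]; split.
  by apply: Cn_ext (Cn_D h1 h3) => p _; rewrite raddfD.
by apply: Cn_ext (Cn_D h2 h4) => p _; rewrite raddfD.
Qed.

Lemma cCn_M n h h' : cCn n h -> cCn n h' -> cCn n (fun p => h p * h' p).
Proof.
move=> [h1 h2] [h3 h4]; split.
  apply: Cn_ext (Cn_D (Cn_M h1 h3) (Cn_M (Cn_cst n (-1)) (Cn_M h2 h4))) => p _.
  by rewrite cReM; ring.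
apply: Cn_ext (Cn_D (Cn_M h1 h4) (Cn_M h2 h3)) => p _.
by rewrite cImM.
Qed.

Lemma cCn_N n h : cCn n h -> cCn n (fun p => - h p).
Proof.
by move=> hh; apply: cCn_ext (cCn_M (cCn_cst n (-1)) hh) => p _; rewrite mulN1r.
Qed.

Lemma cCn_conj n h : cCn n h -> cCn n (fun p => conjc (h p)).
Proof.
move=> [h1 h2]; split; first by apply: Cn_ext h1 => p _; case: (h p).
apply: Cn_ext (Cn_M (Cn_cst n (-1)) h2) => p _; case: (h p) => a b /=.
by rewrite mulN1r.
Qed.

Lemma cderiv_derive h p (v : R3) (l : R[i]) : cderiv (fun u => h (p + u *: v)) 0 l ->
  [/\ derivable (fun q => cRe (h q)) p v, 'D_v (fun q => cRe (h q)) p = cRe l,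
      derivable (fun q => cIm (h q)) p v & 'D_v (fun q => cIm (h q)) p = cIm l].
Proof.
have key (k : R3 -> R) (x : R) : is_derive (0 : R) 1 (fun u => k (p + u *: v)) x ->
    derivable k p v /\ 'D_v k p = x.
  move=> [d1 d2].
  have E : (fun u : R => u^-1 *: (k (u *: v + p) - k p)) =
      (fun u : R => u^-1 *: (((fun u => k (p + u *: v)) \o shift 0) (u *: (1 : R)) - k (p + 0 *:
        v))).
    apply/funext => u; rewrite /= scale0r !addr0 [u *: v + p]addrC.
    by rewrite [u *: (1 : R)]mulr1.
  by split; [rewrite /derivable E|rewrite /derive E].
move=> /cderiv_ReIm[k1 k2].
have [h1 h2] := key (fun q => cRe (h q)) _ k1.
by have [h3 h4] := key (fun q => cIm (h q)) _ k2.
Qed.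

Lemma cCn_succ n h : (forall p, iwasawa_dom p -> ccvg (nbhs p) h (h p)) ->
  (forall v, v \in dirs -> exists h',
    (forall p, iwasawa_dom p -> cderiv (fun u => h (p + u *: v)) 0 (h' p)) /\ cCn n h') ->
  cCn n.+1 h.
Proof.
move=> hc hD; split; (split=> [p dp|v hv]; first by have /ccvg_ReIm[] := hc p dp);
  have [h' [hd [n1 n2]]] := hD v hv; split=> [p dp|].
- by have [] := cderiv_derive (hd p dp).
- by apply: Cn_ext n1 => p dp; have [_ -> _ _] := cderiv_derive (hd p dp).
- by have [] := cderiv_derive (hd p dp).
- by apply: Cn_ext n2 => p dp; have [_ _ _ ->] := cderiv_derive (hd p dp).
Qed.

Lemma dir_x p (u : R) : p + u *: ((1, 0, 0) : R3) = (p.1.1 + u, p.1.2, p.2).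
Proof.
case: p => -[x y] t; congr (_, _, _) => /=.
- by rewrite [u *: _]mulr1.
- by rewrite [u *: _]mulr0 addr0.
- by rewrite [u *: _]mulr0 addr0.
Qed.

Lemma dir_y p (u : R) : p + u *: ((0, 1, 0) : R3) = (p.1.1, p.1.2 + u, p.2).
Proof.
case: p => -[x y] t; congr (_, _, _) => /=.
- by rewrite [u *: _]mulr0 addr0.
- by rewrite [u *: _]mulr1.
- by rewrite [u *: _]mulr0 addr0.
Qed.

Lemma dir_t p (u : R) : p + u *: ((0, 0, 1) : R3) = (p.1.1, p.1.2, p.2 + u).
Proof.
case: p => -[x y] t; congr (_, _, _) => /=.
- by rewrite [u *: _]mulr0 addr0.
- by rewrite [u *: _]mulr0 addr0.
- by rewrite [u *: _]mulr1.
Qed.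

Lemma dirsP (P : R3 -> Prop) : P (1, 0, 0) -> P (0, 1, 0) -> P (0, 0, 1) ->
  forall v, v \in dirs -> P v.
Proof. by move=> h1 h2 h3 v; rewrite !inE => /or3P[] /eqP->. Qed.

Lemma is_derive_shift (x u : R) : is_derive u 1 (fun v => x + v) (1 : R).
Proof.
rewrite -[X in is_derive _ _ _ X]add0r.
exact: (is_deriveD (is_derive_cst x u 1) (is_derive_id u 1)).
Qed.

Lemma cderiv_shift (x u : R) : cderiv (fun v => (x + v)%:C) u 1.
Proof.
exact: (cderiv_real (is_derive_shift x u)).
Qed.

Lemma cderiv_cis (x u : R) : cderiv (fun v => cis (x + v)) u ('i * cis (x + u)).
Proof.
have d := is_derive_shift x u.
apply/cderiv_ReIm; split.
  apply: is_derive_eq; first exact: (is_derive1_comp (is_derive_cos (x + u)) d).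
  by rewrite /=; ring.
apply: is_derive_eq; first exact: (is_derive1_comp (is_derive_sin (x + u)) d).
by rewrite /=; ring.
Qed.

Lemma cCn_inv_y n : cCn n (fun q : R3 => (q.1.2%:C)^-1).
Proof.
have cont p : iwasawa_dom p -> ccvg (nbhs p) (fun q : R3 => (q.1.2%:C)^-1) (p.1.2%:C)^-1.
  move=> dp; apply: ccvgV; first by rewrite fmorph_eq0 gt_eqF.
  by apply: ccvg_real; exact: coord_y.
elim: n => [|n ih].
  split; split=> // p dp; by have /ccvg_ReIm[] := cont p dp.
apply: cCn_succ => //; apply: dirsP.
- exists (fun=> 0); split; last exact: cCn_cst.
  move=> p dp; apply: cderiv_congr (cderiv_cst (p.1.2%:C)^-1 0) => // u.
  by rewrite dir_x.
- exists (fun q => - ((q.1.2%:C)^-1 * (q.1.2%:C)^-1)); split; last by apply: cCn_N; exact: cCn_M.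
  move=> p dp.
  have d : is_derive (0 : R) 1 (fun u => (p.1.2 + u)^-1) (- (p.1.2 ^- 2)).
    have y0 : p.1.2 + 0 != 0 by rewrite addr0 gt_eqF.
    have d1 := is_derive_shift p.1.2 0.
    have := @is_deriveV R (fun u => p.1.2 + u) 0 1 1 y0 d1.
    by rewrite addr0 [X in is_derive _ _ _ X -> _]mulr1.
  apply: cderiv_congr (cderiv_real d) => [u|]; first by rewrite dir_y fmorphV.
  by rewrite rmorphN fmorphV rmorphXn /= -invfM.
- exists (fun=> 0); split; last exact: cCn_cst.
  move=> p dp; apply: cderiv_congr (cderiv_cst (p.1.2%:C)^-1 0) => // u.
  by rewrite dir_t.
Qed.

Lemma cCn_cis n : cCn n (fun q : R3 => cis q.2).
Proof.
have cont p : ccvg (nbhs p) (fun q : R3 => cis q.2) (cis p.2).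
  by apply: cis_ccvg; exact: coord_t.
elim: n => [|n ih].
  split; split=> // p dp; by have /ccvg_ReIm[] := cont p.
apply: cCn_succ => //; apply: dirsP.
- exists (fun=> 0); split; last exact: cCn_cst.
  move=> p dp; apply: cderiv_congr (cderiv_cst (cis p.2) 0) => // u.
  by rewrite dir_x.
- exists (fun=> 0); split; last exact: cCn_cst.
  move=> p dp; apply: cderiv_congr (cderiv_cst (cis p.2) 0) => // u.
  by rewrite dir_y.
- exists (fun q => 'i * cis q.2); split; last by apply: cCn_M => //; exact: cCn_cst.
  move=> p dp; apply: cderiv_congr (cderiv_cis p.2 0) => [u|]; first by rewrite dir_t.
  by rewrite addr0.
Qed.

End Smoothness.

(** * Logarithmic derivatives of the Iwasawa coordinate lines *)

Section IwasawaCurves.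
Local Open Scope complex_scope.
Context {R : realType}.
Local Notation Mp := (metaplectic R).
Local Notation R3 := (R * R * R)%type.
Implicit Types (s : Mp) (p : R3) (x y t u : R).

Definition al0 x y : R[i] :=
  ((Num.sqrt y + (Num.sqrt y)^-1) / 2) +i* (- (x / Num.sqrt y) / 2).
Definition be0 x y : R[i] :=
  ((Num.sqrt y - (Num.sqrt y)^-1) / 2) +i* (- (x / Num.sqrt y) / 2).

Lemma conjcM (a b : R[i]) : conjc (a * b) = conjc a * conjc b.
Proof. exact: rmorphM. Qed.

Lemma al_kappa t : al (mp_mx (mp_kappa t)) = cis t.
Proof. by apply: ceq; rewrite /cis /= !mxE /=; field. Qed.

Lemma be_kappa t : be (mp_mx (mp_kappa t)) = 0.
Proof. by apply: ceq; rewrite /= !mxE /=; field. Qed.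

Lemma al_iwasawa x y t : 0 < y -> al (mp_mx (iwasawa (x, y, t))) = al0 x y * cis t.
Proof.
move=> y0; rewrite (iwasawaE x t y0) mp_mxM alM al_kappa be_kappa mulr0 addr0; congr (_ * _).
by rewrite mp_mx_na; apply: ceq; rewrite /= !mxE //= sub0r.
Qed.

Lemma be_iwasawa x y t : 0 < y -> be (mp_mx (iwasawa (x, y, t))) = be0 x y * cis t.
Proof.
move=> y0; rewrite (iwasawaE x t y0) mp_mxM beM al_kappa be_kappa mulr0 addr0; congr (_ * _).
by rewrite mp_mx_na; apply: ceq; rewrite /= !mxE //= addr0.
Qed.

Lemma cis_conj t : cis t * conjc (cis t) = 1.
Proof.
by apply: ceq; rewrite /cis /=; [have := cos2Dsin2 t; rewrite !expr2; lra|ring].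
Qed.

Lemma iwasawa_path (q : R -> R3) u : (q v @[v --> u] --> q u) -> iwasawa_dom (q u) ->
  iwasawa (q v) @[v --> u] --> iwasawa (q u).
Proof. by move=> hq dq; apply: (cvg_comp _ _ hq); exact: iwasawa_continuous. Qed.

Lemma cvg_triple (a b c : R -> R) u : a v @[v --> u] --> a u -> b v @[v --> u] --> b u ->
  c v @[v --> u] --> c u -> (a v, b v, c v) @[v --> u] --> ((a u, b u, c u) : R3).
Proof.
move=> ha hb hc.
have hab : (a v, b v) @[v --> u] --> (a u, b u) by exact: cvg_pair ha hb.
exact: cvg_pair hab hc.
Qed.

Lemma cvg_shift x u : x + v @[v --> u] --> x + u.
Proof. by apply: cvgD; [exact: cvg_cst|exact: cvg_id]. Qed.

Lemma cderivZr (k : R[i]) (f : R -> R[i]) u l : cderiv f u l -> cderiv (fun v => f v * k) u (l * k).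
Proof. by move=> h; apply: cderiv_congr (cderivZ k h) => [v|]; rewrite mulrC. Qed.

(** Moving x in n_x a_y kappa_t gives the direction E conjugated past a_y and kappa_t. The former
    scales E by 1/y, the latter multiplies xi by exp (2 i t) and fixes w; E itself has w = - 1/2 and
    xi = - i/2. *)
Lemma curve_x x y t u : 0 < y -> curve_at (fun v => iwasawa (x + v, y, t)) u
  (- (2 * y)^-1) ((0 +i* (- (2 * y)^-1)) * cis t ^+ 2).
Proof.
move=> y0; have r0 : Num.sqrt y != 0 by rewrite gt_eqF // sqrtr_gt0.
have yr : y = Num.sqrt y * Num.sqrt y by rewrite -expr2 sqr_sqrtr // ltW.
have D (k : R) : cderiv (fun v => (k +i* (- ((x + v) / Num.sqrt y) / 2)) * cis t) u
    ((0 +i* (- (Num.sqrt y)^-1 / 2)) * cis t).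
  apply: cderivZr.
  have H := cderivD (cderiv_cst k%:C u) (cderivZ (0 +i* (- (Num.sqrt y)^-1 / 2)) (cderiv_shift x
    u)).
  by apply: cderiv_congr H => [v|]; apply: ceq => /=; field.
have E : (0 +i* (- (2 * y)^-1)) * (al0 (x + u) y + conjc (be0 (x + u) y)) =
    0 +i* (- (Num.sqrt y)^-1 / 2).
  rewrite /al0 /be0 {1}yr; move: (Num.sqrt y) r0 => r r0.
  by apply: ceq => /=; field.
have ec := cis_conj t; split.
- apply: cderiv_congr (D ((Num.sqrt y + (Num.sqrt y)^-1) / 2)) => [v|].
    by rewrite al_iwasawa.
  rewrite al_iwasawa // be_iwasawa // conjcM -E.
  move: (0 +i* _) (al0 _ _) (conjc (be0 _ _)) (cis t) (conjc _) ec => k a b e e' ee.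
  by transitivity (k * a * e + k * b * e * (e * e')); [rewrite ee|]; ring.
- apply: cderiv_congr (D ((Num.sqrt y - (Num.sqrt y)^-1) / 2)) => [v|].
    by rewrite be_iwasawa.
  rewrite al_iwasawa // be_iwasawa // conjcM.
  have {}E : (0 +i* (- (2 * y)^-1)) * (be0 (x + u) y + conjc (al0 (x + u) y)) =
    0 +i* (- (Num.sqrt y)^-1 / 2).
    by rewrite -E /al0 /be0; apply: ceq => /=; ring.
  rewrite -E; move: (0 +i* _) (be0 _ _) (conjc (al0 _ _)) (cis t) (conjc _) ec => k a b e e' ee.
  by transitivity (k * a * e + k * b * e * (e * e')); [rewrite ee|]; ring.
- apply: (@iwasawa_path (fun v => (x + v, y, t))) => //.
  by apply: cvg_triple; [exact: cvg_shift|exact: cvg_cst|exact: cvg_cst].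
Qed.

Lemma curve_t x y t u : 0 < y -> curve_at (fun v => iwasawa (x, y, t + v)) u 1 0.
Proof.
move=> y0; split.
- apply: cderiv_congr (cderivZ (al0 x y) (cderiv_cis t u)) => [v|]; first by rewrite al_iwasawa.
  by rewrite al_iwasawa // mul0r addr0 mulrCA.
- apply: cderiv_congr (cderivZ (be0 x y) (cderiv_cis t u)) => [v|]; first by rewrite be_iwasawa.
  by rewrite be_iwasawa // mul0r addr0 mulrCA.
- apply: (@iwasawa_path (fun v => (x, y, t + v))) => //.
  by apply: cvg_triple; [exact: cvg_cst|exact: cvg_cst|exact: cvg_shift].
Qed.

(** The direction is H / (2 (y + u)), since a_y = exp ((log y / 2) H), turned by kappa_t as in
    [curve_x]. The line leaves the domain at some distance from u, whence the use of
    [cderiv_near]. *)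
Lemma curve_y x y t u : 0 < y + u -> curve_at (fun v => iwasawa (x, y + v, t)) u
  0 ((2 * (y + u))^-1%:C * cis t ^+ 2).
Proof.
move=> y0; have r0 : Num.sqrt (y + u) != 0 by rewrite gt_eqF // sqrtr_gt0.
have yr : y + u = Num.sqrt (y + u) * Num.sqrt (y + u) by rewrite -expr2 sqr_sqrtr // ltW.
have dr : is_derive u 1 (fun v => Num.sqrt (y + v)) (2 * Num.sqrt (y + u))^-1.
  rewrite -[X in is_derive _ _ _ X]mulr1.
  exact: (is_derive1_comp (is_derive1_sqrt y0) (is_derive_shift y u)).
have dV : is_derive u 1 (fun v => (Num.sqrt (y + v))^-1) (- (2 * Num.sqrt (y + u) ^+ 3)^-1).
  have := @is_deriveV R (fun v => Num.sqrt (y + v)) u _ 1 r0 dr.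
  rewrite [X in is_derive _ _ _ X -> _](_ : _ = - (2 * Num.sqrt (y + u) ^+ 3)^-1) //.
  by rewrite /GRing.scale /=; field.
have dom : \forall v \near u, 0 < y + v.
  exact: (cvgr_gt (y + u) (@cvg_shift y u) 0 y0).
have cr := cderiv_real dr; have cV := cderiv_real dV.
have E2 : (2 * (y + u))^-1 = (2 * (Num.sqrt (y + u) * Num.sqrt (y + u)))^-1 by rewrite -yr.
have DA : cderiv (fun v => al0 x (y + v)) u ((2 * (y + u))^-1%:C * conjc (be0 x (y + u))).
  have H := cderivD (cderivZ (2^-1)%:C cr) (cderivZ (2^-1 +i* (- x / 2)) cV).
  apply: cderiv_congr H => [v|]; first by rewrite /al0; apply: ceq => /=; ring.
  rewrite /be0 E2; move: (Num.sqrt _) r0 => r r0.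
  by apply: ceq => /=; field.
have DB : cderiv (fun v => be0 x (y + v)) u ((2 * (y + u))^-1%:C * conjc (al0 x (y + u))).
  have H := cderivD (cderivZ (2^-1)%:C cr) (cderivZ (- 2^-1 +i* (- x / 2)) cV).
  apply: cderiv_congr H => [v|]; first by rewrite /be0; apply: ceq => /=; ring.
  rewrite /al0 E2; move: (Num.sqrt _) r0 => r r0.
  by apply: ceq => /=; field.
have ec := cis_conj t; split.
- apply: cderiv_near; last apply: (cderiv_congr _ _ (cderivZr (cis t) DA)).
  + by apply: filterS dom => v dv; rewrite al_iwasawa.
  + by [].
  + rewrite al_iwasawa // be_iwasawa // conjcM -[0 +i* 0]/(0 : R[i]) mul0r add0r.
    move: (_%:C) (conjc (be0 _ _)) (cis t) (conjc _) ec => k b e e' ee.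
    by transitivity (k * b * e * (e * e')); [rewrite ee mulr1|ring].
- apply: cderiv_near; last apply: (cderiv_congr _ _ (cderivZr (cis t) DB)).
  + by apply: filterS dom => v dv; rewrite be_iwasawa.
  + by [].
  + rewrite al_iwasawa // be_iwasawa // conjcM -[0 +i* 0]/(0 : R[i]) mul0r add0r.
    move: (_%:C) (conjc (al0 _ _)) (cis t) (conjc _) ec => k b e e' ee.
    by transitivity (k * b * e * (e * e')); [rewrite ee mulr1|ring].
- apply: (@iwasawa_path (fun v => (x, y + v, t))) => //.
  by apply: cvg_triple; [exact: cvg_cst|exact: cvg_shift|exact: cvg_cst].
Qed.

End IwasawaCurves.

(** * Smoothness and Lie derivatives of the series *)

Section PoincareSmooth.
Local Open Scope complex_scope.
Context {R : realType}.
Local Notation Mp := (metaplectic R).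
Local Notation R3 := (R * R * R)%type.
Variables (Gam : set Mp) (hGam : discrete_subgroup Gam).
Implicit Types (s : Mp) (p : R3) (a b n : nat).

Lemma PG_curve_near a b n (c : R -> Mp) (t B : R) (w : R -> R) (xi : R -> R[i]) :
  (5 <= n)%N -> (\forall v \near t, curve_at c v (w v) (xi v)) ->
  (\forall v \near t, `|w v| <= B /\ cabs (xi v) <= B) ->
  cderiv (fun v => PG Gam a b n (c v)) t
    (Dfun (fun a b n => PG Gam a b n (c t)) a b n (w t) (xi t)).
Proof.
move=> n5 hc hB; have [_ _ ct] := nbhs_singleton hc.
have hA : \forall v \near t, cabs (al (mp_mx (c v))) < cabs (al (mp_mx (c t))) + 1.
  have e0 : 0 < 1 :> R by [].
  have := ccvg_comp ct (@al_ccvg R (c t)) e0; apply: filterS => v hv.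
  by apply: le_lt_trans (cabs_leD _ (al (mp_mx (c t)))) _; rewrite ltrD2l.
have [d /= d0 hd] : \forall v \near t, [/\ curve_at c v (w v) (xi v),
    cabs (al (mp_mx (c v))) < cabs (al (mp_mx (c t))) + 1 & `|w v| <= B /\ cabs (xi v) <= B].
  by near=> v; split; near: v.
have hd' v : `|v - t| < d -> [/\ curve_at c v (w v) (xi v),
    cabs (al (mp_mx (c v))) < cabs (al (mp_mx (c t))) + 1 & `|w v| <= B /\ cabs (xi v) <= B].
  by move=> hv; apply: hd; rewrite /= distrC.
apply: (@PG_curve R Gam hGam a b n c t d (cabs (al (mp_mx (c t))) + 1) B w xi) => // v /hd'[] //.
by move=> _ /ltW.
Unshelve. all: by end_near. Qed.

Lemma PG_curve_cst a b n (c : R -> Mp) (t : R) (w : R) (xi : R[i]) :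
  (5 <= n)%N -> (forall v, curve_at c v w xi) ->
  cderiv (fun v => PG Gam a b n (c v)) t
    (Dfun (fun a b n => PG Gam a b n (c t)) a b n w xi).
Proof.
move=> n5 hc.
apply: (@PG_curve_near a b n c t (`|w| + cabs xi) (fun=> w) (fun=> xi)) => //; near=> v => //.
by rewrite lerDl lerDr cabs_ge0 normr_ge0.
Unshelve. all: by end_near. Qed.

Lemma near_shift_gt (x u z : R) : z < x + u -> \forall v \near u, z < x + v.
Proof. by move=> h; exact: (cvgr_gt (x + u) (@cvg_shift R x u) z h). Qed.

(** The partial derivatives are combinations of series of the same family, with coefficients built
    from 1/y and [cis t]; the induction therefore runs over all a, b, n at once. *)
Lemma PG_smooth_aux k a b n : (5 <= n)%N -> cCn k (fun p => PG Gam a b n (iwasawa p)).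
Proof.
have cont a' b' n' p : (5 <= n')%N -> iwasawa_dom p ->
    ccvg (nbhs p) (fun q => PG Gam a' b' n' (iwasawa q)) (PG Gam a' b' n' (iwasawa p)).
  by move=> n5 dp; exact: (ccvg_comp (iwasawa_continuous dp) (PG_ccvg hGam _ _ _ n5)).
elim: k a b n => [|k ih] a b n n5.
  by split; split=> // p dp; have /ccvg_ReIm[] := cont a b n p n5 dp.
have n9 : (5 <= n.+4)%N by exact: leq_trans n5 (leq_addl 4 n).
(* The common shape of the three partial derivatives; here [w] includes the factor i. *)
have D (w xi : R3 -> R[i]) : (forall p, exists r : R, w p = 0 +i* r) -> cCn k w -> cCn k xi ->
    cCn k (fun p => xi p * a%:R * PG Gam a.-1 b n.+4 (iwasawa p)
      + conjc (xi p) * b%:R * PG Gam a b.-1 n (iwasawa p)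
      - xi p * (b%:R + n%:R / 2) * PG Gam a b.+1 n (iwasawa p)
      - w p * (2 * b%:R + n%:R / 2) * PG Gam a b n (iwasawa p)).
  move=> _ cw cxi; have ccxi := cCn_conj cxi.
  have C := @cCn_cst R k.
  apply: cCn_D; last by apply: cCn_N; apply: cCn_M; [exact: cCn_M|exact: ih].
  apply: cCn_D; last by apply: cCn_N; apply: cCn_M; [exact: cCn_M|exact: ih].
  by apply: cCn_D; apply: cCn_M; [exact: cCn_M|exact: ih|exact: cCn_M|exact: ih].
apply: cCn_succ; first by move=> p dp; exact: cont.
have cy := @cCn_inv_y R k; have ce := @cCn_cis R k.
have C := @cCn_cst R k.
have y2 p : iwasawa_dom p -> (2 * p.1.2)^-1%:C = (2^-1)%:C * (p.1.2%:C)^-1.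
  by move=> dp; rewrite -fmorphV -rmorphM invfM.
apply: dirsP.
- pose w (p : R3) : R[i] := (0 +i* (- 2^-1)) * (p.1.2%:C)^-1.
  pose xi (p : R3) : R[i] := (0 +i* (- 2^-1)) * (p.1.2%:C)^-1 * (cis p.2 * cis p.2).
  exists (fun p => Dfun (fun a b n => PG Gam a b n (iwasawa p)) a b n (- (2 * p.1.2)^-1)
    ((0 +i* (- (2 * p.1.2)^-1)) * cis p.2 ^+ 2)); split.
    case=> -[x y] t dp /=.
    have := @PG_curve_near a b n (fun v => iwasawa (x + v, y, t)) 0
      (`|- (2 * y)^-1| + cabs ((0 +i* (- (2 * y)^-1)) * cis t ^+ 2))
      (fun=> - (2 * y)^-1) (fun=> (0 +i* (- (2 * y)^-1)) * cis t ^+ 2) n5.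
    rewrite addr0 => H; apply: cderiv_congr (H _ _) => [v|||].
    + by rewrite dir_x.
    + by [].
    + by near=> v; exact: curve_x.
    + by near=> v; rewrite lerDl lerDr cabs_ge0 normr_ge0.
  apply: cCn_ext (D w xi _ _ _) => [p dp|p||].
  + rewrite /Dfun /w /xi.
    have -> : 0 +i* (- (2 * p.1.2)^-1) = (0 +i* (- 2^-1)) * (p.1.2%:C)^-1 :> R[i].
      rewrite -fmorphV; apply: ceq => /=; first by ring.
      by rewrite invfM; ring.
    by rewrite expr2.
  + by exists (- (2 * p.1.2)^-1); rewrite /w -fmorphV; apply: ceq => /=; [ring|rewrite invfM; ring].
  + exact: cCn_M.
  + by apply: cCn_M; apply: cCn_M.
- pose xi (p : R3) : R[i] := (2^-1)%:C * (p.1.2%:C)^-1 * (cis p.2 * cis p.2).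
  exists (fun p => Dfun (fun a b n => PG Gam a b n (iwasawa p)) a b n 0
    ((2 * p.1.2)^-1%:C * cis p.2 ^+ 2)); split.
    case=> -[x y] t dp /=; have y0 : 0 < y by exact: dp.
    have := @PG_curve_near a b n (fun v => iwasawa (x, y + v, t)) 0 (y^-1)
      (fun=> 0) (fun v => (2 * (y + v))^-1%:C * cis t ^+ 2) n5.
    rewrite addr0 => H; apply: cderiv_congr (H _ _) => [v|||].
    + by rewrite dir_y.
    + by [].
    + have := @near_shift_gt y 0 0; rewrite addr0 => /(_ y0).
      by apply: filterS => v; exact: curve_y.
    (* Where y + v > y / 2, the coefficient 1 / (2 (y + v)) is at most 1/y, the bound announced
       above. *)
    + have := @near_shift_gt y 0 (y / 2); rewrite addr0.
      have yh : y / 2 < y by rewrite ltr_pdivrMr // ltr_pMr //; lra.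
      move=> /(_ yh); apply: filterS => v hv.
      rewrite normr0 invr_ge0 ltW //; split=> //.
      have v0 : 0 < 2 * (y + v) by move: hv; lra.
      rewrite cabsM cabsX cabs_cis expr1n mulr1 cabs_real normfV gtr0_norm //.
      by rewrite lef_pV2 ?posrE //; move: hv; lra.
  apply: cCn_ext (D (fun=> 0) xi _ _ _) => [p dp|p||].
  + by rewrite /Dfun /xi y2 // -[0 +i* 0]/(0 : R[i]) expr2.
  + by exists 0.
  + exact: C.
  + by apply: cCn_M; apply: cCn_M.
- exists (fun p => Dfun (fun a b n => PG Gam a b n (iwasawa p)) a b n 1 0); split.
    case=> -[x y] t dp /=; have y0 : 0 < y by exact: dp.
    have := @PG_curve_cst a b n (fun v => iwasawa (x, y, t + v)) 0 1 0 n5.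
    rewrite addr0 => H; apply: cderiv_congr (H _) => [v||].
    + by rewrite dir_t.
    + by [].
    + by move=> v; exact: curve_t.
  apply: cCn_ext (D (fun=> 0 +i* 1) (fun=> 0) _ _ _) => [p dp|p||].
  + by [].
  + by exists 1.
  + exact: C.
  + exact: C.
Unshelve. all: by end_near. Qed.

Lemma PG_smooth a b n : (5 <= n)%N -> mp_smooth (PG Gam a b n).
Proof. by move=> n5 k; exact: PG_smooth_aux. Qed.

Lemma mp_deriv_eq e (F : Mp -> R[i]) s l :
  cderiv (fun t => F (s * mp_exp e t)%g) 0 l -> mp_deriv e F s = l.
Proof.
by move=> /cderiv_ReIm[[_ h1] [_ h2]]; rewrite /mp_deriv !derive1E; apply: ceq.
Qed.

(** The entries of E, H, W after the Cayley transform, in the notation of [curve_at]. *)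
Definition exp_w (e : sl2) : R := match e with slE => - 2^-1 | slH => 0 | slW => 1 end.
Definition exp_xi (e : sl2) : R[i] :=
  match e with slE => 0 +i* (- 2^-1) | slH => 1 | slW => 0 end.

Lemma mp_inj_mx s t : mp_mx s = mp_mx t -> mpN s = mpN t -> s = t.
Proof. by move=> h; apply: mp_inj; rewrite /mpZ h. Qed.

Lemma mp_a1 (h : 0 < 1 :> R) : mp_a h = 1%g.
Proof.
apply: mp_inj_mx; last by rewrite /mpN /mp_a mp_lift_eta_i !sqrtr1 invr1.
rewrite mp_mx1; apply/matrixP => i j; rewrite /= !mxE !sqrtr1 invr1.
by elim/ord2_ind: i; elim/ord2_ind: j.
Qed.

Lemma mp_n0 : mp_n (0 : R) = 1%g.
Proof.
apply: mp_inj_mx; last by rewrite /mpN /mp_n mp_lift_eta_i.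
rewrite mp_mx1; apply/matrixP => i j; rewrite /= !mxE.
by elim/ord2_ind: i; elim/ord2_ind: j.
Qed.

Lemma mp_kappa0 : mp_kappa (0 : R) = 1%g.
Proof.
apply: mp_inj_mx; last by rewrite /mpN /mp_kappa mp_lift_eta_i mul0r -/(cis 0) cis0.
rewrite mp_mx1; apply/matrixP => i j; rewrite /= !mxE cos0 sin0 oppr0.
by elim/ord2_ind: i; elim/ord2_ind: j.
Qed.

(** The subgroups of E and W are Iwasawa coordinate lines through 1. For H the coordinate is y = exp
    (2 t), not affine in t, so the derivative is computed directly. *)
Lemma exp_curve e (t : R) : curve_at (@mp_exp R e) t (exp_w e) (exp_xi e).
Proof.
case: e => /=.
- have h : 0 < 1 :> R by [].
  have E : (fun v => iwasawa (0 + v, 1, 0)) = @mp_n R.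
    by apply/funext => v; rewrite (@iwasawaE _ _ _ _ h) mp_a1 mp_kappa0 !mulg1 add0r.
  by have := @curve_x R 0 1 0 t h; rewrite E mulr1 cis0 expr1n mulr1.
- have E (v : R) : mp_a (expR_gt0 (2 * v)) = iwasawa (0, expR (2 * v), 0).
    have -> : iwasawa (0, expR (2 * v), 0) =
        (mp_n 0%R * mp_a (expR_gt0 (2 * v)) * mp_kappa 0%R)%g by exact: iwasawaE.
    by rewrite mp_n0 mp_kappa0 mul1g mulg1.
  have sq (v : R) : Num.sqrt (expR (2 * v)) = expR v :> R.
    by rewrite expRM_natl sqrtr_sqr ger0_norm // expR_ge0.
  have hal (v : R) : al (mp_mx (mp_a (expR_gt0 (2 * v)))) = ((expR v + (expR v)^-1) / 2)%:C.
    by rewrite E al_iwasawa ?expR_gt0 // cis0 mulr1 /al0 sq mul0r; apply: ceq => /=; ring.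
  have hbe (v : R) : be (mp_mx (mp_a (expR_gt0 (2 * v)))) = ((expR v - (expR v)^-1) / 2)%:C.
    by rewrite E be_iwasawa ?expR_gt0 // cis0 mulr1 /be0 sq mul0r; apply: ceq => /=; ring.
  have dE : is_derive t 1 expR (expR t) by exact: is_derive_expR.
  have dV : is_derive t 1 (fun v => (expR v)^-1) (- (expR t)^-1).
    have e0 : expR t != 0 by rewrite gt_eqF // expR_gt0.
    have := @is_deriveV R expR t _ 1 e0 dE.
    rewrite [X in is_derive _ _ _ X -> _](_ : _ = - (expR t)^-1) //.
    by rewrite /GRing.scale /=; field.
  have cE := cderiv_real dE; have cV := cderiv_real dV.
  split.
  + apply: cderiv_congr (cderivZ (2^-1)%:C (cderivD cE cV)) => [v|].
      by rewrite hal; apply: ceq => /=; ring.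
    by rewrite hal hbe; apply: ceq => /=; ring.
  + apply: cderiv_congr (cderivZ (2^-1)%:C (cderivD cE (cderivZ (-1) cV))) => [v|].
      by rewrite hbe; apply: ceq => /=; ring.
    by rewrite hal hbe; apply: ceq => /=; ring.
  + have -> : @mp_exp R slH = fun v => iwasawa (0, expR (2 * v), 0).
      by apply/funext => v; rewrite -E.
    apply: (@iwasawa_path R (fun v => (0, expR (2 * v), 0))); last exact: expR_gt0.
    apply: cvg_triple; [exact: cvg_cst| |exact: cvg_cst].
    apply: (@cvg_comp _ _ _ (fun v : R => 2 * v) expR _ (nbhs (2 * t))).
      by apply: cvgM; [exact: cvg_cst|exact: cvg_id].
    exact: continuous_expR.
- have h : 0 < 1 :> R by [].
  have E : (fun v => iwasawa (0, 1, 0 + v)) = @mp_kappa R.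
    by apply/funext => v; rewrite (@iwasawaE _ _ _ _ h) mp_a1 mp_n0 !mul1g add0r.
  by have := @curve_t R 0 1 0 t h; rewrite E.
Qed.

Lemma mp_exp0 e : @mp_exp R e 0 = 1%g.
Proof.
case: e => /=; [exact: mp_n0| |exact: mp_kappa0].
apply: mp_inj_mx.
  rewrite mp_mx1; apply/matrixP => i j; rewrite /= !mxE mulr0 expR0 !sqrtr1 invr1.
  by elim/ord2_ind: i; elim/ord2_ind: j.
by rewrite /mpN /mp_a mp_lift_eta_i mulr0 expR0 !sqrtr1 invr1.
Qed.

Lemma PG_cderiv_exp a b n e s : (5 <= n)%N ->
  cderiv (fun t => PG Gam a b n (s * mp_exp e t)%g) 0
    (Dfun (fun a b n => PG Gam a b n s) a b n (exp_w e) (exp_xi e)).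
Proof.
move=> n5; have := @PG_curve_cst a b n (fun t => s * mp_exp e t)%g 0 _ _ n5
  (fun v => curve_mul s (exp_curve e v)).
by rewrite mp_exp0 mulg1.
Qed.

End PoincareSmooth.

(** * The action of the center of the enveloping algebra *)

Section CenterAction.
Local Open Scope complex_scope.
Context {R : realType}.
Local Notation Mp := (metaplectic R).
Variables (Gam : set Mp) (hGam : discrete_subgroup Gam).
Variables (k n0 : nat).
Hypothesis n05 : (5 <= n0)%N.
Implicit Types (s : Mp) (a b i j n : nat) (c d : nat -> nat -> R[i]) (f g : Mp -> R[i]).

(* The right g-module generated by PG k 0 n0; [wvec i b] has weight n0 / 2 + 2 i + 2 b. *)
Definition wvec i b : Mp -> R[i] := PG Gam (k - i) b (n0 + 4 * i).

(** A relation between a finitely supported array of coefficients and the function it represents.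
    Since the [wvec i b] may be linearly dependent, a function does not determine its array;
    operators are defined on arrays and compared with derivatives through this relation. *)
Inductive rep : (nat -> nat -> R[i]) -> (Mp -> R[i]) -> Prop :=
| rep0 : rep (fun _ _ => 0) (fun=> 0)
| repS x i b c f : rep c f ->
    rep (fun i' b' => x * ((i' == i) && (b' == b))%:R + c i' b')
        (fun s => x * wvec i b s + f s).

(** [opL] and [opR] collect the terms of [Dfun] in xi and conj xi, [opW] those in w. On arrays, the
    first raises the weight by 2, the second lowers it by 2, and the third is diagonal. The factor
    [k - j] vanishes at j = k, so the truncated index in [wvec] is never reached from i <= k. *)
Definition opL c i b : R[i] :=
  (if i is j.+1 then (k - j)%N%:R * c j b else 0)
  - (if b is a.+1 then (a%:R + (n0%:R / 2 + 2 * i%:R)) * c i a else 0).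
Definition opR c i b : R[i] := b.+1%:R * c i b.+1.
Definition opW c i b : R[i] := - 'i * (2 * b%:R + (n0%:R / 2 + 2 * i%:R)) * c i b.

Definition rho1 (e : sl2) c i b : R[i] :=
  exp_xi e * opL c i b + conjc (exp_xi e) * opR c i b + (exp_w e)%:C * opW c i b.

Fixpoint rho (u : uenv R) c : nat -> nat -> R[i] :=
  match u with
  | UScal x => fun i b => x * c i b
  | UGen e => rho1 e c
  | UAdd u v => fun i b => rho u c i b + rho v c i b
  | UMul u v => rho u (rho v c)
  end.

Lemma rep_add c d f g : rep c f -> rep d g ->
  rep (fun i b => c i b + d i b) (fun s => f s + g s).
Proof.
move=> hc hd; elim: hc => [|x i b c' f' _ ih].
  rewrite (_ : (fun i b => _) = d); last by apply/funext => i; apply/funext => b; rewrite add0r.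
  by rewrite (_ : (fun s => _) = g) //; apply/funext => s; rewrite add0r.
rewrite (_ : (fun i b => _) = (fun i' b' => x * ((i' == i) && (b' == b))%:R + (c' i' b' + d i'
  b'))).
  rewrite (_ : (fun s => _) = (fun s => x * wvec i b s + (f' s + g s))); first exact: repS.
  by apply/funext => s; rewrite addrA.
by apply/funext => i'; apply/funext => b'; rewrite addrA.
Qed.

Lemma rep_scale y c f : rep c f -> rep (fun i b => y * c i b) (fun s => y * f s).
Proof.
elim=> [|x i b c' f' _ ih].
  rewrite (_ : (fun i b => _) = fun _ _ => 0); last by apply/funext => i; apply/funext => b;
    rewrite mulr0.
  by rewrite (_ : (fun s => _) = fun=> 0); [exact: rep0|apply/funext => s; rewrite mulr0].
rewrite (_ : (fun i b => _) = (fun i' b' => (y * x) * ((i' == i) && (b' == b))%:R + y * c' i' b')).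
  rewrite (_ : (fun s => _) = (fun s => (y * x) * wvec i b s + y * f' s)); first exact: repS.
  by apply/funext => s; rewrite mulrDr mulrA.
by apply/funext => i'; apply/funext => b'; rewrite mulrDr mulrA.
Qed.

Lemma rep_congr c c' f : (forall i b, c i b = c' i b) -> rep c f -> rep c' f.
Proof.
by move=> E; rewrite (_ : c' = c) //; apply/funext => i; apply/funext => b; rewrite E.
Qed.

Definition delta i b : nat -> nat -> R[i] := fun i' b' => ((i' == i) && (b' == b))%:R.

Lemma rep_delta i b : rep (delta i b) (wvec i b).
Proof.
have := repS 1 i b rep0.
rewrite (_ : (fun i' b' => _) = delta i b); last first.
  by apply/funext => i'; apply/funext => b'; rewrite addr0 mul1r.
by rewrite (_ : (fun s => _) = wvec i b) //; apply/funext => s; rewrite addr0 mul1r.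
Qed.

Lemma rep_wvec_deriv e i b : exists2 g, rep (rho1 e (delta i b)) g &
  forall s, cderiv (fun t => wvec i b (s * mp_exp e t)%g) 0 (g s).
Proof.
pose xi : R[i] := exp_xi e; pose w : R := exp_w e; pose n := (n0 + 4 * i)%N.
have n5 : (5 <= n)%N by exact: leq_trans n05 (leq_addr _ _).
exists (fun s => (xi * (k - i)%N%:R) * wvec i.+1 b s + (conjc xi * b%:R * wvec i b.-1 s +
    ((- (xi * (b%:R + n%:R / 2))) * wvec i b.+1 s + (- ((0 +i* w) * (2 * b%:R + n%:R / 2))) *
      wvec i b s))).
  have H := rep_add (rep_scale (xi * (k - i)%N%:R) (rep_delta i.+1 b))
    (rep_add (rep_scale (conjc xi * b%:R) (rep_delta i b.-1))
    (rep_add (rep_scale (- (xi * (b%:R + n%:R / 2))) (rep_delta i b.+1))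
       (rep_scale (- ((0 +i* w) * (2 * b%:R + n%:R / 2))) (rep_delta i b)))).
  apply: rep_congr H => i' b'.
  rewrite /rho1 -/xi -/w /opL /opR /opW /delta.
  have hn : n%:R / 2 = n0%:R / 2 + 2 * i%:R :> R[i] by rewrite /n natrD natrM; field.
  have hw : 0 +i* w = 'i * w%:C by apply: ceq => /=; ring.
  rewrite hn hw.
  (* These four identities evaluate the operators on a unit array: the support moves, and the
     coefficient is then that of the single index where the array is nonzero. *)
  have e1 : (if i' is j.+1 then (k - j)%N%:R * ((j == i) && (b' == b))%:R else 0) =
      (k - i)%N%:R * ((i' == i.+1) && (b' == b))%:R :> R[i].
    case: i' => [|j]; first by rewrite mulr0.
    by rewrite eqSS; case: eqVneq => [->|] //=; rewrite !mulr0.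
  have e2 : (if b' is a.+1 then (a%:R + (n0%:R / 2 + 2 * i'%:R)) * ((i' == i) && (a == b))%:R
    else 0) =
      (b%:R + (n0%:R / 2 + 2 * i%:R)) * ((i' == i) && (b' == b.+1))%:R :> R[i].
    case: b' {e1} => [|a]; first by rewrite andbF mulr0.
    rewrite eqSS; case: eqVneq => [->|] /=; last by rewrite !mulr0.
    by case: eqVneq => [->|] //=; rewrite !mulr0.
  have e3 : b'.+1%:R * ((i' == i) && (b'.+1 == b))%:R =
      b%:R * ((i' == i) && (b' == b.-1))%:R :> R[i].
    case: b {e1 e2} => [|a] /=; first by rewrite andbF mulr0 mul0r.
    rewrite eqSS; case: (i' == i) => /=; last by rewrite !mulr0.
    by case: (eqVneq b' a) => [->|_] //; rewrite !mulr0.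
  have e4 : (2 * b'%:R + (n0%:R / 2 + 2 * i'%:R)) * ((i' == i) && (b' == b))%:R =
      (2 * b%:R + (n0%:R / 2 + 2 * i%:R)) * ((i' == i) && (b' == b))%:R :> R[i].
    by case: eqVneq => [->|] /=; [case: eqVneq => [->|] //=; rewrite !mulr0|rewrite !mulr0].
  rewrite e1 e2 e3 -[- 'i * _ * _]mulrA e4; ring.
move=> s; have := @PG_cderiv_exp R Gam hGam (k - i) b n e s n5.
apply: cderiv_congr => //; rewrite /Dfun -/xi -/w.
have -> : PG Gam (k - i).-1 b n.+4 s = wvec i.+1 b s.
  by rewrite /wvec subnS; congr (PG Gam _ _ _ s); rewrite /n mulnS; lia.
by rewrite -![PG Gam _ _ n s]/(wvec i _ s); ring.
Qed.

Lemma rho1_lin e x c d i b : rho1 e (fun i b => x * c i b + d i b) i b =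
  x * rho1 e c i b + rho1 e d i b.
Proof. by rewrite /rho1 /opL /opR /opW; case: i => [|i]; case: b => [|b]; ring. Qed.

Lemma rep_deriv e c f : rep c f -> exists2 g, rep (rho1 e c) g &
  forall s, cderiv (fun t => f (s * mp_exp e t)%g) 0 (g s).
Proof.
elim=> [|x i b c' f' _ [g' hg' dg']].
  exists (fun=> 0); last by move=> s; exact: cderiv_cst.
  rewrite (_ : rho1 e _ = fun _ _ => 0); first exact: rep0.
  apply/funext => i; apply/funext => b.
  by rewrite /rho1 /opL /opR /opW; case: i => [|i]; case: b => [|b]; ring.
have [g hg dg] := rep_wvec_deriv e i b.
exists (fun s => x * g s + g' s).
  rewrite (_ : rho1 e _ = fun i' b' => x * rho1 e (delta i b) i' b' + rho1 e c' i' b').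
    exact: rep_add (rep_scale x hg) hg'.
  by apply/funext => i'; apply/funext => b'; rewrite rho1_lin.
by move=> s; exact: cderivD (cderivZ x (dg s)) (dg' s).
Qed.

Lemma rep_rho u c f : rep c f -> rep (rho u c) (uenv_act u f).
Proof.
elim: u c f => [x|e|u ihu v ihv|u ihu v ihv] c f h /=.
- exact: rep_scale.
- have [g hg dg] := rep_deriv e h.
  rewrite (_ : mp_deriv e f = g) //; apply/funext => s; exact: mp_deriv_eq.
- by apply: rep_add; [exact: ihu|exact: ihv].
- exact/ihu/ihv.
Qed.

Lemma rep_sum c f : rep c f -> exists n, forall n', (n <= n')%N -> forall s,
  f s = \sum_(i < n') \sum_(b < n') c i b * wvec i b s.
Proof.
elim=> [|x i b c' f' _ [n hn]].
  exists 0%N => n' _ s; rewrite big1 // => i _; rewrite big1 // => b _; exact: mul0r.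
exists (maxn n (maxn i.+1 b.+1)) => n'; rewrite !geq_max => /and3P[nn ni nb] s.
under eq_bigr do under eq_bigr do rewrite mulrDl.
under eq_bigr do rewrite big_split /=.
rewrite big_split /= -hn //; congr (_ + _).
rewrite (bigD1 (Ordinal ni)) //= (bigD1 (Ordinal nb)) //= !eqxx mulr1.
rewrite big1 ?addr0 => [|b' hb']; last first.
  have -> : (b' == b :> nat) = false by apply/negP => /eqP E; move/eqP: hb'; apply; exact: val_inj.
  by rewrite andbF mulr0 mul0r.
rewrite big1 ?addr0 // => i' hi'; rewrite big1 // => b' _.
have -> : (i' == i :> nat) = false by apply/negP => /eqP E; move/eqP: hi'; apply; exact: val_inj.
by rewrite mulr0 mul0r.
Qed.

Lemma rho_lin u x c d i b : rho u (fun i b => x * c i b + d i b) i b =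
  x * rho u c i b + rho u d i b.
Proof.
elim: u c d i b => [y|e|u ihu v ihv|u ihu v ihv] c d i b /=.
- ring.
- exact: rho1_lin.
- by rewrite ihu ihv; ring.
- rewrite -ihu; congr (rho u _ i b); apply/funext => i'; apply/funext => b'; exact: ihv.
Qed.

Lemma rho_add u c d i b : rho u (fun i b => c i b + d i b) i b = rho u c i b + rho u d i b.
Proof.
rewrite -[X in _ = X + _]mul1r -rho_lin; congr (rho u _ i b).
by apply/funext => i'; apply/funext => b'; rewrite mul1r.
Qed.

Lemma rho_scale u x c i b : rho u (fun i b => x * c i b) i b = x * rho u c i b.
Proof.
have z : rho u (fun _ _ => 0) i b = 0.
  have E : (fun _ _ : nat => -1 * 0 + 0 : R[i]) = fun _ _ => 0.
    by apply/funext => i'; apply/funext => b'; ring.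
  have := rho_lin u (-1) (fun _ _ => 0) (fun _ _ => 0) i b.
  by rewrite E => ->; ring.
have := rho_lin u x c (fun _ _ => 0) i b; rewrite z addr0 => <-.
by congr (rho u _ i b); apply/funext => i'; apply/funext => b'; rewrite addr0.
Qed.

(** With the next two lemmas, the relations of sl_2 in a basis of weight vectors. They are
    identities between arrays, whatever relations hold between the functions. *)
Lemma opLR c i b : opL (opR c) i b - opR (opL c) i b = 'i * opW c i b.
Proof.
have i2 : 'i * - 'i = 1 :> R[i] by apply: ceq => /=; ring.
have -> : 'i * opW c i b = 'i * - 'i * ((2 * b%:R + (n0%:R / 2 + 2 * i%:R)) * c i b).
  by rewrite /opW; ring.
rewrite i2 mul1r /opL /opR.
by case: i => [|i]; case: b => [|b]; rewrite -?natr1; ring.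
Qed.

Lemma opWL c i b : opW (opL c) i b - opL (opW c) i b = - (2 * 'i) * opL c i b.
Proof.
rewrite /opL /opW.
by case: i => [|i]; case: b => [|b]; rewrite -?natr1; ring.
Qed.

Lemma opWR c i b : opW (opR c) i b - opR (opW c) i b = 2 * 'i * opR c i b.
Proof.
rewrite /opR /opW.
by case: i => [|i]; case: b => [|b]; rewrite -?natr1; ring.
Qed.

Lemma opL_lin (x y z : R[i]) c1 c2 c3 i b :
  opL (fun i b => x * c1 i b + y * c2 i b + z * c3 i b) i b =
  x * opL c1 i b + y * opL c2 i b + z * opL c3 i b.
Proof. by rewrite /opL; case: i => [|i]; case: b => [|b]; ring. Qed.

Lemma rho1_comm e e' c i b : rho1 e (rho1 e' c) i b - rho1 e' (rho1 e c) i b =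
  (exp_xi e * conjc (exp_xi e') - conjc (exp_xi e) * exp_xi e') * ('i * opW c i b)
  + (exp_w e)%:C * (exp_xi e' * (- (2 * 'i) * opL c i b) + conjc (exp_xi e') * (2 * 'i * opR c i b))
  - (exp_w e')%:C * (exp_xi e * (- (2 * 'i) * opL c i b) + conjc (exp_xi e) * (2 * 'i * opR c i b)).
Proof.
rewrite -opLR -opWL -opWR {1 3}/rho1.
rewrite !(opL_lin (exp_xi e')) !(opL_lin (exp_xi e)).
have oR x y z c1 c2 c3 : opR (fun i b => x * c1 i b + y * c2 i b + z * c3 i b) i b =
   x * opR c1 i b + y * opR c2 i b + z * opR c3 i b by rewrite /opR; ring.
have oW x y z c1 c2 c3 : opW (fun i b => x * c1 i b + y * c2 i b + z * c3 i b) i b =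
   x * opW c1 i b + y * opW c2 i b + z * opW c3 i b by rewrite /opW; ring.
rewrite !oR !oW.
move: (exp_xi e) (exp_xi e') (conjc _) (conjc _) (exp_w e)%:C (exp_w e')%:C => *.
ring.
Qed.

Lemma rho_UVec X c i b : rho (UVec X) c i b =
  (sl2_coord X slE)%:C * rho1 slE c i b +
  ((sl2_coord X slH)%:C * rho1 slH c i b + (sl2_coord X slW)%:C * rho1 slW c i b).
Proof. by []. Qed.

Lemma sl2_bracketE (e e' : sl2) (i j : 'I_2) : sl2_bracket e e' i j =
  (sl2_mx e i 0 * sl2_mx e' 0 j + sl2_mx e i 1 * sl2_mx e' 1 j
  - (sl2_mx e' i 0 * sl2_mx e 0 j + sl2_mx e' i 1 * sl2_mx e 1 j)) :> R.
Proof. by rewrite /sl2_bracket [LHS]mxE [X in _ + X]mxE !mulmx22. Qed.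

Lemma rho_lie e e' c i b : rho1 e (rho1 e' c) i b =
  rho1 e' (rho1 e c) i b + rho (UVec (sl2_bracket e e')) c i b.
Proof.
apply/eqP; rewrite addrC -subr_eq rho1_comm rho_UVec; apply/eqP.
rewrite /sl2_coord !sl2_bracketE /rho1.
move: (opL c i b) (opR c i b) (opW c i b) => [l1 l2] [r1 r2] [w1 w2].
by case: e; case: e'; rewrite /= !mxE /=; apply: ceq => /=; field.
Qed.

(** All the generating relations hold on every array, so centrality modulo [uenv_eq] turns into
    commutation of operators on arrays. *)
Lemma rho_eq u v : uenv_eq u v -> forall c i b, rho u c i b = rho v c i b.
Proof.
elim=> {u v}.
- by [].
- by move=> u v _ ih c i b; rewrite ih.
- by move=> u v w _ ih1 _ ih2 c i b; rewrite ih1 ih2.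
- by move=> u u' v v' _ ih1 _ ih2 c i b /=; rewrite ih1 ih2.
- move=> u u' v v' _ ih1 _ ih2 c i b /=; rewrite ih1; congr (rho u' _ i b).
  by apply/funext => i'; apply/funext => b'; exact: ih2.
- by move=> u v c i b /=; rewrite addrC.
- by move=> u v w c i b /=; rewrite addrA.
- by move=> u c i b /=; rewrite mul0r add0r.
- by [].
- by [].
- by move=> u v w c i b /=; exact: rho_add.
- by move=> u c i b /=; rewrite mul1r.
- by move=> u c i b /=; rewrite !mul0r.
- by move=> x y c i b /=; rewrite mulrDl.
- by move=> x y c i b /=; rewrite mulrA.
- by move=> x u c i b /=; rewrite rho_scale.
- by move=> e e' c i b; exact: rho_lie.
Qed.

Lemma rho1_W c i b : rho1 slW c i b = opW c i b.
Proof. by rewrite /rho1 /exp_xi /exp_w conjc0 rmorph1 !mul0r mul1r !add0r. Qed.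

(* A central element commutes with slW, whose eigenvalues separate the vector of lowest
   weight from the others. *)
Lemma center_scalar z : uenv_center z ->
  exists x : R[i], forall s, uenv_act z (wvec 0 0) s = x * wvec 0 0 s.
Proof.
move=> hz; set d := rho z (delta 0 0).
have W00 : rho1 slW (delta 0 0) = fun i b => (- 'i * (n0%:R / 2)) * delta 0 0 i b.
  apply/funext => i; apply/funext => b; rewrite rho1_W /opW /delta.
  by case: i => [|i]; case: b => [|b] /=; ring.
have hd i b : opW d i b = (- 'i * (n0%:R / 2)) * d i b.
  have := rho_eq (hz (UGen slW)) (delta 0 0) i b => /=.
  by rewrite W00 rho_scale -/d => ->; rewrite -rho1_W.
have d0 i b : (i, b) <> (0, 0)%N -> d i b = 0.
  move=> ib; have := hd i b; rewrite /opW => h; apply/eqP; apply/negPn/negP => dn.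
  have := mulIf dn h => {}h.
  have /(mulfI (_ : - 'i != 0)) : - 'i * (2 * b%:R + (n0%:R / 2 + 2 * i%:R)) = - 'i * (n0%:R / 2)
    := h.
  have i0 : - 'i != 0 :> R[i] by rewrite oppr_eq0 -normr_eq0 normCi oner_eq0.
  move=> /(_ i0) h2.
  have : (2 * (i + b))%:R = 0 :> R[i].
    by rewrite natrM natrD; apply: (addIr (n0%:R / 2)); rewrite add0r -[RHS]h2; ring.
  move/eqP; rewrite pnatr_eq0 muln_eq0 /= addn_eq0 => /andP[/eqP i00 /eqP b00].
  by apply: ib; rewrite i00 b00.
exists (d 0%N 0%N) => s.
have [n hn] := rep_sum (rep_rho z (rep_delta 0 0)).
rewrite (hn n.+1 (leqnSn n)) -/d big_ord_recl big_ord_recl /=.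
rewrite big1 ?addr0 => [|b _]; last by rewrite d0 ?mul0r.
by rewrite big1 ?addr0 // => i _; rewrite big1 // => b _; rewrite d0 ?mul0r.
Qed.

Lemma center_finite : finite_dim_span [set uenv_act z (PG Gam k 0 n0) | z in @uenv_center R].
Proof.
exists 1%N, (fun=> PG Gam k 0 n0) => _ [z hz <-].
have [x hx] := center_scalar hz; exists (fun=> x) => s.
by rewrite big_ord1; have := hx s; rewrite /wvec subn0 muln0 addn0.
Qed.

Lemma theta_kappa s (t : R) : theta (s * mp_kappa t)%g = theta s * (cis (t / 2))^-1.
Proof.
by rewrite /theta mpZ_kappaM mpN_kappaM mulrA [in RHS]invfM !invfM !mulrA.
Qed.

Lemma be_kappaM s (t : R) : be (mp_mx (s * mp_kappa t)%g) = be (mp_mx s) * cis t.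
Proof. by rewrite mp_mxM beM al_kappa be_kappa mulr0 addr0. Qed.

(** The factor is the character exp (- i n0 t / 2), left in the form in which be and theta
    contribute to it. *)
Lemma K_finite : finite_dim_span [set (fun s => PG Gam k 0 n0 (s * h)%g) | h in @mp_K R].
Proof.
exists 1%N, (fun=> PG Gam k 0 n0) => _ [_ [t _ <-] <-].
exists (fun=> cis t ^+ k * (cis (t / 2))^-1 ^+ (n0 + 2 * k)) => s.
rewrite big_ord1 /PG -(csumZ _ (orbit_bound_sum hGam s)); last first.
  by move=> g; exact: Gfun_orbit_bound.
congr csum; apply/funext => g.
rewrite /Gfun mulgA be_kappaM theta_kappa !expr0 !mulr1 muln0 addn0.
move: (be _) (theta _) (cis t) (_^-1) => B T x y.
by rewrite !(exprMn _ B) (exprMn _ T); ring.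
Qed.

End CenterAction.

(** * Unfolding and square-integrability *)

Section MeasureTools.
Local Open Scope ereal_scope.
Context {R : realType}.

(** [sel] is chosen before the summands: a family depending on a point is enumerated alike at all
    points, and results on series over [nat] yield measurability and the interchange with integrals.
    Indices that enumerate nothing contribute 0. *)
Lemma esum_enum (J : choiceType) (D : set J) : countable D ->
  exists sel : nat -> option J, forall a : J -> \bar R, (forall j, 0 <= a j) ->
    \esum_(j in D) a j = \sum_(n <oo) (if sel n is Some j then a j else 0).
Proof.
move=> /countable_injP[f finj].
pose sel n := if pselect (exists2 j, D j & f j = n) is left h
  then Some (projT1 (cid2 h)) else None.
exists sel => a a0.
have selE j : D j -> sel (f j) = Some j.
  move=> Dj; rewrite /sel; case: pselect => [h|[]]; last by exists j.
  by congr Some; case: (cid2 h) => i /= Di ij; apply: finj; rewrite ?inE.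
pose b n := if sel n is Some j then a j else 0.
have b0 n : 0 <= b n by rewrite /b; case: (sel n).
rewrite nneseries_esumT // (eq_esum (_ : forall j, D j -> a j = b (f j))); last first.
  by move=> j Dj; rewrite /b selE.
rewrite -(esum_image D f b finj) esum_mkcond; apply: eq_esum => n _.
case: ifPn => // /negP nD; rewrite /sel; case: pselect => // -[j Dj jn].
by case: nD; rewrite inE; exists j.
Qed.

Section Esum.
Context d (T : measurableType d) (mu : {measure set T -> \bar R}).
Context (J : choiceType) (D : set J) (f : J -> T -> \bar R).
Hypothesis cD : countable D.
Hypothesis mf : forall j, measurable_fun [set: T] (f j).
Hypothesis f0 : forall j x, 0 <= f j x.

Lemma measurable_esum : measurable_fun [set: T] (fun x => \esum_(j in D) f j x).
Proof.
have [sel h] := esum_enum cD.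
rewrite (_ : (fun x => _) = fun x => \sum_(n <oo) (if sel n is Some j then f j x else 0)).
  by apply: ge0_emeasurable_sum => [n x _ _|n _]; case: (sel n).
by apply/funext => x; exact: h.
Qed.

Lemma integral_esum :
  \int[mu]_x (\esum_(j in D) f j x) = \esum_(j in D) (\int[mu]_x f j x).
Proof.
have [sel h] := esum_enum cD.
rewrite (h (fun j => \int[mu]_x f j x)); last by move=> j; exact: integral_ge0.
rewrite (eq_integral (fun x => \sum_(n <oo) (if sel n is Some j then f j x else 0))); last first.
  by move=> x _; exact: (h (f^~ x)).
rewrite integral_nneseries //; last 2 first.
- by move=> n; case: (sel n).
- by move=> n x _; case: (sel n).
apply: eq_eseriesr => n _; case: (sel n) => //; exact: integral0.
Qed.

End Esum.

Section Density.
Context d (T : measurableType d) (mu : {measure set T -> \bar R}) (w : T -> R).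
Hypotheses (mw : measurable_fun [set: T] w) (w0 : forall x, (0 <= w x)%R).

Import HBNNSimple.

(** The measure sends A to the integral of w over A. The formula holds for indicators, hence for
    simple functions, and passes to the limit by monotone convergence. *)
Lemma density_measure : exists nu : {measure set T -> \bar R},
  forall f, (forall x, 0 <= f x) -> measurable_fun [set: T] f ->
    \int[nu]_x f x = \int[mu]_x (f x * (w x)%:E).
Proof.
pose g x := (w x)%:E.
have mg : measurable_fun [set: T] g by exact/measurable_EFinP.
have g0 x : 0 <= g x by rewrite lee_fin.
pose nu0 A := \int[mu]_(x in A) g x.
have nu00 : nu0 set0 = 0 by exact: integral_set0.
have nu0_ge0 A : 0 <= nu0 A by exact: integral_ge0.
have nu0_sa : semi_sigma_additive nu0 by exact: semi_sigma_additive_nng_induced.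
pose nu0M := isMeasure.Build d T R nu0 nu00 nu0_ge0 nu0_sa.
pose nu : {measure set T -> \bar R} := HB.pack nu0 nu0M.
have nuE A : nu A = \int[mu]_(x in A) g x by [].
exists nu => f f0 mf; symmetry.
have mE := @measurableT _ T.
pose h := nnsfun_approx mE mf.
have -> : \int[nu]_x f x = lim (\int[nu]_x (EFin \o h n) x @[n --> \oo]).
  have fE x : f x = lim ((EFin \o h n) x @[n --> \oo]).
    by apply/esym/cvg_lim => //; exact: cvg_nnsfun_approx.
  under eq_integral => x _ do rewrite fE.
  apply: monotone_convergence => //.
  - by move=> n; apply/measurable_EFinP; exact/measurable_funP.
  - by move=> n x _ /=; rewrite lee_fin.
  - by move=> x _ a b ab; rewrite lee_fin; exact/lefP/nd_nnsfun_approx.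
have -> : \int[mu]_x (f x * g x) =
    lim (\int[mu]_x ((EFin \o h n) \* g) x @[n --> \oo]).
  have fg x : f x * g x = lim (((EFin \o h n) \* g) x @[n --> \oo]).
    by apply/esym/cvg_lim => //; apply: cvgeZr => //; exact: cvg_nnsfun_approx.
  under eq_integral => x _ do rewrite fg.
  apply: monotone_convergence => [//| | |].
  - by move=> n; apply/emeasurable_funM => //; exact/measurable_EFinP.
  - by move=> n x _ /=; rewrite mule_ge0 ?lee_fin ?g0.
  - by move=> x _ a b ab/=; rewrite lee_wpmul2r ?lee_fin ?g0//; exact/lefP/nd_nnsfun_approx.
suff suf n : \int[mu]_x ((EFin \o h n) x * g x) = \int[nu]_x (EFin \o h n) x.
  by under eq_fun do rewrite suf.
transitivity (\int[nu]_x
   (\sum_(y \in range (h n)) (y * \1_(h n @^-1` [set y]) x)%:E)); last first.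
  by apply: eq_integral => t tE; rewrite /= fimfunE -fsumEFin.
have indich m r : measurable_fun [set: T] (fun x => (r * \1_(h m @^-1` [set r]) x)%:E).
  by apply: (measurable_comp measurableT) => //; exact: measurable_funM.
rewrite ge0_integral_fsum//; last by move=> m y Ey; exact: nnfun_muleindic_ge0.
transitivity (\int[mu]_x (\sum_(y \in range (h n))
    (y * \1_(h n @^-1` [set y]) x)%:E * g x)).
  under [RHS]eq_integral => x xE.
    rewrite -ge0_mule_fsuml => [|y]; last exact: nnfun_muleindic_ge0.
    rewrite fsumEFin // -(fimfunE _ x); over.
  by [].
rewrite ge0_integral_fsum//; last 2 first.
  - by move=> y; apply: emeasurable_funM.
  - by move=> m y Ey; rewrite mule_ge0 ?g0// nnfun_muleindic_ge0.
apply: eq_fsbigr => r rhn.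
under [RHS]eq_integral do rewrite EFinM.
rewrite integralZl_indic_nnsfun => //.
under eq_integral do rewrite EFinM -muleA.
rewrite ge0_integralZl//.
- under eq_integral do rewrite muleC.
  rewrite (eq_integral (g \_ (h n @^-1` [set r]))); last first.
    by move=> x xE; rewrite epatch_indic.
  by rewrite -integral_mkcondr -nuE// integral_indic// setIC.
- by apply: emeasurable_funM => //; exact/measurable_EFinP.
- by move=> t Et; rewrite mule_ge0 ?lee_fin ?g0.
- by move: rhn; rewrite inE => -[t _ <-]; rewrite lee_fin.
Qed.

End Density.

(** The upper level sets suffice. For lower semicontinuous functions they are generators of the
    Borel sets, and if the function is invariant also of [quot_borel]. *)
Lemma gsigma_measurable (T : pointedType) (G : set (set T)) (f : T -> \bar R) :
  (forall r : R, G [set x | r%:E < f x]) ->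
  measurable_fun (setT : set (g_sigma_algebraType G)) (f : g_sigma_algebraType G -> \bar R).
Proof.
move=> hG; apply: (measurability _ (ErealGenOInfty.measurableE R)).
move=> _ [_ [r ->] <-]; rewrite setTI preimage_itvoy; apply: sub_sigma_algebra.
exact: hG.
Qed.

End MeasureTools.

(** * Sums of nonnegative families *)

Section PositiveSums.
Local Open Scope complex_scope.
Context {R : realType}.

Lemma esumZl (J : choiceType) (D : set J) (c : R) (a : J -> \bar R) : countable D ->
  (0 <= c) -> (forall j, (0 <= a j)%E) ->
  (\esum_(j in D) (c%:E * a j) = c%:E * \esum_(j in D) a j)%E.
Proof.
move=> cD c0 a0; have [sel h] := @esum_enum R J D cD.
rewrite !h //; last by move=> j; rewrite mule_ge0 ?lee_fin.
rewrite -nneseriesZl; last by move=> n _; case: (sel n).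
by apply: eq_eseriesr => n _; case: (sel n) => //; rewrite mule0.
Qed.

Context {I : choiceType}.
Implicit Types (b : I -> R) (B : {fset I}).

(** A number strictly below the supremum is exceeded by a finite partial sum. Upper level sets of
    sums of continuous functions are thus unions of open sets. *)
Lemma esum_gt_fsum b (r : R) :
  (r%:E < \esum_(i in [set: I]) (b i)%:E)%E <-> exists B, r < \sum_(i <- B) b i.
Proof.
split=> [/ereal_sup_gt[_ [X [finX _] <-]]|[B hB]].
  by rewrite fsbig_finite //= sumEFin lte_fin => h; exists (fset_set X).
apply: (@lt_le_trans _ _ (\sum_(i <- B) b i)%:E); first by rewrite lte_fin.
apply: ereal_sup_ubound; exists [set` B]; first by split=> //; exact: finite_fset.
by rewrite fsbig_finite ?set_fsetK ?sumEFin //; exact: finite_fset.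
Qed.

Lemma esum_le_fsum b (K : R) : (forall B, \sum_(i <- B) b i <= K) ->
  (\esum_(i in [set: I]) (b i)%:E <= K%:E)%E.
Proof.
move=> hK; rewrite leNgt; apply/negP => /esum_gt_fsum[B].
by rewrite ltNge hK.
Qed.

Definition rsum b : R := cRe (csum (fun i => (b i)%:C)).

Let cabs_b b i : fsum_bounded b -> cabs (b i)%:C <= b i.
Proof. by move=> hb; rewrite cabs_real ger0_norm //; exact: hb.1. Qed.

Lemma rsum_le b (K : R) : fsum_bounded b -> (forall B, \sum_(i <- B) b i <= K) -> rsum b <= K.
Proof.
move=> hb hK; apply: le_trans (cRe_le_cabs _) _.
by apply: (csum_le hb) => // i; exact: cabs_b.
Qed.

Lemma fsum_le_rsum b B : fsum_bounded b -> \sum_(i <- B) b i <= rsum b.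
Proof.
move=> hb; apply/ler_addgt0Pr => e e0.
have [B0 hB0] := csum_tail hb e0.
have := hB0 _ (fun i => cabs_b i hb) (B0 `|` B)%fset (fsubsetUl _ _).
move=> /(le_trans (norm_cRe _)); rewrite raddfB /= cRe_sum /= => h.
apply: le_trans (fsum_le hb.1 (fsubsetUr B0 B)) _.
by move: h; rewrite ler_norml => /andP[h _]; move: h; rewrite /rsum; lra.
Qed.

Lemma esum_rsum b : fsum_bounded b -> (\esum_(i in [set: I]) (b i)%:E = (rsum b)%:E)%E.
Proof.
move=> hb; apply/eqP; rewrite eq_le esum_le_fsum /=; last by move=> B; exact: fsum_le_rsum.
rewrite leNgt; apply/negP => h.
have h0 : (0 <= \esum_(i in [set: I]) (b i)%:E)%E.
  by apply: esum_ge0 => i _; rewrite lee_fin hb.1.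
have hf : (\esum_(i in [set: I]) (b i)%:E)%E \is a fin_num.
  by rewrite ge0_fin_numE //; apply: lt_trans h (ltry _).
move: h; rewrite -(fineK hf) lte_fin ltNge => /negP; apply.
apply: rsum_le => // B; rewrite leNgt; apply/negP => hB.
have : ((fine (\esum_(i in [set: I]) (b i)%:E)%E)%:E < \esum_(i in [set: I]) (b i)%:E)%E.
  by apply/esum_gt_fsum; exists B.
by rewrite fineK // ltxx.
Qed.

Lemma fsum_continuous (T : topologicalType) (f : I -> T -> R) B :
  (forall i, continuous (f i)) -> continuous (fun x => \sum_(i <- B) f i x).
Proof.
move=> hf x; elim: (enum_fset B) => [|i s IHs].
  rewrite (_ : (fun y => _) = fun=> 0); first exact: cvg_cst.
  by apply/funext => y; rewrite big_nil.
rewrite (_ : (fun y => _) = fun y => f i y + \sum_(j <- s) f j y); last first.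
  by apply/funext => y; rewrite big_cons.
by apply: cvgD => //; exact: hf.
Qed.

End PositiveSums.

(** * Integrability of the majorant on the group *)

Section Unfolding.
Local Open Scope complex_scope.
Context {R : realType}.
Local Notation Mp := (metaplectic R).
Implicit Types (s t g : Mp) (phi : Mp -> R).
Variables (mu : {measure set (@mp_borel R) -> \bar R}) (hmu : haar_measure mu).

Lemma borel_measurable (f : Mp -> \bar R) : (forall r : R, open [set s | (r%:E < f s)%E]) ->
  measurable_fun [set: @mp_borel R] (f : @mp_borel R -> \bar R).
Proof. by move=> hf; exact: gsigma_measurable. Qed.

Lemma continuous_open_gt phi (r : R) : continuous phi -> open [set s | (r%:E < (phi s)%:E)%E].
Proof.
move=> hphi; under eq_set do rewrite lte_fin.
by apply: (open_comp _ (@open_gt _ r)) => s _; exact: hphi.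
Qed.

Lemma continuous_borel phi : continuous phi ->
  measurable_fun [set: @mp_borel R] ((fun s => (phi s)%:E) : @mp_borel R -> \bar R).
Proof. by move=> hphi; apply: borel_measurable => r; exact: continuous_open_gt. Qed.

Lemma translation_measurable g :
  measurable_fun [set: @mp_borel R] ((fun s => (g * s)%g) : @mp_borel R -> @mp_borel R).
Proof.
have E : @measurable _ (@mp_borel R) = <<s @open Mp >> by [].
apply: (measurability _ E).
move=> _ [U oU <-]; rewrite setTI; apply: sub_sigma_algebra.
by apply: (open_comp _ oU) => s _; exact: mp_mulg_continuous.
Qed.

Lemma integral_translate g (f : @mp_borel R -> \bar R) : (forall s, (0 <= f s)%E) ->
  measurable_fun [set: @mp_borel R] f ->
  (\int[mu]_s f ((g : Mp) * s)%g = \int[mu]_s f s)%E.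
Proof.
move=> f0 mf; have [inv _ _] := hmu.
have mg := translation_measurable g.
rewrite -[LHS](ge0_integral_pushforward mg mu measurableT mf) //.
by apply: eq_measure_integral => A mA _; exact: inv.
Qed.

Definition theta5 s : R := cabs (theta s) ^+ 5.

Lemma theta5_continuous : continuous theta5.
Proof.
move=> s; exact: (continuous_comp (@cabs_theta_continuous R s) (@exprn_continuous R 5 _)).
Qed.

Lemma theta5_gt0 s : 0 < theta5 s.
Proof. by rewrite exprn_gt0 // cabs_theta_gt0. Qed.

Lemma mpX_continuous : continuous (fun s : Mp => cRe (mpZ s)).
Proof. by move=> s; have /ccvg_ReIm[h _] := @mpZ_ccvg R s. Qed.

Lemma mpY_continuous : continuous (fun s : Mp => cIm (mpZ s)).
Proof. by move=> s; have /ccvg_ReIm[_ h] := @mpZ_ccvg R s. Qed.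

(** The preimage of a rectangle with room for any cell of the grid once the corner of the cell is
    moved to i. *)
Definition box : set Mp := [set s | 0 <= cRe (mpZ s) <= 1 /\ 1 <= cIm (mpZ s) <= 2].

Lemma box_image : box =
  (@iwasawa R) @` ((`[0, 1] `*` `[1, 2]) `*` `[0, 4 * pi]).
Proof.
apply/seteqP; split=> [s [hX hY]|_ [p [[/= hx hy] ht] <-]].
  have [p [dp hp E]] := iwasawa_onto s.
  exists p; last exact: E.
  by move: hX hY; rewrite -E mpZ_iwasawa //= => hx hy; rewrite !in_itv.
move: hx hy; rewrite !in_itv /= => hx hy.
have dp : iwasawa_dom p by rewrite /iwasawa_dom /=; case/andP: hy => hy _; lra.
by rewrite /box /= mpZ_iwasawa.
Qed.

Lemma compact_box : compact box.
Proof.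
rewrite box_image; apply: continuous_compact.
  apply: continuous_in_subspaceT => p; rewrite inE => -[[_ hy] _].
  apply: iwasawa_continuous; move: hy; rewrite /= in_itv /= => /andP[hy _].
  by rewrite /iwasawa_dom /=; lra.
by apply: compact_setX; [apply: compact_setX|]; exact: segment_compact.
Qed.

Lemma measurable_box : measurable (box : set (@mp_borel R)).
Proof.
have cl (h : Mp -> R) (a b : R) : continuous h -> closed [set s | a <= h s <= b].
  move=> hc; have -> : [set s | a <= h s <= b] = h @^-1` `[a, b]%classic.
    by apply/seteqP; split=> s; rewrite /= in_itv.
  by apply: preimage_closed; [move=> s _; exact: hc|exact: itv_closed].
have oC : open (~` box).
  by apply: closed_openC; apply: closedI; apply: cl; [exact: mpX_continuous|exact: mpY_continuous].
by rewrite -(setCK box); apply: measurableC; apply: sub_sigma_algebra.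
Qed.

Definition e16 : R := 1 / 16.

Lemma e16_itv : 0 < e16 <= 1 / 16.
Proof. by rewrite lexx andbT divr_gt0. Qed.

(** The element that carries i to the corner of the cell of the upper half-plane with indices
    [c]. *)
Definition celln (c : int * int) : Mp :=
  (mp_n (c.2%:~R * (e16 * celly e16 c.1)) * mp_a (@celly_gt0 R e16 c.1))%g.

Lemma mpZ_naM (x y : R) (y0 : 0 < y) s :
  mpZ (mp_n x * mp_a y0 * s)%g = y%:C * mpZ s + x%:C.
Proof.
rewrite mpZM_E mp_mx_na !mxE /=.
have r0 : Num.sqrt y != 0 by rewrite gt_eqF // sqrtr_gt0.
have E : y = Num.sqrt y * Num.sqrt y by rewrite -expr2 sqr_sqrtr // ltW.
move: r0 E; move: (Num.sqrt y) => r r0 ->.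
have -> : (0 : R)%:C * mpZ s + (r^-1)%:C = (r^-1)%:C by rewrite rmorph0 mul0r add0r.
rewrite -fmorphV /= invrK; case: (mpZ s) => u v.
by apply: ceq => /=; field.
Qed.

Lemma cell_box s : box ((celln (cell e16 s).1)^-1 * s)%g.
Proof.
set t := (_ * s)%g.
have E : s = (celln (cell e16 s).1 * t)%g by rewrite mulgA mulgV mul1g.
have := celly_itv e16_itv s; have := celll_itv e16_itv s.
have := mpZ_naM ((celll e16 s)%:~R * (e16 * celly e16 (cellj e16 s)))
  (@celly_gt0 R e16 (cellj e16 s)) t.
have -> : (mp_n ((celll e16 s)%:~R * (e16 * celly e16 (cellj e16 s))) *
  mp_a (celly_gt0 e16 (cellj e16 s)) * t)%g = s by [].
have := @celly_gt0 R e16 (cellj e16 s).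
rewrite /box /=; rewrite intrD rmorph1; move: (celly _ _) ((celll _ _)%:~R) => y l y0 ->;
  case: (mpZ t) => X Y /=.
rewrite !mul0r !subr0 !addr0 => /andP[h1 h2] /andP[h3 h4].
have e0 : e16 = 1/16 by [].
rewrite mulrDl mul1r in h2.
split; apply/andP; split.
- by rewrite -(pmulr_rge0 X y0); lra.
- rewrite -(ler_pM2l y0) mulr1; move: h2; rewrite e0; lra.
- by rewrite -(ler_pM2l y0) mulr1; lra.
- rewrite -(ler_pM2l y0); move: h4; rewrite e0; lra.
Qed.

Lemma cellw_ge0 c : 0 <= cellw e16 c.
Proof. by have [h _] := cellw_sum e16_itv; exact: h. Qed.

Lemma integral_theta5 : (\int[mu]_s (theta5 s)%:E < +oo)%E.
Proof.
have [inv fin _] := hmu.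
pose f (c : int * int) (s : @mp_borel R) : \bar R :=
  ((cellw e16 c)%:E * (\1_box (((celln c : Mp)^-1 * s)%g : @mp_borel R) : R)%:E)%E.
have cZ : countable [set: int * int] by exact: countableP.
have m1 c : measurable_fun [set: @mp_borel R]
    (fun s : @mp_borel R => (\1_box (((celln c : Mp)^-1 * s)%g : @mp_borel R) : R)%:E).
  apply/measurable_EFinP; apply: (measurableT_comp (measurable_indic measurable_box)).
  exact: translation_measurable.
have mf c : measurable_fun [set: @mp_borel R] (f c).
  exact: measurable_funeM.
have f0 c s : (0 <= f c s)%E by rewrite mule_ge0 ?lee_fin ?cellw_ge0.
apply: (@le_lt_trans _ _ (\int[mu]_s \esum_(c in [set: int * int]) f c s)%E).
  apply: ge0_le_integral => //.
  - by move=> s _; rewrite lee_fin ltW // theta5_gt0.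
  - exact: continuous_borel theta5_continuous.
  - exact: measurable_esum.
  (* A single term suffices, that of the cell of s, because s lies in the corresponding translate of
     [box]. *)
  move=> s _; apply: esum_ge; exists [set (cell e16 s).1].
    by split=> //; exact: finite_set1.
  rewrite fsbig_set1 /f indicE mem_set; last exact: cell_box.
  by rewrite mule1 lee_fin; exact: theta_cell e16_itv s.
rewrite integral_esum //.
have E c : (\int[mu]_s f c s = mu box * (cellw e16 c)%:E)%E.
  rewrite /f ge0_integralZl_EFin ?cellw_ge0 //.
  have := @integral_translate (celln c)^-1%g (fun s => (\1_box s : R)%:E) _ _.
  move=> ->; [|by move=> s; rewrite lee_fin|].
    by rewrite integral_indic //; [rewrite setIT muleC|exact: measurable_box].
  by apply/measurable_EFinP; exact: (measurable_indic measurable_box).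
rewrite (eq_esum (fun c _ => E c)).
have muf : mu box \is a fin_num by rewrite ge0_fin_numE //; exact: fin compact_box.
have b0 : 0 <= fine (mu box) by exact: fine_ge0.
rewrite -(fineK muf) (esumZl cZ b0); last by move=> c; rewrite lee_fin cellw_ge0.
have [_ hK] := cellw_sum e16_itv.
apply: le_lt_trans (lee_wpmul2l _ (esum_le_fsum hK)) _; first by rewrite lee_fin fine_ge0.
by rewrite -EFinM ltry.
Qed.

End Unfolding.

(** * The quotient measure and the unfolding formula *)

Section QuotientMeasure.
Local Open Scope complex_scope.
Context {R : realType}.
Local Notation Mp := (metaplectic R).
Implicit Types (s t g : Mp) (phi : Mp -> R).
Variables (mu : {measure set (@mp_borel R) -> \bar R}) (hmu : haar_measure mu).
Variables (Gam : set Mp) (hGam : discrete_subgroup Gam).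

(** The grid, taken at s = 1, injects Gamma into a countable set of cells. *)
Lemma Gam_countable : countable Gam.
Proof.
have [e [_ inj]] := discrete_grid hGam.
apply/countable_injP; exists (fun s => choice.pickle (cell e s)) => s t.
rewrite !inE => hs ht /(pcan_inj choice.pickleK) E.
have := inj 1%g (SigSub (mem_set hs)) (SigSub (mem_set ht)).
by rewrite /= !mul1g => /(_ E) /(congr1 val).
Qed.

Lemma esum_Gam (a : Mp -> \bar R) :
  (\esum_(g in Gam) a g = \esum_(g in [set: Gam]) a (val g))%E.
Proof.
apply: (reindex_esum [set: Gam]); split.
- by move=> g _; exact: set_valP.
- by move=> g h _ _; exact: val_inj.
- by move=> g hg; exists (SigSub (mem_set hg)).
Qed.

Lemma GamM s t : Gam s -> Gam t -> Gam (s * t)%g.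
Proof.
have [[G1 GV] _] := hGam.
by move=> hs ht; have := GV _ _ hs (GV _ _ G1 ht); rewrite mul1g invgK.
Qed.

Lemma GamV s : Gam s -> Gam s^-1%g.
Proof. by have [[G1 GV] _] := hGam => hs; have := GV _ _ G1 hs; rewrite mul1g. Qed.

Lemma esum_GamM g (a : Mp -> \bar R) : Gam g ->
  (\esum_(h in Gam) a (h * g)%g = \esum_(h in Gam) a h)%E.
Proof.
move=> hg; symmetry; apply: reindex_esum; split.
- by move=> h /= hh; exact: GamM.
- by move=> h h' _ _ /mulIg.
- by move=> h hh; exists (h * g^-1)%g; [apply: GamM => //; exact: GamV|rewrite mulgVK].
Qed.

Lemma esum_GamV (a : Mp -> \bar R) :
  (\esum_(h in Gam) a h^-1%g = \esum_(h in Gam) a h)%E.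
Proof.
symmetry; apply: reindex_esum; split.
- by move=> h /= hh; exact: GamV.
- by move=> h h' _ _ /invg_inj.
- by move=> h hh; exists h^-1%g; [exact: GamV|rewrite invgK].
Qed.

Definition thetaS s : R := rsum (orbit_bound (Gam := Gam) s).

Lemma thetaS_esum s : (\esum_(g in Gam) (theta5 (g * s)%g)%:E = (thetaS s)%:E)%E.
Proof. by rewrite esum_Gam -(esum_rsum (orbit_bound_sum hGam s)). Qed.

Lemma theta5_le_thetaS s : theta5 s <= thetaS s.
Proof.
have [[G1 _] _] := hGam.
have := fsum_le_rsum [fset (SigSub (mem_set G1) : Gam)]%fset (orbit_bound_sum hGam s).
by rewrite big_seq_fset1 /orbit_bound /= mul1g.
Qed.

Lemma thetaS_gt0 s : 0 < thetaS s.
Proof. exact: lt_le_trans (theta5_gt0 s) (theta5_le_thetaS s). Qed.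

Lemma thetaS_bounded : exists K, forall s, thetaS s <= K.
Proof.
have [K hK] := theta_orbit_sum hGam; exists K => s.
by apply: rsum_le (orbit_bound_sum hGam s) _; exact: (hK s).2.
Qed.

Lemma cabs_PG_le a b n s : (5 <= n)%N -> cabs (PG Gam a b n s) <= thetaS s.
Proof.
move=> n5; apply: (csum_le (orbit_bound_sum hGam s)) => [g|B].
  exact: Gfun_orbit_bound.
by apply: fsum_le_rsum; exact: orbit_bound_sum.
Qed.

Lemma thetaS_invariant g s : Gam g -> thetaS (g * s)%g = thetaS s.
Proof.
move=> hg; have := thetaS_esum (g * s)%g.
under eq_esum do rewrite mulgA.
by rewrite (esum_GamM (fun h => (theta5 (h * s)%g)%:E) hg) thetaS_esum => -[].
Qed.

Lemma thetaS_continuous : continuous thetaS.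
Proof.
move=> s; have hb := orbit_bound_sum hGam s.
have hb' : fsum_bounded (fun g : Gam => 4 ^+ 5 * orbit_bound s g).
  by apply: fsum_boundedZ => //; exact: exprn_ge0.
have ob0 t (g : Gam) : 0 <= orbit_bound t g by rewrite exprn_ge0 ?cabs_ge0.
have : ccvg (nbhs s) (fun t => csum (fun g : Gam => (orbit_bound t g)%:C))
    (csum (fun g : Gam => (orbit_bound s g)%:C)).
  apply: (ccvg_csum hb') => [|g|g].
  - have := @al_near R s; apply: filterS => t ht g.
    rewrite cabs_real ger0_norm //.
    have := @orbit_boundM R Gam s (s^-1 * t)%g 2 g; rewrite mulgA mulgV mul1g.
    have -> : 2 * 2 = 4 :> R by ring.
    by apply => //; lra.
  - rewrite cabs_real ger0_norm // ler_peMl // exprn_ege1 //; lra.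
  - apply: ccvg_real.
    exact: (continuous_comp (@mp_mulg_continuous R (val g) s) (@theta5_continuous R _)).
by move=> /ccvg_ReIm[].
Qed.

Definition cutoff s : R := theta5 s / thetaS s.

Lemma cutoff_ge0 s : 0 <= cutoff s.
Proof. by rewrite divr_ge0 // ltW // ?theta5_gt0 // thetaS_gt0. Qed.

Lemma cutoff_continuous : continuous cutoff.
Proof.
move=> s.
have S0 : thetaS s != 0 by rewrite gt_eqF // thetaS_gt0.
have cV := @cvgV R _ (nbhs s) (nbhs_filter s) _ _ S0 (@thetaS_continuous s).
exact: (@cvgM R _ (nbhs s) (nbhs_filter s) _ _ _ _ (@theta5_continuous R s) cV).
Qed.

Lemma cutoff_sum s : (\esum_(g in Gam) (cutoff (g * s)%g)%:E = 1)%E.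
Proof.
have c0 : 0 <= (thetaS s)^-1 by rewrite invr_ge0 ltW // thetaS_gt0.
transitivity (\esum_(g in Gam) ((thetaS s)^-1%:E * (theta5 (g * s)%g)%:E))%E.
  by apply: eq_esum => g hg; rewrite /cutoff thetaS_invariant // EFinM muleC.
rewrite (esumZl Gam_countable c0); last by move=> g; rewrite lee_fin ltW // theta5_gt0.
by rewrite thetaS_esum -EFinM mulVf // gt_eqF // thetaS_gt0.
Qed.

Lemma esum_orbit_open phi (r : R) : continuous phi ->
  open [set s | (r%:E < \esum_(g in Gam) (phi (g * s)%g)%:E)%E].
Proof.
move=> hphi.
have -> : [set s | (r%:E < \esum_(g in Gam) (phi (g * s)%g)%:E)%E] =
    \bigcup_(B in [set: {fset Gam}]) [set s | r < \sum_(g <- B) phi (val g * s)%g].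
  apply/seteqP; split=> s /=; rewrite esum_Gam (esum_gt_fsum (fun g : Gam => phi (val g * s)%g)).
    by move=> [B hB]; exists B.
  by move=> [B _ hB]; exists B.
apply: bigcup_open => B _; apply: (open_comp _ (@open_gt _ r)) => s _.
apply: (@fsum_continuous _ _ _ (fun (g : Gam) t => phi (val g * t)%g)) => g t.
exact: (continuous_comp (@mp_mulg_continuous R (val g) t) (hphi _)).
Qed.

(** The sets of [quot_borel Gam] are Borel, so the identity map pushes the measure of density
    [cutoff] forward. Invariant functions with open upper level sets are measurable directly from
    the generators; they include both the orbit sums in the unfolding formula and the squared
    absolute value of a Poincare series. *)
Lemma quot_measure_exists : exists nu : {measure set (quot_borel Gam) -> \bar R},
  forall f : Mp -> \bar R, (forall s, (0 <= f s)%E) ->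
    (forall r : R, open [set s | (r%:E < f s)%E]) ->
    (forall g s, Gam g -> f (g * s)%g = f s) ->
  (\int[nu]_s f s = \int[mu]_s (f s * (cutoff s)%:E))%E.
Proof.
have mw : measurable_fun [set: @mp_borel R] (cutoff : @mp_borel R -> R).
  by apply/measurable_EFinP; exact: continuous_borel cutoff_continuous.
have [d hd] := density_measure mu mw cutoff_ge0.
pose q : @mp_borel R -> quot_borel Gam := id.
have mq : measurable_fun [set: @mp_borel R] q.
  have E : @measurable _ (quot_borel Gam) =
      <<s [set U : set Mp | open U /\ forall g s, Gam g -> U s -> U (g * s)%g] >> by [].
  apply: (measurability _ E).
  by move=> _ [U [oU _] <-]; rewrite setTI; apply: sub_sigma_algebra.
exists (pushforward d q) => f f0 fo fi.
have mf : measurable_fun [set: quot_borel Gam] (f : quot_borel Gam -> \bar R).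
  apply: gsigma_measurable => r; split; first exact: fo.
  by move=> g s hg /=; rewrite fi.
rewrite (ge0_integral_pushforward mq d measurableT mf) // preimage_setT.
by rewrite (hd f) //; exact: borel_measurable.
Unshelve. exact: mq.
Qed.

(** In each term the substitution s -> g^-1 s moves the translation from phi to the weight, by
    invariance of mu; the translated weights then add up to 1. *)
Lemma unfolding phi : continuous phi -> (forall s, 0 <= phi s) ->
  (\int[mu]_s ((\esum_(g in Gam) (phi (g * s)%g)%:E) * (cutoff s)%:E) =
   \int[mu]_s (phi s)%:E)%E.
Proof.
move=> hphi phi0.
have tr g h : continuous h -> continuous (fun s => (h (g * s)%g : R)).
  by move=> hh s; exact: (continuous_comp (@mp_mulg_continuous R g s) (hh _)).
have pos g h s : (0 <= (phi (g * s)%g * cutoff (h * s)%g)%:E)%E.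
  by rewrite lee_fin mulr_ge0 // cutoff_ge0.
have meas g h : measurable_fun [set: @mp_borel R]
    ((fun s => (phi (g * s)%g * cutoff (h * s)%g)%:E) : @mp_borel R -> \bar R).
  apply: continuous_borel => s.
  exact: (@cvgM R _ (nbhs s) (nbhs_filter s) _ _ _ _ (tr g phi hphi s) (tr h cutoff
    cutoff_continuous s)).
(* The trivial translations by 1 give both sums the shape to which [pos] and [meas] apply. *)
transitivity (\int[mu]_s (\esum_(g in Gam) (phi (g * s)%g * cutoff (1 * s)%g)%:E))%E.
  apply: eq_integral => s _; rewrite muleC -(esumZl Gam_countable (cutoff_ge0 s)) => [|g];
    last by rewrite lee_fin.
  by apply: eq_esum => g _; rewrite -EFinM mulrC mul1g.
rewrite (integral_esum mu Gam_countable) //.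
transitivity (\esum_(g in Gam) \int[mu]_s (phi (1 * s)%g * cutoff (g^-1 * s)%g)%:E)%E.
  apply: eq_esum => g hg.
  have := @integral_translate R mu hmu g (fun s => (phi (1 * s)%g * cutoff (g^-1 * s)%g)%:E)
    (fun s => pos 1%g g^-1%g s) (meas _ _).
  by move=> <-; apply: eq_integral => s _; rewrite !mul1g mulKg.
rewrite -(integral_esum mu Gam_countable) //.
apply: eq_integral => s _; rewrite mul1g.
under eq_esum do rewrite EFinM.
rewrite (esumZl Gam_countable (phi0 s)); last by move=> g; rewrite lee_fin cutoff_ge0.
by rewrite (esum_GamV (fun g => (cutoff (g * s)%g)%:E)) cutoff_sum mule1.
Qed.

Lemma PG_square_integrable a b n : (5 <= n)%N -> square_integrable Gam mu (PG Gam a b n).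
Proof.
move=> n5; have [nu hnu] := quot_measure_exists; exists nu.
  move=> phi hphi phi0 _; rewrite hnu ?unfolding // => [s|r|g s hg].
  - by apply: esum_ge0 => g _; rewrite lee_fin.
  - exact: esum_orbit_open.
  - under eq_esum do rewrite mulgA.
    exact: (esum_GamM (fun h => (phi (h * s)%g)%:E)).
pose F s := cabs (PG Gam a b n s) ^+ 2.
have F0 s : 0 <= F s by rewrite exprn_ge0 ?cabs_ge0.
have Fc : continuous F.
  move=> s; apply: (continuous_comp _ (@exprn_continuous R 2 _)).
  exact: (@ccvg_cabs R _ (nbhs s) (nbhs_filter s) _ _ (PG_ccvg hGam _ _ _ n5)).
rewrite (hnu (fun s => (F s)%:E)) => [|s|r|g s hg]; last 3 first.
- by rewrite lee_fin.
- exact: continuous_open_gt.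
- by rewrite /F (PG_left_invariant hGam).
have [K hK] := thetaS_bounded.
have K0 : 0 <= K by apply: le_trans (hK 1%g); rewrite ltW // thetaS_gt0.
have mth : measurable_fun [set: @mp_borel R] ((fun s => (theta5 s)%:E) : @mp_borel R -> \bar R).
  exact: continuous_borel (@theta5_continuous R).
have th0 s : (0 <= (theta5 s)%:E)%E by rewrite lee_fin ltW // theta5_gt0.
apply: (@le_lt_trans _ _ (\int[mu]_s (K%:E * (theta5 s)%:E))%E); last first.
  by rewrite ge0_integralZl_EFin //; exact: lte_mul_pinfty (integral_theta5 hmu).
apply: ge0_le_integral => //.
- by move=> s _; rewrite mule_ge0 // lee_fin // cutoff_ge0.
- apply: (@continuous_borel R (fun s => F s * cutoff s)) => s.
  exact: (@cvgM R _ (nbhs s) (nbhs_filter s) _ _ _ _ (Fc s) (@cutoff_continuous s)).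
- exact: measurable_funeM.
move=> s _; rewrite -!EFinM lee_fin /cutoff.
have S0 := thetaS_gt0 s; have t0 := theta5_gt0 s.
rewrite mulrA ler_pdivrMr // [leRHS]mulrAC; apply: ler_wpM2r; first exact: ltW.
apply: le_trans (_ : thetaS s ^+ 2 <= _).
  apply: lerXn2r; rewrite ?nnegrE ?cabs_ge0 //; first exact: ltW.
  exact: cabs_PG_le.
by rewrite expr2 ler_wpM2r // ltW.
Qed.

End QuotientMeasure.

Theorem lemma6p2 (R : realType)
    (mu : {measure set (@mp_borel R) -> \bar R}) (hmu : haar_measure mu)
    (k : nat) (m : rat) (hm : exists n : nat, m = 5 / 2 + n%:R)
    (Gam : set (metaplectic R)) (hGam : discrete_subgroup Gam) :
  [/\ abs_series_cvg_compact Gam (F_km k m),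
      automorphic_form Gam mu (poincare Gam (F_km k m)) &
      exists M : R, forall s, cabs (poincare Gam (F_km k m) s) <= M].
Proof.
have [n ->] := hm; have n5 : (5 <= 5 + 2 * n)%N by exact: leq_addr.
have n0 : (0 < 5 + 2 * n)%N by [].
have -> : poincare Gam (F_km k (5 / 2 + n%:R)) = PG Gam k 0 (5 + 2 * n).
  by apply/funext => s; exact: poincareE.
split.
- have -> : F_km k (5 / 2 + n%:R) = @Gfun R k 0 (5 + 2 * n).
    by apply/funext => s; exact: F_kmE.
  exact: abs_series_PG.
- split.
  + split; first exact: PG_smooth.
    by move=> g s hg; exact: PG_left_invariant.
  + exact: PG_square_integrable.
  + exact: K_finite.
  + exact: center_finite.
- exact: PG_bounded.
Qed.
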